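(* Let $n\ge1$, $0<\alpha<n$, $0<q\le\infty$ and $1/r=1-\alpha/n$. Let $\Phi:[0,\infty)\to[0,\infty)$ be a function onto $[0,\infty)$, positive on $(0,\infty)$, which is equivalent to a strictly increasing function, such that $\Phi(0)=0$, for every $c>0$ one has $\Phi(cs)\approx\Phi(s)$ for all $s>0$ (with constants that may depend on $c$), and $$\int_0^s\left(\frac{\Phi(u)}{u^{n}}\right)^{1/r}\frac{du}{u}\prec\left(\frac{\Phi(s)}{s^{n}}\right)^{1/r}\quad\text{for all } s>0 .$$ Put $\Phi_\alpha(s)=\Phi\big(s^{\frac{1}{n-\alpha}}\big)$. Then $$Cap^{\Phi_\alpha}(b^\alpha_{1,q})=C^\Phi .$$
   Context: Notation: $X\prec Y$ means $X\le cY$ with a finite constant $c>0$ independent of the variables in question; $X\approx Y$ means $X\prec Y$ and $Y\prec X$. Two functions $\Phi,\widetilde\Phi$ on $[0,\infty)$ are equivalent if $\Phi\approx\widetilde\Phi$. $\mathbf R^{n+1}_+=\mathbf R^n\times(0,\infty)$. For an open set $O\subset\mathbf R^n$ the tent over $O$ is $TO=\{(x,t)\in\mathbf R^{n+1}_+: x\in O,\ t<\mathrm{dist}(x,\partial O)\}$ (the distance is $+\infty$ if $\partial O=\emptyset$). Homogeneous Sobolev space $w^m_1$ ($m$ a positive integer): the closure of $C_0^\infty(\mathbf R^n)$ with respect to the norm $\|f\|_{w^m_1}=\sum_{|\kappa|=m}\|D^\kappa f\|_{L^1}$. Homogeneous Besov space: $b^\alpha_{1,q}=(L^1,w^m_1)_{\alpha/m,q}$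 with $0<\alpha<m$, where $(\cdot,\cdot)_{\theta,q}$ is the real interpolation method, i.e. $\|f\|_{(A_0,A_1)_{\theta,q}}=\big(\int_0^\infty(t^{-\theta}K(t,f))^q\,\frac{dt}{t}\big)^{1/q}$ (supremum if $q=\infty$), $K(t,f)=\inf_{f=f_0+f_1}(\|f_0\|_{A_0}+t\|f_1\|_{A_1})$. Capacity of an open set $O\subset\mathbf R^n$: $cap(O;b^\alpha_{1,q})=\inf\{\|f\|_{b^\alpha_{1,q}}: f\in\mathcal S,\ f\ge0,\ f(x)\ge1\text{ if }x\in O\}$, where $\mathcal S$ is the Schwartz class on $\mathbf R^n$ (infimum of the empty set is $+\infty$, and a condition of the form $\mu(TO)\prec\Phi(+\infty)$ is regarded as void). Classes of positive Borel measures $\mu$ on $\mathbf R^{n+1}_+$, for a positive function $\Theta$ on $(0,\infty)$ with $\Theta(0)=0$: $\mu\in Cap^{\Theta}(b^\alpha_{1,q})$ iff $\mu(TO)\prec\Theta(cap(O;b^\alpha_{1,q}))$ uniformly for all open sets $O\subset\mathbf R^n$; $\mu\in C^{\Theta}$ iff $\mu(TB_r)\prec\Theta(r)$ uniformly for all balls $B_r\subset\mathbf R^n$ of radius $r>0$. *)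

(* Defs.v *)
From HB Require Import structures.
From mathcomp Require Import all_boot all_order all_algebra.
From mathcomp Require Import all_classical all_reals all_analysis.

Set Implicit Arguments.
Unset Strict Implicit.
Unset Printing Implicit Defensive.

Import Order.TTheory GRing.Theory Num.Theory.
Import numFieldNormedType.Exports.

Local Open Scope classical_set_scope.
Local Open Scope ring_scope.

Notation borel T := (g_sigma_algebraType (@open T)).

Section coordinates.
Context {R : realType}.

Lemma open_measurable_borel (T : ptopologicalType) (U : set T) :
  open U -> measurable (U : set (borel T)).
Proof. by move=> oU; exact: sub_sigma_algebra. Qed.

Lemma measurable_coord n (i : 'I_n) :
  measurable_fun setT ((fun x => x ord0 i) : borel 'rV[R]_n -> R).
Proof.
apply: (measurability _ (measurable_realfun.RGenOpens.measurableE R)).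
move=> _ [_ [a [b ->]] <-]; rewrite setTI.
apply: open_measurable_borel; apply: open_comp; last exact: interval_open.
by move=> x _; exact: coord_continuous.
Qed.

Lemma ball_rVE n (x : 'rV[R]_n) (e : R) : 0 < e ->
  ball x e = [set y | forall i, ball (x ord0 i) e (y ord0 i)].
Proof.
move=> e0; apply/seteqP; split => y /=.
  by move=> [_ H] i; exact: H.
by move=> H; split => // i j; rewrite (ord1 i).
Qed.

Lemma measurable_to_rV d (T : measurableType d) n (f : T -> 'rV[R]_n) :
  (forall i, measurable_fun setT (fun t => f t ord0 i)) ->
  measurable_fun setT (f : T -> borel 'rV[R]_n).
Proof.
move=> mf; apply: (@measurability _ _ _ (borel 'rV[R]_n) setT f (@open 'rV[R]_n)) => //.
move=> _ [U oU <-]; rewrite setTI.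
pose c (p : 'rV[rat]_n) : 'rV[R]_n := map_mx ratr p.
pose e (k : nat) : R := k.+1%:R^-1.
pose B (p : 'rV[rat]_n * nat) : set 'rV[R]_n :=
  if `[< ball (c p.1) (e p.2) `<=` U >] then ball (c p.1) (e p.2) else set0.
have e0 k : 0 < e k by rewrite invr_gt0.
have UE : U = \bigcup_(k : nat) oapp B set0 (unpickle k).
  apply/seteqP; split => [x Ux|x [k _]]; last first.
    case: (unpickle k) => //= p; rewrite /B; case: asboolP => // BU; exact: BU.
  have [r /= r0 rU] : exists2 r : R, 0 < r & ball x r `<=` U.
    by apply/nbhs_ballP; exact: open_nbhs_nbhs.
  have [k kr] : exists k, e k < r / 2.
    have r20 : 0 < r / 2 by rewrite divr_gt0.
    have [N _ /(_ N (leqnn _)) H] := near_infty_natSinv_lt (PosNum r20).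
    by exists N.
  have /choice[q qP] (i : 'I_n) : exists q : rat, ball (x ord0 i) (e k) (ratr q).
    have /rat_in_itvoo[q] : x ord0 i - e k < x ord0 i + e k.
      by rewrite ltrD2l gtrN.
    by move=> /itvP qx; exists q; rewrite /ball/= ltr_distlC !qx.
  exists (pickle ((\row_i q i) : 'rV[rat]_n, k)) => //.
  rewrite pickleK /B /=.
  have xB : ball (c (\row_i q i)) (e k) x.
    rewrite ball_rVE// => i /=; rewrite !mxE; exact: ball_sym.
  case: asboolP => // nBU; case: nBU => y By; apply: rU.
  rewrite (splitr r); apply: (@ball_triangle _ _ (c (\row_i q i))).
    by exact/(le_ball (ltW kr))/ball_sym.
  exact: (le_ball (ltW kr) By).
rewrite UE preimage_bigcup; apply: bigcup_measurable => k _.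
case: (unpickle k) => [p|]; last by rewrite preimage_set0.
rewrite /= /B; case: asboolP => [BU|nBU]; last by rewrite preimage_set0.
rewrite ball_rVE //.
rewrite (_ : _ @^-1` _ = \bigcap_(i in [set: 'I_n])
   ((fun t => f t ord0 i) @^-1` ball (c p.1 ord0 i) (e p.2))).
  apply: fin_bigcap_measurable => // i _.
  rewrite -[X in measurable X]setTI; apply: mf => //.
  by apply: measurable_realfun.open_measurable; exact: ball_open.
by apply/seteqP; split => t /= H i; [move=> _|]; exact: H.
Qed.

End coordinates.

Section lebesgue_Rn.
Context {R : realType}.
Local Open Scope ereal_scope.

Lemma product_sigma_finite d1 d2 (T1 : measurableType d1)
    (T2 : measurableType d2) (m1 : {sigma_finite_measure set T1 -> \bar R})
    (m2 : {sigma_finite_measure set T2 -> \bar R}) :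
  sigma_finite setT (m1 \x m2).
Proof.
have /sigma_finiteP[F [TF ndF Foo]] := sigma_finiteT m1.
have /sigma_finiteP[G [TG ndG Goo]] := sigma_finiteT m2.
exists (fun k => F k `*` G k).
  rewrite -setXTT TF TG; apply/seteqP; split => -[x y].
    move=> [/= [i _ Fix] [j _ Gjy]]; exists (maxn i j) => //; split.
    - by move: x Fix; exact/subsetPset/ndF/leq_maxl.
    - by move: y Gjy; exact/subsetPset/ndG/leq_maxr.
  by move=> [i _ []/= ? ?]; split; exists i.
move=> k; have [? ?] := Foo k; have [? ?] := Goo k.
split; first exact: measurableX.
by rewrite product_measure1E// lte_mul_pinfty// ge0_fin_numE.
Qed.

Section step.
Variables (n : nat) (m : {sigma_finite_measure set (borel 'rV[R]_n) -> \bar R}).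

Definition consR (p : measurableTypeR R * borel 'rV[R]_n) : borel 'rV[R]_n.+1 :=
  row_mx (p.1)%:M (p.2 : 'rV[R]_n) : 'rV[R]_(1 + n).

Definition lebesgue_step : set (borel 'rV[R]_n.+1) -> \bar R :=
  pushforward (lebesgue_measure \x m) consR.

Let measurable_consR : measurable_fun setT consR.
Proof.
apply: measurable_to_rV => i.
case: (split_ordP (i : 'I_(1 + n))) => j ->.
  rewrite (_ : (fun t => _) = fst); first exact: measurable_fst.
  apply/funext => t; apply: (etrans (row_mxEl _ _ _ _)).
  by rewrite (ord1 j) mxE eqxx mulr1n.
rewrite (_ : (fun t => _) = (fun x : borel 'rV[R]_n => x ord0 j) \o snd).
  exact: measurableT_comp (measurable_coord j) measurable_snd.
by apply/funext => t; exact: row_mxEr.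
Qed.

Let lebesgue_step0 : lebesgue_step set0 = 0.
Proof. by rewrite /lebesgue_step /pushforward preimage_set0 measure0. Qed.

Let lebesgue_step_ge0 A : 0 <= lebesgue_step A.
Proof. exact: measure_ge0. Qed.

Let lebesgue_step_sigma_additive : semi_sigma_additive lebesgue_step.
Proof.
move=> F mF tF mUF; rewrite /lebesgue_step /pushforward preimage_bigcup.
apply: measure_semi_sigma_additive.
- by move=> k; rewrite -[X in measurable X]setTI; exact: measurable_consR.
- apply/trivIsetP => /= i j _ _ ij; rewrite -preimage_setI.
  by move/trivIsetP : tF => /(_ _ _ _ _ ij) ->//; rewrite preimage_set0.
- rewrite -preimage_bigcup -[X in measurable X]setTI.
  exact: measurable_consR.
Qed.

HB.instance Definition _ := isMeasure.Build _ _ _ lebesgue_step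
  lebesgue_step0 lebesgue_step_ge0 lebesgue_step_sigma_additive.

Let lebesgue_step_sigma_finite : sigma_finite setT lebesgue_step.
Proof.
have [F FT Foo] := product_sigma_finite lebesgue_measure m.
pose tl (x : borel 'rV[R]_n.+1) : measurableTypeR R * borel 'rV[R]_n :=
  (x ord0 ord0, rsubmx (x : 'rV[R]_(1 + n))).
have tlK p : tl (consR p) = p.
  case: p => x y; congr pair; last exact: row_mxKr.
  rewrite /consR (_ : ord0 = lshift n (ord0 : 'I_1)); last exact/val_inj.
  by apply: (etrans (row_mxEl _ _ _ _)); rewrite mxE eqxx mulr1n.
have mtl : measurable_fun setT tl.
  apply/measurable_fun_pairP; split; first exact: measurable_coord.
  apply: measurable_to_rV => i.
  rewrite (_ : (fun t => _) = fun x : borel 'rV[R]_n.+1 => x ord0 (rshift 1 i)).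
    exact: measurable_coord.
  by apply/funext => x; rewrite /= mxE.
exists (fun k => tl @^-1` F k).
  by rewrite -preimage_bigcup -FT preimage_setT.
move=> k; have [mFk Fkoo] := Foo k; split.
  by rewrite -[X in measurable X]setTI; exact: mtl.
rewrite /lebesgue_step /pushforward (_ : _ @^-1` _ = F k)//.
by apply/seteqP; split => p /=; rewrite tlK.
Qed.

HB.instance Definition _ := Measure_isSigmaFinite.Build _ _ _ lebesgue_step
  lebesgue_step_sigma_finite.

End step.

Fixpoint lebesgueRn n : {sigma_finite_measure set (borel 'rV[R]_n) -> \bar R} :=
  if n is k.+1 then lebesgue_step (lebesgueRn k)
  else \d_((0%R : 'rV[R]_0) : borel 'rV[R]_0).

Lemma lebesgueRn_box n (A : 'I_n -> set R) :
  (forall i, measurable (A i)) ->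
  lebesgueRn n [set x | forall i, A i (x ord0 i)] =
  \prod_(i < n) lebesgue_measure (A i).
Proof.
elim: n A => [|n IH] A mA.
  rewrite big_ord0 /= diracE mem_set//= => -[].
  by [].
pose B := [set y : borel 'rV[R]_n | forall i, A (lift ord0 i) (y ord0 i)].
have consRB : @consR n @^-1` [set x | forall i, A i (x ord0 i)] = A ord0 `*` B.
  have E (p : R * 'rV[R]_n) i :
      consR p ord0 (lift ord0 i) = p.2 ord0 i.
    rewrite (_ : lift ord0 i = rshift 1 i); last exact/val_inj.
    exact: row_mxEr.
  have E0 (p : R * 'rV[R]_n) : consR p ord0 ord0 = p.1.
    rewrite [X in consR p _ X](_ : _ = lshift n (ord0 : 'I_1)); last first.
      exact/val_inj.
    by apply: (etrans (row_mxEl _ _ _ _)); rewrite mxE eqxx mulr1n.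
  apply/seteqP; split => -[x y] /=.
    move=> H; split=> [|i]; first by have := H ord0; rewrite E0.
    by have := H (lift ord0 i); rewrite E.
  move=> [Ax Ay] i; have [j ->|->] := unliftP ord0 i; first by rewrite E.
  by rewrite E0.
rewrite big_ord_recl.
transitivity ((lebesgue_measure \x lebesgueRn n) (A ord0 `*` B)).
  by rewrite -consRB.
have mB : measurable B.
  rewrite (_ : B = \bigcap_(i in [set: 'I_n])
     ((fun y : borel 'rV[R]_n => y ord0 i) @^-1` A (lift ord0 i))); last first.
    by apply/seteqP; split => y /= H i; [move=> _|]; exact: H.
  apply: fin_bigcap_measurable => // i _.
  by rewrite -[X in measurable X]setTI; exact: measurable_coord.
transitivity (lebesgue_measure (A ord0) * lebesgueRn n B).
  by apply: product_measure1E; [exact: mA|exact: mB].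
by congr (_ * _); exact: (IH (fun i => A (lift ord0 i))).
Qed.

End lebesgue_Rn.

(* f \prec g, uniformly on D *)
Definition dominated_on {R : realType} {X : Type} (D : set X) (f g : X -> \bar R) :=
  exists2 c : R, 0 < c & forall x, D x -> (f x <= c%:E * g x)%E.

(* f \approx g, uniformly on D *)
Definition comparable_on {R : realType} {X : Type} (D : set X) (f g : X -> \bar R) :=
  dominated_on D f g /\ dominated_on D g f.

Section function_spaces.
Context {R : realType} {n : nat}.
Implicit Types (f g phi : 'rV[R]_n -> R) (k b : 'I_n -> nat) (m : nat).

Local Notation mu := (@lebesgueRn R n).

Definition partial (i : 'I_n) f : 'rV[R]_n -> R :=
  fun x => 'D_(delta_mx ord0 i) f x.

Definition smooth f := forall s : seq 'I_n,
  continuous (foldr partial f s) /\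
  forall x i, derivable (foldr partial f s) x (delta_mx ord0 i).

Definition mderiv k f : 'rV[R]_n -> R :=
  foldr (fun i => iter (k i) (partial i)) f (enum 'I_n).

Definition morder k : nat := (\sum_(i < n) k i)%N.

Definition test_function phi :=
  smooth phi /\ compact (closure [set x | phi x != 0]).

Definition schwartz f := smooth f /\
  forall b k, exists M : R, forall x : 'rV[R]_n,
    `|\prod_(i < n) x ord0 i ^+ b i * mderiv k f x| <= M.

Definition L1 : set ('rV[R]_n -> R) :=
  [set f | mu.-integrable setT (EFin \o f)].

Definition L1norm f : \bar R := (\int[mu]_x `|(f x)%:E|)%E.

Definition L1loc : set ('rV[R]_n -> R) :=
  [set f | measurable_fun (setT : set (borel 'rV[R]_n)) f /\
    forall K : set 'rV[R]_n, compact K -> mu.-integrable K (EFin \o f)].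

Definition is_wderiv k f g := [/\ L1loc f, L1loc g &
  forall phi, test_function phi ->
    \int[mu]_x (f x * mderiv k phi x) =
    (-1) ^+ morder k * \int[mu]_x (g x * phi x)].

(* a representative of the distributional derivative; the default is only
   reached when there is no locally integrable one *)
Definition wderiv k f : 'rV[R]_n -> R := xget (cst 0) [set g | is_wderiv k f g].

Definition mindices m : {set {ffun 'I_n -> 'I_m.+1}} :=
  [set k : {ffun 'I_n -> 'I_m.+1} | morder (fun i => k i) == m].

Definition wnorm m f : \bar R :=
  (\sum_(k in mindices m) L1norm (wderiv (fun i => k i) f))%E.

(* the closure is taken among the functions whose distributional derivatives
   of order m are all in L1 *)
Definition w1 m : set ('rV[R]_n -> R) :=
  [set f | (forall k, morder k = m -> exists2 g, is_wderiv k f g & L1 g) /\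
    forall e : R, 0 < e ->
      exists2 phi, test_function phi & (wnorm m (f - phi)%R < e%:E)%E].

End function_spaces.

Section real_interpolation.
Context {R : realType} {V : zmodType}.
Variables (A0 A1 : set V) (N0 N1 : V -> \bar R).
Local Open Scope ereal_scope.

Definition Kfun (t : R) (f : V) : \bar R :=
  ereal_inf [set N0 p.1 + t%:E * N1 p.2 | p in
    [set p : V * V | [/\ A0 p.1, A1 p.2 & f = (p.1 + p.2)%R]]].

(* 0 < q is intended; the value at q = -oo is junk *)
Definition interp_norm (theta : R) (q : \bar R) (f : V) : \bar R :=
  match q with
  | q'%:E => (\int[lebesgue_measure]_(t in `]0%R, +oo[)
               (((t `^ (- theta))%:E * Kfun t f) `^ q' * (t^-1)%:E)) `^ q'^-1
  | +oo => ereal_sup [set (t `^ (- theta))%:E * Kfun t f |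
                        t in [set t : R | (0 < t)%R]]
  | -oo => 0
  end.

End real_interpolation.

Definition besov_norm {R : realType} {n : nat} (m : nat) (alpha : R)
    (q : \bar R) (f : 'rV[R]_n -> R) : \bar R :=
  interp_norm L1 (w1 m) L1norm (wnorm m) (alpha / m%:R) q f.

Section capacity_tent.
Context {R : realType} {n : nat}.
Implicit Types (O : set 'rV[R]_n) (x y : 'rV[R]_n).

Definition cap (m : nat) (alpha : R) (q : \bar R) O : \bar R :=
  ereal_inf [set besov_norm m alpha q f | f in
    [set f : 'rV[R]_n -> R | [/\ schwartz f, forall x, 0 <= f x &
                                 forall x, O x -> 1 <= f x]]].

(* the library norm on row vectors is the sup norm *)
Definition enorm x : R := Num.sqrt (\sum_(i < n) x ord0 i ^+ 2).

Definition eball x (r : R) : set 'rV[R]_n := [set y | enorm (y - x) < r].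

Definition boundary O : set 'rV[R]_n := closure O `\` interior O.

Definition dist_to x (A : set 'rV[R]_n) : \bar R :=
  ereal_inf [set (enorm (x - y))%:E | y in A].

End capacity_tent.

Definition halfspace (R : realType) (n : nat) : Type :=
  set_type [set p : 'rV[R]_n * R | 0 < p.2].

HB.instance Definition _ (R : realType) (n : nat) :=
  Topological.on (halfspace R n).

Lemma halfspace_subproof (R : realType) (n : nat) :
  ((0, 1) : 'rV[R]_n * R) \in [set p : 'rV[R]_n * R | 0 < p.2].
Proof. by rewrite inE /=. Qed.

HB.instance Definition _ (R : realType) (n : nat) :=
  isPointed.Build (halfspace R n)
    (exist (fun p => p \in [set p : 'rV[R]_n * R | 0 < p.2]) (0, 1)
      (halfspace_subproof R n)).

Definition tent {R : realType} {n : nat} (O : set 'rV[R]_n) :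
    set (halfspace R n) :=
  [set z | O (set_val z).1 /\
    ((set_val z).2%:E < dist_to (set_val z).1 (boundary O))%E].

Notation borel_measure R n :=
  {measure set (borel (halfspace R n)) -> \bar R}.

(* mu (T O) <= c Theta(+oo) is void, hence the restriction to finite capacity *)
Definition CapClass {R : realType} {n : nat} (m : nat) (alpha : R)
    (q : \bar R) (Theta : R -> R) : set (borel_measure R n) :=
  [set mu | dominated_on [set O : set 'rV[R]_n | open O /\ (cap m alpha q O < +oo)%E]
     (fun O => mu (tent O)) (fun O => (Theta (fine (cap m alpha q O)))%:E)].

Definition CClass {R : realType} {n : nat} (Theta : R -> R) :
    set (borel_measure R n) :=
  [set mu | dominated_on [set xr : 'rV[R]_n * R | 0 < xr.2]
     (fun xr => mu (tent (eball xr.1 xr.2))) (fun xr => (Theta xr.2)%:E)].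

(* Main.v *)
Require Import Defs.
From HB Require Import structures.
From mathcomp Require Import all_boot all_order all_algebra.
From mathcomp Require Import all_classical all_reals all_analysis.
From mathcomp Require Import measurable_realfun lra.

Set Implicit Arguments.
Unset Strict Implicit.
Unset Printing Implicit Defensive.

Import Order.TTheory GRing.Theory Num.Theory.
Import numFieldNormedType.Exports.

Local Open Scope classical_set_scope.
Local Open Scope ring_scope.

(** Both inclusions compare capacity with volume.

    Capacity is at most volume for balls. A bump adapted to a ball of radius
    rho has L1 norm of order rho^n and order-m derivatives with L1 norm of
    order rho^(n-m), so that K(t) <= C min(rho^n, t rho^(n-m)), and the
    interpolation norm is at most C rho^(n-alpha): this is [cap_eball_le].
    A measure controlled by the capacity is thus controlled on the tents of
    balls. The Sobolev norm is computed on a chosen representative of each weak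
    derivative, whence the need for their uniqueness, [wderiv_unique].

    Volume is at most capacity for open sets: |O| <= C cap(O)^(n/(n-alpha)),
    which is [volume_le_cap]. Let f >= 1 on O have norm less than N, so that
    K(h^m, f) <= N h^alpha up to a constant. Average f against a kernel of
    scale h which is such that the difference between the scales h/2 and h is a
    sum of pure derivatives of order m of functions living on a cube of side h.
    Splitting f = f0 + f1 and moving these derivatives onto f1, the change
    between consecutive dyadic scales at x is at most C h^(-n) times the
    integral over that cube of a function G_h >= 0 of total mass N h^alpha
    ([mollify_diff]). It is thus at most C N h^(alpha-n) everywhere, and at
    most C N h^alpha in L1. Add the sup bounds above a scale H and the L1
    bounds below it: if H^(n-alpha) is a large multiple of N, the coarse scales
    contribute at most 1/4 at each point, hence the fine scales at least 1/2 on
    O, and |O| <= C N H^alpha ([measure_superlevel_le]).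

    Given s with |O| < s^n, cut O into its maximal dyadic cubes, of sides
    l_j <= s. Each is as close to the complement of O as it is large, so that
    the tent over O is covered by the tents over balls of radii comparable to
    l_j ([tent_covering]). The integral condition makes Phi(u) / u^n
    increasing up to a constant ([gauge_ratio]); hence a measure controlled on
    tents of balls charges the tent over O at most
    C sum_j Phi(l_j) <= C sum_j l_j^n Phi(s) / s^n <= C Phi(s).
    By the volume bound, s can be taken of order cap(O)^(1/(n-alpha)). *)

(** * Smooth functions of one real variable *)

Section smooth_line.
Context {R : realType}.
Implicit Types (f g : R -> R) (p : {poly R}).

(** A tower of derivatives given by witnesses: sums, products and inverses are
    then treated by a plain induction on the height, with no Leibniz formula. *)
Fixpoint diff_upto (k : nat) f : Prop :=
  if k is k'.+1 then
    exists2 f' : R -> R, (forall x, is_derive x (1 : R) f (f' x)) & diff_upto k' f'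
  else True.

Definition smooth1 f := forall k, diff_upto k f.

Lemma diff_uptoW k f : diff_upto k.+1 f -> diff_upto k f.
Proof.
elim: k f => [//|k IH] f [f' df Df']; exists f' => //; exact: IH.
Qed.

Lemma diff_upto_cst k (a : R) : diff_upto k (fun=> a).
Proof.
elim: k a => [//|k IH] a; exists (fun=> 0); last exact: IH.
by move=> x; exact: is_derive_cst.
Qed.

Lemma diff_uptoD k f g : diff_upto k f -> diff_upto k g ->
  diff_upto k (fun x => f x + g x).
Proof.
elim: k f g => [//|k IH] f g [f' df Df'] [g' dg Dg'].
exists (fun x => f' x + g' x); last exact: IH.
by move=> x; apply: is_deriveD.
Qed.

Lemma diff_uptoM k f g : diff_upto k f -> diff_upto k g ->
  diff_upto k (fun x => f x * g x).
Proof.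
elim: k f g => [//|k IH] f g Df Dg.
have := Df; have := Dg => -[g' dg Dg'] [f' df Df'].
exists (fun x => f x * g' x + g x * f' x).
  by move=> x; apply: is_deriveM.
apply: diff_uptoD; apply: IH => //; exact: diff_uptoW.
Qed.

Lemma diff_uptoV k f : (forall x, f x != 0) -> diff_upto k f ->
  diff_upto k (fun x => (f x)^-1).
Proof.
move=> f0; elim: k => [//|k IH] Df; have := Df => -[f' df Df'].
exists (fun x => (-1) * ((f x)^-1 * ((f x)^-1 * f' x))).
  move=> x; have := is_deriveV (f0 x) (df x).
  by move=> h; apply: is_derive_eq; rewrite /GRing.scale/= mulN1r mulNr
    expr2 invfM mulrA.
have DV := IH (diff_uptoW Df).
apply: diff_uptoM; first exact: diff_upto_cst.
by do 2 apply: diff_uptoM => //.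
Qed.

Lemma diff_upto_affine k f (a b : R) : diff_upto k f ->
  diff_upto k (fun x => f (a * x + b)).
Proof.
elim: k f => [//|k IH] f [f' df Df'].
exists (fun x => a * f' (a * x + b)).
  move=> x; have dg : is_derive x (1 : R) (fun x : R => a * x + b) a.
    have h1 : is_derive x (1 : R) (fun x : R => a * x) a.
      have := @is_deriveZ _ _ _ id a x 1 1 _.
      by move=> h; apply: is_derive_eq; rewrite /GRing.scale/= mulr1.
    by apply: is_derive_eq; rewrite addr0.
  have := @is_derive1_comp _ f _ x _ _ (df (a * x + b)) dg.
  by move=> h; apply: is_derive_eq; rewrite mulrC.
by apply: diff_uptoM; [exact: diff_upto_cst|exact: IH].
Qed.

Lemma diff_uptoX k j : diff_upto k (fun x : R => x ^+ j).
Proof.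
elim: j => [|j IH]; first exact: diff_upto_cst.
rewrite (_ : (fun x => _) = (fun x => x * x ^+ j)); last first.
  by apply/funext => x; rewrite exprS.
apply: diff_uptoM => //; case: k {IH} => // k; exists (fun=> 1).
  by move=> x; exact: is_derive_id.
exact: diff_upto_cst.
Qed.

Lemma smooth1_derive1 f : smooth1 f -> smooth1 (derive1 f).
Proof.
move=> sf k; have [f' df Df'] := sf k.+1.
rewrite (_ : derive1 f = f')//; apply/funext => x.
by rewrite derive1E; apply: derive_val; exact: df.
Qed.

Lemma smooth1_derive1n j f : smooth1 f -> smooth1 (derive1n j f).
Proof.
move=> sf; elim: j => [//|j IH]; rewrite derive1nS; exact: smooth1_derive1.
Qed.

Lemma smooth1_derivable f x : smooth1 f -> derivable f x 1.
Proof. by move=> /(_ 1%N)[f' df _]; have [] := df x. Qed.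

Lemma smooth1_is_derive f x : smooth1 f -> is_derive x (1 : R) f (derive1 f x).
Proof.
by move=> sf; rewrite derive1E; apply/derivableP; exact: smooth1_derivable.
Qed.

Lemma smooth1_continuous f : smooth1 f -> continuous f.
Proof.
move=> sf x; apply: differentiable_continuous; apply/derivable1_diffP.
exact: smooth1_derivable.
Qed.

Lemma is_derive0_quadratic f (C : R) :
  (forall h, `|h| < 1 -> `|f h| <= C * h ^+ 2) -> is_derive (0 : R) (1 : R) f 0.
Proof.
move=> fC; have f0 : f 0 = 0.
  by apply/normr0_eq0/le_anti; rewrite normr_ge0 andbT
    (le_trans (fC 0 _)) ?normr0// expr0n/= mulr0.
have cv : h^-1 *: ((f \o shift 0) (h *: 1) - f 0) @[h --> 0^'] --> (0 : R).
  apply/cvgr0Pnorm_le => e e0.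
  have C1 : 0 < `|C| + 1 by rewrite ltr_wpDl.
  near=> h; rewrite /= f0 subr0 addr0 /GRing.scale/= mulr1 normrM normfV.
  have h0 : h != 0 by near: h; exact: nbhs_dnbhs_neq.
  have hd : `|h| < Num.min 1 (e / (`|C| + 1)).
    near: h; apply: dnbhs0_lt; rewrite lt_min ltr01/=; exact: divr_gt0.
  move: hd; rewrite lt_min => /andP[h1 he].
  rewrite ler_pdivrMl ?normr_gt0// (le_trans (fC h h1))//.
  rewrite -real_normK ?num_real// expr2 mulrA mulrC ler_pM2l ?normr_gt0//.
  move: he; rewrite ltr_pdivlMr// => /ltW; apply: le_trans.
  rewrite mulrC ler_wpM2l// (le_trans (ler_norm _))// lerDl//.
apply: DeriveDef; first by apply/cvg_ex; exists 0; exact: cv.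
exact: cvg_lim cv.
Unshelve. all: by end_near. Qed.

(** The derivatives of exp(-1/x), extended by 0 to the half-line x <= 0, all
    have this form: a polynomial in 1/x times the exponential. *)
Definition flat p (x : R) : R :=
  if 0 < x then p.[x^-1] * expR (- x^-1) else 0.

Lemma horner_bound p : exists2 C : R, 0 <= C & exists N : nat, forall y : R, 1 <= y ->
  `|p.[y]| <= C * y ^+ N.
Proof.
elim/poly_ind: p => [|p c [C C0 [N HN]]].
  by exists 0 => //; exists 0%N => y _; rewrite horner0 normr0 mul0r.
exists (C + `|c|); first exact: addr_ge0.
exists N.+1 => y y1; rewrite hornerMXaddC (le_trans (ler_normD _ _))//.
have y0 : 0 <= y by rewrite (le_trans ler01).
rewrite mulrDl lerD//.
  by rewrite normrM (ger0_norm y0) exprSr mulrA ler_wpM2r// HN.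
by rewrite ler_peMr// exprn_ege1.
Qed.

(** The exponential beats all powers of 1/x; the quadratic bound is what makes
    the derivative at the origin vanish. *)
Lemma flat_bound p : exists C : R, forall h, `|h| < 1 ->
  `|flat p h| <= C * h ^+ 2.
Proof.
have [C C0 [N HN]] := horner_bound p.
exists (C * (N.+2)`!%:R) => h; rewrite /flat; case: ifPn => h0; last first.
  by rewrite normr0 mulr_ge0// ?sqr_ge0// mulr_ge0.
rewrite (gtr0_norm h0) => h1.
have [y y1 ->] : exists2 y : R, 1 <= y & h = y^-1.
  by exists h^-1; rewrite ?invrK// invf_ge1// ltW.
rewrite invrK.
have y0 : 0 < y by rewrite (lt_le_trans ltr01).
rewrite normrM (ger0_norm (expR_ge0 _)) expRN.
rewrite ler_pdivrMr ?expR_gt0// (le_trans (HN _ y1))//.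
have := expR_ge1Dxn N.+1 (ltW y0) => hexp.
have {hexp} : y ^+ N.+2 / (N.+2)`!%:R <= expR y.
  by rewrite (le_trans _ hexp)// lerDr.
rewrite ler_pdivrMr ?ltr0n ?fact_gt0// => hexp.
rewrite exprVn -!(mulrA C). apply: ler_wpM2l => //.
rewrite (mulrC _ (_ ^-1)) -mulrA.
by rewrite ler_pdivlMl ?exprn_gt0// -exprD add2n mulrC.
Qed.

Lemma is_derive_flat p x :
  is_derive x (1 : R) (flat p) (flat ('X^2 * (p - p^`())) x).
Proof.
have [x0|x0|->] := ltgtP x 0.
- rewrite {2}/flat ltNge (ltW x0)/=.
  apply: (@near_eq_is_derive _ _ _ (cst 0)).
  near=> y; rewrite /flat ltNge ifN// negbK ltW//.
  by near: y; exact: lt_nbhsl.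
- rewrite {2}/flat x0.
  have dV : is_derive x (1 : R) (fun y : R => y^-1) (- x ^- 2).
    have := @is_deriveV R id x 1 1 (lt0r_neq0 x0) (is_derive_id _ _).
    by move=> h; apply: is_derive_eq; rewrite /GRing.scale/= mulr1.
  have dN : is_derive x (1 : R) (fun y : R => - y^-1) (x ^- 2).
    by have h := is_deriveN dV; apply: is_derive_eq; rewrite opprK.
  have d1 := @is_derive1_comp _ (horner p) _ x _ _ (is_derive_poly p _) dV.
  have d2 := @is_derive1_comp _ expR _ x _ _ (is_derive_expR _) dN.
  have d3 : is_derive x (1 : R) (fun y => p.[y^-1] * expR (- y^-1))
      (('X^2 * (p - p^`())).[x^-1] * expR (- x^-1)).
    have h := is_deriveM d1 d2; apply: is_derive_eq.
    rewrite /GRing.scale/= hornerM hornerXn hornerD hornerN.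
    rewrite exprVn; lra.
  apply: near_eq_is_derive d3.
  near=> y; rewrite /flat ifT//; near: y; exact: lt_nbhsr.
- rewrite {2}/flat ltxx; have [C HC] := flat_bound p.
  exact: is_derive0_quadratic HC.
Unshelve. all: by end_near. Qed.

Lemma smooth1_flat p : smooth1 (flat p).
Proof.
move=> k; elim: k p => [//|k IH] p.
by exists (flat ('X^2 * (p - p^`()))) => // x; exact: is_derive_flat.
Qed.

(** A smooth step, 0 for x <= 0 and 1 for x >= 1. *)
Definition sstep (x : R) : R := flat 1 x / (flat 1 x + flat 1 (1 - x)).

Lemma flat1_ge0 x : 0 <= flat 1 x.
Proof. by rewrite /flat; case: ifP => // _; rewrite hornerC mul1r expR_ge0. Qed.

Lemma flat1_gt0 x : 0 < x -> 0 < flat 1 x.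
Proof. by rewrite /flat => ->; rewrite hornerC mul1r expR_gt0. Qed.

Lemma sstep_den x : 0 < flat 1 x + flat 1 (1 - x).
Proof.
have [x0|x0] := ltP 0 x.
  by rewrite ltr_pwDl ?flat1_ge0// flat1_gt0.
by rewrite ltr_wpDl ?flat1_ge0// flat1_gt0// subr_gt0 (le_lt_trans x0).
Qed.

Lemma smooth1_sstep : smooth1 sstep.
Proof.
move=> k; apply: diff_uptoM; first exact: smooth1_flat.
apply: diff_uptoV; first by move=> x; rewrite gt_eqF// sstep_den.
apply: diff_uptoD; first exact: smooth1_flat.
rewrite (_ : (fun x => _) = (fun x => flat 1 ((-1) * x + 1))).
  by apply: diff_upto_affine; exact: smooth1_flat.
by apply/funext => x; rewrite mulN1r addrC.
Qed.

Lemma sstep_ge0 x : 0 <= sstep x.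
Proof. by rewrite divr_ge0 ?flat1_ge0// ltW// sstep_den. Qed.

Lemma sstep_le1 x : sstep x <= 1.
Proof. by rewrite ler_pdivrMr ?sstep_den// mul1r lerDl flat1_ge0. Qed.

Lemma sstep_le0 x : x <= 0 -> sstep x = 0.
Proof. by move=> x0; rewrite /sstep {1}/flat ltNge x0/= mul0r. Qed.

Lemma sstep_ge1 x : 1 <= x -> sstep x = 1.
Proof.
move=> x1; rewrite /sstep {3}/flat subr_gt0 ltNge x1/= addr0 divff//.
by rewrite gt_eqF// flat1_gt0// (lt_le_trans ltr01).
Qed.

End smooth_line.

(** * Integration over R^n *)

Section integration_Rn.
Context {R : realType}.
Local Notation mu := (@lebesgueRn R).
Local Notation lam := (@lebesgue_measure R).

Lemma continuous_borel_measurable n (f : 'rV[R]_n -> R) :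
  continuous f -> measurable_fun setT (f : borel 'rV[R]_n -> R).
Proof.
move=> cf; apply: (measurability _ (measurable_realfun.RGenOpens.measurableE R)).
move=> _ [_ [a [b ->]] <-]; rewrite setTI.
apply: open_measurable_borel; apply: open_comp; last exact: interval_open.
by move=> x _; exact: cf.
Qed.

Lemma compact_measurable_borel n (K : set 'rV[R]_n) :
  compact K -> @measurable _ (borel 'rV[R]_n) K.
Proof.
move=> cK; rewrite -(setCK K); apply: measurableC; apply: open_measurable_borel.
by apply: closed_openC; apply: compact_closed => //; exact: norm_hausdorff.
Qed.

Lemma ler_coord_norm n (x : 'rV[R]_n) i : `|x ord0 i| <= `|x|.
Proof.
by rewrite -[in leRHS]/(mx_norm x) mx_normrE (le_trans _ (le_bigmax _ _ (ord0, i))).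
Qed.

(** The integral of a nonnegative function is a supremum over the simple
    functions below it, hence is monotone for arbitrary functions: gauges and
    K-functionals are integrated below. *)
Lemma ge0_le_integral_nomeas d (T : measurableType d)
    (nu : {measure set T -> \bar R}) (D : set T) (f g : T -> \bar R) :
  (forall x, D x -> (0 <= f x)%E) -> (forall x, D x -> (f x <= g x)%E) ->
  (\int[nu]_(x in D) f x <= \int[nu]_(x in D) g x)%E.
Proof.
move=> f0 fg; have g0 x : D x -> (0 <= g x)%E.
  by move=> Dx; exact: le_trans (f0 x Dx) (fg x Dx).
rewrite !ge0_integralE//; apply: le_ereal_sup => _ [h hf <-]; exists h => //= x.
apply: le_trans (hf x) _; rewrite !patchE; case: ifPn => // xD.
by apply: fg; rewrite inE in xD.
Qed.

Definition cube n (x : 'rV[R]_n) (l : R) : set 'rV[R]_n :=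
  [set y | forall i, y ord0 i \in `[x ord0 i, x ord0 i + l] ].

Lemma cube_box n (x : 'rV[R]_n) l :
  cube x l = [set y | forall i, `[x ord0 i, x ord0 i + l]%classic (y ord0 i)].
Proof. by apply/seteqP; split => y /= H i; have := H i; rewrite inE. Qed.

Lemma measurable_box n (A : 'I_n -> set R) : (forall i, measurable (A i)) ->
  measurable [set x : borel 'rV[R]_n | forall i, A i (x ord0 i)].
Proof.
move=> mA; rewrite (_ : [set x | _] = \bigcap_(i in [set: 'I_n])
     ((fun y : borel 'rV[R]_n => y ord0 i) @^-1` A i)); last first.
  by apply/seteqP; split => y /= H i; [move=> _|]; exact: H.
apply: fin_bigcap_measurable => // i _.
by rewrite -[X in measurable X]setTI; exact: measurable_coord.
Qed.

Lemma measurable_cube n (x : 'rV[R]_n) l :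
  @measurable _ (borel 'rV[R]_n) (cube x l).
Proof.
rewrite cube_box; apply: (@measurable_box n (fun i => `[x ord0 i, x ord0 i + l]%classic)).
by move=> i; exact: measurable_itv.
Qed.

Lemma lebesgueRn_cube n (x : 'rV[R]_n) l : 0 <= l ->
  mu n (cube x l) = (l ^+ n)%:E.
Proof.
move=> l0; rewrite cube_box.
apply: etrans (@lebesgueRn_box R n (fun i => `[x ord0 i, x ord0 i + l]%classic) _) _.
  by move=> i; exact: measurable_itv.
transitivity (\prod_(i < n) l%:E)%E.
  apply: eq_bigr => i _; rewrite lebesgue_measure_itv/= lte_fin -EFinD.
  rewrite addrAC subrr add0r ltrDl; case: ltP => // l0'.
  by congr EFin; apply/eqP; rewrite eq_le l0.
by rewrite prodEFin prodr_const card_ord.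
Qed.

Lemma compact_cube n (x : 'rV[R]_n) l : compact (cube x l).
Proof.
rewrite cube_box.
apply: (@rV_compact R n (fun i => `[x ord0 i, x ord0 i + l]%classic)) => i.
exact: segment_compact.
Qed.

(** Vanishing outside the cube [-M, M]^n is the form in which compactness of
    the support is used throughout. *)
Definition supported n (M : R) (f : 'rV[R]_n -> R) :=
  forall x : 'rV[R]_n, (exists i, M < `|x ord0 i|) -> f x = 0.

Definition ccont n (f : 'rV[R]_n -> R) :=
  continuous f /\ exists M, supported M f.

(** The lower corner of the cube [-M, M]^n. *)
Definition ctr n (M : R) : 'rV[R]_n := const_mx (- M).

Lemma supportedP n M (f : 'rV[R]_n -> R) x :
  supported M f -> ~ cube (ctr n M) (2 * M) x -> f x = 0.
Proof.
move=> sf nx; apply: sf; apply: contrapT => /forallNP H; apply: nx => i.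
have /negP := H i; rewrite -leNgt ler_norml => /andP[h1 h2].
by rewrite !mxE in_itv/= h1/=; lra.
Qed.

Lemma continuous_bounded n (K : set 'rV[R]_n) (f : 'rV[R]_n -> R) :
  compact K -> continuous f -> exists C, forall x, K x -> `|f x| <= C.
Proof.
move=> cK cf.
have /compact_bounded[C [_ HC]] : compact (f @` K).
  by apply: continuous_compact => //; exact: continuous_subspaceT.
exists (C + 1) => x Kx; apply: (HC (C + 1)); first by rewrite ltrDl.
by exists x.
Qed.

Lemma ccont_bounded n (f : 'rV[R]_n -> R) :
  ccont f -> exists2 C, 0 <= C & forall x, `|f x| <= C.
Proof.
move=> [cf [M sf]].
have [C HC] := continuous_bounded (@compact_cube _ (ctr n M) (2 * M)) cf.
exists `|C| => // x.
have [/HC fC|/(supportedP sf) ->] := pselect (cube (ctr n M) (2 * M) x).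
  by rewrite (le_trans fC)// ler_norm.
by rewrite normr0.
Qed.

Lemma integrable_bounded_supp n (f : borel 'rV[R]_n -> R) (C : R)
    (K : set (borel 'rV[R]_n)) :
  measurable_fun setT f -> measurable K -> (mu n K < +oo)%E ->
  (forall x, `|f x| <= C) -> (forall x, ~ K x -> f x = 0) ->
  (mu n).-integrable setT (EFin \o f).
Proof.
move=> mf mK Koo fC fK.
rewrite (_ : EFin \o f = (EFin \o f) \_ K); last first.
  apply/funext => x; rewrite patchE; case: ifPn => //.
  by rewrite notin_setE => /fK/= ->.
apply: (proj1 (@integrable_mkcond _ _ _ (mu n) K (EFin \o f) mK)).
apply: measurable_bounded_integrable => //.
  exact: measurable_funTS.
exists C; split; first exact: num_real.
by move=> r Cr x _ /=; rewrite (le_trans (fC x))// ltW.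
Qed.

Lemma cube_lty n (x : 'rV[R]_n) l : (mu n (cube x l) < +oo)%E.
Proof.
have [l0|l0] := leP 0 l; first by rewrite lebesgueRn_cube// ltry.
have sub : cube x l `<=` cube x 0.
  by move=> y H i; have := H i; rewrite !in_itv/= => /andP[]; lra.
apply: (@le_lt_trans _ _ (mu n (cube x 0))).
  by apply: le_measure => //; rewrite inE; exact: measurable_cube.
by rewrite lebesgueRn_cube// ltry.
Qed.

Lemma ccont_integrable n (f : 'rV[R]_n -> R) :
  ccont f -> (mu n).-integrable setT (EFin \o f).
Proof.
move=> ccf; have [C _ HC] := ccont_bounded ccf; have [cf [M sf]] := ccf.
apply: (@integrable_bounded_supp _ _ C (cube (ctr n M) (2 * M))) => //.
- exact: continuous_borel_measurable.
- exact: measurable_cube.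
- exact: cube_lty.
- by move=> x; exact: supportedP.
Qed.

Lemma consR0 n (p : R * 'rV[R]_n) : consR p ord0 ord0 = p.1.
Proof.
rewrite [X in consR p _ X](_ : _ = lshift n (ord0 : 'I_1)); last exact/val_inj.
by apply: (etrans (row_mxEl _ _ _ _)); rewrite mxE eqxx mulr1n.
Qed.

Lemma consRS n (p : R * 'rV[R]_n) i : consR p ord0 (lift ord0 i) = p.2 ord0 i.
Proof.
rewrite (_ : lift ord0 i = rshift 1 i); last exact/val_inj.
exact: row_mxEr.
Qed.

Lemma measurable_consR n : measurable_fun setT (@consR R n).
Proof.
apply: measurable_to_rV => i; have [j ->|->] := unliftP ord0 i.
  rewrite (_ : (fun t => _) = (fun x : borel 'rV[R]_n => x ord0 j) \o snd).
    exact: measurableT_comp (measurable_coord j) measurable_snd.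
  by apply/funext => t; exact: consRS.
rewrite (_ : (fun t => _) = fst); first exact: measurable_fst.
by apply/funext => t; exact: consR0.
Qed.

Lemma integrable_consR n (f : borel 'rV[R]_n.+1 -> \bar R) :
  (mu n.+1).-integrable setT f ->
  (lam \x mu n)%E.-integrable setT (f \o @consR R n).
Proof.
move=> /integrableP[mf foo]; apply/integrableP; split.
  exact: (measurableT_comp mf (@measurable_consR n)).
move: foo; rewrite /= /lebesgue_step ge0_integral_pushforward//.
- exact: measurable_consR.
- exact: measurableT_comp.
Qed.

Lemma integral_consR n (f : borel 'rV[R]_n.+1 -> \bar R) :
  (mu n.+1).-integrable setT f ->
  (\int[mu n.+1]_x f x = \int[lam \x mu n]_p f (consR p))%E.
Proof.
move=> fi; have /integrableP[mf _] := fi.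
rewrite /= /lebesgue_step integral_pushforward//.
- exact: measurable_consR.
- exact: integrable_consR.
Qed.

Lemma lebesgueRn_fubini12 n (f : borel 'rV[R]_n.+1 -> \bar R) :
  (mu n.+1).-integrable setT f ->
  (\int[mu n.+1]_x f x = \int[lam]_t \int[mu n]_y f (consR (t, y)))%E.
Proof.
move=> fi; rewrite integral_consR//.
by rewrite -integral12_prod_meas1//; exact: integrable_consR.
Qed.

Lemma lebesgueRn_fubini21 n (f : borel 'rV[R]_n.+1 -> \bar R) :
  (mu n.+1).-integrable setT f ->
  (\int[mu n.+1]_x f x = \int[mu n]_y \int[lam]_t f (consR (t, y)))%E.
Proof.
move=> fi; rewrite integral_consR//.
by rewrite -integral21_prod_meas1//; exact: integrable_consR.
Qed.

End integration_Rn.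

(** * Tensor products of functions of one variable *)

Section tensors.
Context {R : realType}.
Local Notation mu := (@lebesgueRn R).
Local Notation lam := (@lebesgue_measure R).

(** The map phi carries lines along v to lines along u, so that the difference
    quotients are the same: phi is a coordinate line, or the embedding of a
    slice. *)
Lemma derivative_line (V W : normedModType R) (phi : V -> W) (w : W -> R) v u y :
  (forall h : R, phi (h *: v + y) = h *: u + phi y) ->
  'D_v (w \o phi) y = 'D_u w (phi y) /\
  (derivable w (phi y) u -> derivable (w \o phi) y v) /\
  (derivable (w \o phi) y v -> derivable w (phi y) u).
Proof.
move=> H; suff E : (fun h : R => h^-1 *: (((w \o phi) \o shift y) (h *: v) - (w \o phi) y)) =
    (fun h : R => h^-1 *: ((w \o shift (phi y)) (h *: u) - w (phi y))).
  by rewrite /derive /derivable E.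
by apply/funext => h /=; rewrite H.
Qed.

Definition tens n (b : 'I_n -> R -> R) (x : 'rV[R]_n) : R :=
  \prod_i b i (x ord0 i).

Lemma continuous_tens n (b : 'I_n -> R -> R) :
  (forall i, continuous (b i)) -> continuous (tens b).
Proof.
move=> cb; rewrite (_ : tens b = fun x => \prod_(i <- index_enum 'I_n) b i (x ord0 i))//.
elim: (index_enum _) => [|i s IH].
  rewrite (_ : (fun _ => _) = cst 1); first exact: cst_continuous.
  by apply/funext => x; rewrite big_nil.
rewrite (_ : (fun _ => _) =
    fun x : 'rV[R]_n => b i (x ord0 i) * \prod_(j <- s) b j (x ord0 j)); last first.
  by apply/funext => x; rewrite big_cons.
move=> x; apply: continuousM; last exact: IH.
apply: (@continuous_comp _ _ _ (fun x : 'rV[R]_n => x ord0 i) (b i)).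
  exact: coord_continuous.
exact: cb.
Qed.

Lemma is_partial_tens n (b : 'I_n -> R -> R) i x :
  smooth1 (b i) ->
  derivable (tens b) x (delta_mx ord0 i) /\
  partial i (tens b) x =
  tens (fun j => if j == i then derive1 (b j) else b j) x.
Proof.
move=> sb.
pose phi (t : R) : 'rV[R]_n := t *: delta_mx ord0 i + (x - x ord0 i *: delta_mx ord0 i).
have phix : phi (x ord0 i) = x by rewrite /phi addrC subrK.
have Hphi (h : R) : phi (h *: 1 + x ord0 i) = h *: delta_mx ord0 i + phi (x ord0 i).
  by rewrite (_ : h *: 1 = h) ?/phi ?scalerDl ?addrA//; exact: mulr1.
have := derivative_line (tens b) Hphi; rewrite phix => -[D1 [_ D2]].
pose c := \prod_(j | j != i) b j (x ord0 j).
have E : tens b \o phi = (fun t => c * b i t).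
  apply/funext => t; rewrite /= /tens (bigD1 i)//= mulrC; congr (_ * _).
    apply: eq_bigr => j ji; congr (b j _).
    by rewrite /phi !mxE eqxx (negbTE ji) /= mulr0 mulr0 subr0 add0r.
  by congr (b i _); rewrite /phi !mxE !eqxx/= !mulr1 subrr addr0.
have dcb : is_derive (x ord0 i) (1 : R) (fun t => c * b i t) (c * derive1 (b i) (x ord0 i)).
  have hb := smooth1_is_derive (x ord0 i) sb.
  exact: (@is_deriveZ _ _ _ (b i) c).
rewrite E in D1 D2; split; first by apply: D2; have [] := dcb.
rewrite /partial -D1; have [_ ->] := dcb.
rewrite /tens [RHS](bigD1 i)//= eqxx mulrC; congr (_ * _).
by apply: eq_bigr => j /negbTE ->.
Qed.

Lemma partial_tens n (b : 'I_n -> R -> R) i : smooth1 (b i) ->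
  partial i (tens b) = tens (fun j => if j == i then derive1 (b j) else b j).
Proof. by move=> sb; apply/funext => x; exact: (is_partial_tens x sb).2. Qed.

Lemma iter_partial_tens n (b : 'I_n -> R -> R) i k : smooth1 (b i) ->
  iter k (partial i) (tens b) =
  tens (fun j => if j == i then derive1n k (b j) else b j).
Proof.
move=> sb; elim: k => [|k IH].
  by congr tens; apply/funext => j; case: eqP.
rewrite iterS IH partial_tens ?eqxx; last exact: smooth1_derive1n.
by congr tens; apply/funext => j; case: eqP.
Qed.

Lemma mderiv_tens n (b : 'I_n -> R -> R) k : (forall i, smooth1 (b i)) ->
  mderiv k (tens b) = tens (fun j => derive1n (k j) (b j)).
Proof.
move=> sb; rewrite /mderiv.
have H s : uniq s -> foldr (fun i => iter (k i) (partial i)) (tens b) s =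
    tens (fun j => if j \in s then derive1n (k j) (b j) else b j).
  elim: s => [|i s IH] //=; move=> /andP[nis /IH ->].
  rewrite iter_partial_tens; last by rewrite (negbTE nis).
  congr tens; apply/funext => j; rewrite in_cons.
  by have [->|//] := eqVneq j i; rewrite (negbTE nis).
rewrite H ?enum_uniq//; congr tens; apply/funext => j.
by rewrite mem_enum.
Qed.

Lemma smooth_tens n (b : 'I_n -> R -> R) :
  (forall i, smooth1 (b i)) -> smooth (tens b).
Proof.
move=> sb s.
have [b' [sb' ->]] : exists b', (forall i, smooth1 (b' i)) /\
    foldr partial (tens b) s = tens b'.
  elim: s => [|i s [b' [sb' IH]]] /=; first by exists b.
  exists (fun j => if j == i then derive1 (b' j) else b' j); split.
    by move=> j; case: eqP => // _; exact: smooth1_derive1.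
  by rewrite IH partial_tens.
split; first by apply: continuous_tens => i; exact: smooth1_continuous.
by move=> x i; exact: (is_partial_tens x (sb' i)).1.
Qed.

Definition supported1 (M : R) (f : R -> R) := forall t, M < `|t| -> f t = 0.

Lemma supported_tens n (b : 'I_n -> R -> R) M :
  (forall i, supported1 M (b i)) -> supported M (tens b).
Proof.
move=> sb x [i Mx]; rewrite /tens (bigD1 i)//= sb ?mul0r//.
Qed.

Lemma smooth_supported_test n (f : 'rV[R]_n -> R) M :
  smooth f -> supported M f -> test_function f.
Proof.
move=> smf sf; split => //.
have cc : compact (cube (ctr n M) (2 * M)) by exact: compact_cube.
have cl : closed (cube (ctr n M) (2 * M)).
  by apply: compact_closed => //; exact: norm_hausdorff.
apply: (subclosed_compact _ cc); first exact: closed_closure.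
rewrite closureE => x; apply; split => // y /= /eqP fy.
by apply: contrapT => /(supportedP sf).
Qed.

Lemma test_supported n (f : 'rV[R]_n -> R) :
  test_function f -> exists M, supported M f.
Proof.
move=> [_ /compact_bounded[M [_ HM]]]; exists (M + 1) => x [i Mx].
apply/eqP; apply: contraPT Mx => fx; apply/negP; rewrite -leNgt.
have /= : `|x| <= M + 1.
  by apply: (HM (M + 1)); [rewrite ltrDl|exact: subset_closure].
by apply: le_trans; exact: ler_coord_norm.
Qed.

Lemma test_ccont n (f : 'rV[R]_n -> R) : test_function f -> ccont f.
Proof.
by move=> tf; split; [have [cf _] := tf.1 [::]|exact: test_supported].
Qed.

Lemma supported_partial n M (f : 'rV[R]_n -> R) i :
  supported M f -> supported M (partial i f).
Proof.
move=> sf x [j Mx]; rewrite /partial.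
rewrite (near_eq_derive (g := cst 0)); first by rewrite derive_cst.
have oU : open [set y : 'rV[R]_n | M < `|y ord0 j|].
  rewrite (_ : [set _ | _] = (fun y : 'rV[R]_n => `|y ord0 j|) @^-1` [set t | M < t]) //.
  apply: open_comp; last exact: open_gt.
  move=> y _; apply: (@continuous_comp _ _ _ (fun x : 'rV[R]_n => x ord0 j) Num.norm).
    exact: coord_continuous.
  exact: norm_continuous.
have : nbhs x [set y : 'rV[R]_n | M < `|y ord0 j|] by exact: open_nbhs_nbhs.
by apply: filterS => y /= My; apply: sf; exists j.
Qed.

Lemma test_partial n (f : 'rV[R]_n -> R) i :
  test_function f -> test_function (partial i f).
Proof.
move=> tf; have [M sM] := test_supported tf.
apply: (@smooth_supported_test _ _ M); last exact: supported_partial.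
by move=> s; have := tf.1 (rcons s i); rewrite foldr_rcons.
Qed.

(** The derivative lives on [a, b], where this is the fundamental theorem of
    calculus. *)
Lemma integral_derive1 (g : R -> R) (a b : R) : a < b ->
  (forall t, derivable g t 1) -> continuous (derive1 g) ->
  (forall t, t \notin `[a, b] -> derive1 g t = 0) ->
  (\int[lam]_t (derive1 g t)%:E = (g b - g a)%:E)%E.
Proof.
move=> ab dg cg sg.
have cont_g : continuous g.
  by move=> x; apply: differentiable_continuous; exact/derivable1_diffP.
transitivity (\int[lam]_(t in `[a, b]) (derive1 g t)%:E)%E.
  rewrite [RHS]integral_mkcond; apply: eq_integral => t _.
  by rewrite patchE; case: ifPn => //; rewrite notin_setE/= => /negP/sg ->.
have dgoo : derivable_oo_LRcontinuous g a b.
  split; first by move=> x _; exact: dg.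
  - by apply: cvg_at_right_filter; exact: cont_g.
  - by apply: cvg_at_left_filter; exact: cont_g.
exact: (@continuous_FTC2 R (derive1 g) g a b ab (continuous_subspaceT cg) dgoo (fun _ _ => erefl)).
Qed.

Lemma shift_coord n (h : R) i (v : 'rV[R]_n) j :
  (h *: delta_mx ord0 i + v) ord0 j = h * (j == i)%:R + v ord0 j.
Proof. by rewrite !mxE eqxx. Qed.

Lemma consR_shift0 n (y : 'rV[R]_n) (h t : R) :
  @consR R n (h *: (1 : R) + t, y) = h *: delta_mx ord0 ord0 + @consR R n (t, y).
Proof.
apply/rowP => j; rewrite shift_coord; have [k ->|->] := unliftP ord0 j.
  by rewrite !consRS/= mulr0 add0r.
by rewrite !consR0/= [h *: 1]mulr1 mulr1.
Qed.

Lemma consR_shiftS n (t : R) (y : 'rV[R]_n) i (h : R) :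
  @consR R n (t, h *: delta_mx ord0 i + y) =
  h *: delta_mx ord0 (lift ord0 i) + @consR R n (t, y).
Proof.
apply/rowP => j; rewrite shift_coord; have [k ->|->] := unliftP ord0 j.
  by rewrite !consRS/= shift_coord (inj_eq lift_inj).
by rewrite !consR0/= mulr0 add0r.
Qed.

Lemma continuous_consRr n (t : R) :
  continuous (fun y : 'rV[R]_n => consR (t, y) : 'rV[R]_n.+1).
Proof.
move=> y U /nbhs_ballP[e /= e0 eU]; apply/nbhs_ballP; exists e => //= z yz.
apply: eU; rewrite ball_rVE// => j /=; have [k ->|->] := unliftP ord0 j.
  by rewrite !consRS/=; move: yz; rewrite ball_rVE// => /(_ k).
by rewrite !consR0; exact: ballxx.
Qed.

Lemma continuous_consRl n (y : 'rV[R]_n) :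
  continuous (fun t : R => consR (t, y) : 'rV[R]_n.+1).
Proof.
move=> t U /nbhs_ballP[e /= e0 eU]; apply/nbhs_ballP; exists e => //= s ts.
apply: eU; rewrite ball_rVE// => j /=; have [k ->|->] := unliftP ord0 j.
  by rewrite !consRS/=; exact: ballxx.
by rewrite !consR0.
Qed.

Lemma ccont_consRr n (w : 'rV[R]_n.+1 -> R) (t : R) :
  ccont w -> ccont (fun y : 'rV[R]_n => w (consR (t, y))).
Proof.
move=> [cw [M sM]]; split; last first.
  by exists M => x [i Mx]; apply: sM; exists (lift ord0 i); rewrite consRS.
move=> y; apply: (@continuous_comp _ _ _ (fun y => consR (t, y) : 'rV[R]_n.+1) w); last exact: cw.
exact: continuous_consRr.
Qed.

Lemma ccont_consRl n (w : 'rV[R]_n.+1 -> R) (y : 'rV[R]_n) :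
  ccont w -> continuous (fun t : R => w (consR (t, y))).
Proof.
move=> [cw _] t.
apply: (@continuous_comp _ _ _ (fun t => consR (t, y) : 'rV[R]_n.+1) w); last exact: cw.
exact: continuous_consRl.
Qed.

(** Fubini reduces this to the fundamental theorem of calculus along the
    i-th axis. *)
Lemma integral_partial0 n (w : 'rV[R]_n -> R) i :
  ccont w -> (forall x, derivable w x (delta_mx ord0 i)) ->
  continuous (partial i w) -> (\int[mu n]_x (partial i w x)%:E = 0)%E.
Proof.
elim: n w i => [w []//|n IH w i cw dw cdw].
have [_ [M sM]] := cw.
have cpw : ccont (partial i w) by split => //; exists M; exact: supported_partial.
have [j|] := unliftP ord0 i => ij; subst i.
- rewrite lebesgueRn_fubini12; last exact: ccont_integrable.
  rewrite integral0_eq// => t _.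
  have E (y : 'rV[R]_n) : partial (lift ord0 j) w (consR (t, y)) =
      partial j (fun y : 'rV[R]_n => w (consR (t, y))) y.
    by have [h _] := derivative_line w (consR_shiftS t y j); symmetry.
  transitivity (\int[mu n]_y (partial j (fun y : 'rV[R]_n => w (consR (t, y))) y)%:E)%E.
    by apply: eq_integral => y _; rewrite E.
  apply: IH; first exact: ccont_consRr.
    by move=> y; exact: (derivative_line w (consR_shiftS t y j)).2.1.
  rewrite (_ : partial j _ = fun y => partial (lift ord0 j) w (consR (t, y))).
    by have [] := ccont_consRr t cpw.
  by apply/funext => y; rewrite E.
- rewrite lebesgueRn_fubini21; last exact: ccont_integrable.
  rewrite integral0_eq// => y _.
  pose g (t : R) := w (consR (t, y)).
  have D (t : R) := @derivative_line R 'rV[R]_n.+1 (fun t => consR (t, y)) w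
    (1 : R) (delta_mx ord0 ord0) t (fun h => consR_shift0 y h t).
  have E (t : R) : partial ord0 w (consR (t, y)) = derive1 g t.
    by have [h _] := D t; rewrite derive1E; symmetry.
  transitivity (\int[lam]_t (derive1 g t)%:E)%E.
    by apply: eq_integral => t _; rewrite E.
  have N0 : `|M| < `|M| + 1 by rewrite ltrDl.
  have big t : `|M| < `|t| -> g t = 0 /\ derive1 g t = 0.
    move=> Mt; rewrite -E /g; have Mt' : M < `|t| by rewrite (le_lt_trans _ Mt)// ler_norm.
    by split; [apply: sM|apply: (supported_partial _ sM)]; exists ord0; rewrite consR0.
  rewrite (@integral_derive1 _ (- (`|M| + 1)) (`|M| + 1)).
  + have N1 : `| `|M| + 1 | = `|M| + 1 by rewrite ger0_norm// addr_ge0.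
    rewrite (big (`|M| + 1) _).1 ?N1// (big (- (`|M| + 1)) _).1 ?normrN ?N1//.
    by rewrite subrr.
  + by have := normr_ge0 M; lra.
  + by move=> t; apply: (D t).2.1.
  + rewrite (_ : derive1 g = fun t => partial ord0 w (consR (t, y))).
      exact: ccont_consRl.
    by apply/funext => t; rewrite E.
  + move=> t; rewrite in_itv/= -ler_norml -ltNge => h.
    by apply: (big t _).2; rewrite (lt_trans N0).
Qed.

Lemma integral_tens n (b : 'I_n -> R -> R) M (I : 'I_n -> R) :
  (forall i, continuous (b i)) -> (forall i, supported1 M (b i)) ->
  (forall i, (\int[lam]_t (b i t)%:E = (I i)%:E)%E) ->
  (\int[mu n]_x (tens b x)%:E = (\prod_i I i)%:E)%E.
Proof.
elim: n b I => [|n IH] b I cb sb bI.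
  rewrite big_ord0 /= integral_dirac//; last first.
    apply/measurable_EFinP; apply: continuous_borel_measurable.
    exact: continuous_tens.
  by rewrite diracT mul1e /tens big_ord0.
have cct : ccont (tens b).
  split; first exact: continuous_tens.
  by exists M; exact: supported_tens.
rewrite lebesgueRn_fubini12; last exact: ccont_integrable.
pose b' j := b (lift ord0 j).
have E t y : tens b (consR (t, y)) = b ord0 t * tens b' y.
  by rewrite /tens big_ord_recl consR0; congr (_ * _); apply: eq_bigr => j _; rewrite consRS.
have ccb' : ccont (tens b').
  split; first by apply: continuous_tens => j; exact: cb.
  by exists M; apply: supported_tens => j; exact: sb.
rewrite big_ord_recl.
transitivity (\int[lam]_t ((\prod_(i < n) I (lift ord0 i))%:E * (b ord0 t)%:E))%E.
  apply: eq_integral => t _; under eq_integral do rewrite E EFinM.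
  rewrite integralZl//; last exact: ccont_integrable.
  by rewrite (IH b' _ (fun=> cb _) (fun=> sb _) (fun=> bI _)) muleC.
rewrite integralZl//.
  by rewrite bI -EFinM mulrC.
have := @continuous_compact_integrable R (b ord0) `[- M, M] (@segment_compact _ _ _).
move=> /(_ (continuous_subspaceT (cb ord0))).
move/(@integrable_mkcond _ _ _ lam _ _ (measurable_itv _)).
congr (integrable _ _ _); apply/funext => t; rewrite patchE; case: ifPn => //.
rewrite notin_setE/= in_itv/= -ler_norml => /negP; rewrite -ltNge => h.
by rewrite /= sb.
Qed.

End tensors.

(** * Uniqueness of weak derivatives *)

Section weak_uniqueness.
Context {R : realType} {n : nat}.
Local Notation mu := (@lebesgueRn R n).

Definition obox (a b : 'I_n -> R) : set 'rV[R]_n :=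
  [set x | forall i, a i < x ord0 i < b i].

Definition oboxes : set (set 'rV[R]_n) :=
  [set A | exists p : ('I_n -> R) * ('I_n -> R), A = obox p.1 p.2].

Lemma measurable_obox a b : @measurable _ (borel 'rV[R]_n) (obox a b).
Proof.
rewrite (_ : obox a b = [set x : borel 'rV[R]_n | forall i, `]a i, b i[%classic (x ord0 i)]).
  by apply: (@measurable_box R n (fun i => `]a i, b i[%classic)) => i; exact: measurable_itv.
by apply/seteqP; split => x /= H i; have := H i; rewrite in_itv.
Qed.

(** A slab a < x_i < b is the increasing union of its intersections with large
    cubes, so the coordinates are measurable for the sigma-algebra generated by
    boxes. *)
Lemma borel_oboxes : @measurable _ (borel 'rV[R]_n) = <<s oboxes >>.
Proof.
apply/seteqP; split; last first.
  apply: smallest_sub; first exact: sigma_algebra_measurable.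
  by move=> _ [p ->]; exact: measurable_obox.
pose T := g_sigma_algebraType oboxes.
suff mid : measurable_fun setT ((fun t => t) : T -> borel 'rV[R]_n).
  by move=> A mA; have := mid measurableT A mA; rewrite setTI preimage_id.
apply: measurable_to_rV => i.
apply: (measurability _ (measurable_realfun.RGenOpens.measurableE R)).
move=> _ [_ [a [b ->]] <-]; rewrite setTI.
rewrite (_ : _ @^-1` _ = \bigcup_k obox (fun j => if j == i then a else - k%:R)
                                     (fun j => if j == i then b else k%:R)).
  by apply: bigcupT_measurable => k; apply: sub_sigma_algebra; eexists (_, _).
apply/seteqP; split => [x /= xab|x [k _] /(_ i)]; last by rewrite eqxx /= in_itv.
exists (Num.truncn `|x|).+1 => //= j; case: eqP => [->|_].
  by move: xab; rewrite in_itv.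
rewrite -ltr_norml (le_lt_trans _ (truncnS_gt _))//.
exact: ler_coord_norm.
Qed.

Lemma setI_closed_oboxes : setI_closed oboxes.
Proof.
move=> _ _ [[a b] ->] [[c d] ->].
exists (fun i => Num.max (a i) (c i), fun i => Num.min (b i) (d i)).
apply/seteqP; split => x /=.
  move=> [H1 H2] i; rewrite gt_max lt_min.
  by have /andP[-> ->] := H1 i; have /andP[-> ->] := H2 i.
move=> H; split => i; have := H i; rewrite gt_max lt_min;
  by move=> /andP[/andP[? ?] /andP[? ?]]; apply/andP.
Qed.

(** The indicator of ]a, b[ is the pointwise limit in j; the slopes are j. *)
Definition ramp (a b : R) (j : nat) (t : R) : R :=
  sstep (j%:R * t + - (j%:R * a)) * sstep ((- j%:R) * t + j%:R * b).

Lemma smooth1_ramp a b j : smooth1 (ramp a b j).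
Proof.
move=> k; apply: (diff_uptoM (f := fun t => sstep (j%:R * t + - (j%:R * a)))
  (g := fun t => sstep (- j%:R * t + j%:R * b)));
  exact/diff_upto_affine/smooth1_sstep.
Qed.

Lemma ramp_out a b j t : ~ (a < t < b) -> ramp a b j t = 0.
Proof.
move=> /negP; rewrite negb_and -!leNgt => /orP[h|h]; rewrite /ramp.
  by rewrite sstep_le0 ?mul0r// subr_le0 ler_wpM2l.
by rewrite mulrC sstep_le0 ?mul0r// addrC mulNr subr_le0 ler_wpM2l.
Qed.

Lemma ramp_ge0 a b j t : 0 <= ramp a b j t.
Proof. by rewrite mulr_ge0// sstep_ge0. Qed.

Lemma ramp_le1 a b j t : ramp a b j t <= 1.
Proof. by rewrite mulr_ile1// ?sstep_ge0 ?sstep_le1. Qed.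

Lemma ramp_in a b t : a < t < b -> exists N, forall j, (N <= j)%N -> ramp a b j t = 1.
Proof.
move=> /andP[at_ tb]; pose N := (Num.truncn (Num.max (t - a)^-1 (b - t)^-1)).+1.
exists N => j Nj.
have : Num.max (t - a)^-1 (b - t)^-1 < j%:R.
  by rewrite (lt_le_trans (truncnS_gt _))// ler_nat.
rewrite gt_max => /andP[h1 h2].
rewrite /ramp !sstep_ge1 ?mulr1//.
  rewrite mulNr addrC -mulrBr; move: h2.
  by rewrite -div1r ltr_pdivrMr ?subr_gt0// => /ltW.
rewrite -mulrBr; move: h1.
by rewrite -div1r ltr_pdivrMr ?subr_gt0// => /ltW.
Qed.

Definition rampbox (a b : 'I_n -> R) j := tens (fun i => ramp (a i) (b i) j).

Lemma rampbox_out a b j x : ~ obox a b x -> rampbox a b j x = 0.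
Proof.
move=> /existsNP[i nx]; rewrite /rampbox /tens (bigD1 i)//= ramp_out ?mul0r//.
Qed.

Lemma rampbox_norm a b j x : `|rampbox a b j x| <= 1.
Proof.
rewrite /rampbox /tens ger0_norm ?prodr_ge0// => [|i _]; last exact: ramp_ge0.
by apply: prodr_ile1 => i _; rewrite ramp_ge0 ramp_le1.
Qed.

Lemma rampbox_in a b x : obox a b x ->
  exists N, forall j, (N <= j)%N -> rampbox a b j x = 1.
Proof.
move=> xab; have /choice[N HN] := fun i => ramp_in (xab i).
exists (\max_i N i)%N => j Nj; apply: big1 => i _; apply: HN.
by rewrite (leq_trans _ Nj)// leq_bigmax.
Qed.

Lemma test_rampbox a b j : test_function (rampbox a b j).
Proof.
apply: (@smooth_supported_test _ _ _ (\sum_i (`|a i| + `|b i|))).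
  by apply: smooth_tens => i; exact: smooth1_ramp.
move=> x [i h]; apply: rampbox_out => /(_ i)/andP[ax xb].
move: h; apply/negP; rewrite -leNgt (bigD1 i)//=.
rewrite (@le_trans _ _ (`|a i| + `|b i|))//; last first.
  by rewrite lerDl sumr_ge0// => k _; rewrite addr_ge0.
have := normr_ge0 (a i); have := normr_ge0 (b i).
have := ler_norm (b i); have := ler_norm (- a i); rewrite normrN => *.
rewrite ler_norml; apply/andP; split; lra.
Qed.

Lemma measurable_test (phi : 'rV[R]_n -> R) :
  test_function phi -> measurable_fun setT (phi : borel 'rV[R]_n -> R).
Proof. by move=> /test_ccont[cf _]; exact: continuous_borel_measurable. Qed.

Lemma integrable_patch (A : set (borel 'rV[R]_n)) (f : borel 'rV[R]_n -> \bar R) :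
  measurable A -> mu.-integrable A f -> mu.-integrable setT (f \_ A).
Proof. by move=> mA; exact: (proj1 (integrable_mkcond f mA)). Qed.

Lemma L1loc_test_integrable (g phi : 'rV[R]_n -> R) :
  L1loc g -> test_function phi ->
  mu.-integrable setT (EFin \o (fun x => g x * phi x)).
Proof.
move=> [mg gK] tp; have [C C0 HC] : exists2 C : R, 0 <= C & forall x, `|phi x| <= C.
  exact/ccont_bounded/test_ccont.
have [M sM] := test_supported tp.
have mK := @measurable_cube R n (ctr n M) (2 * M).
have cK := @compact_cube R n (ctr n M) (2 * M).
have i1 : mu.-integrable setT ((EFin \o (fun x => C * g x)) \_ (cube (ctr n M) (2 * M))).
  apply: (integrable_patch mK).
  have := integrableZl mK C (gK _ cK).
  by apply: eq_integrable => // x _; rewrite /= EFinM.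
apply: le_integrable i1 => //.
  by apply/measurable_EFinP; apply: measurable_funM => //; exact: measurable_test.
move=> x _ /=; rewrite patchE; case: ifPn => [_|].
  by rewrite lee_fin !normrM mulrC (ger0_norm C0) ler_wpM2r.
by rewrite notin_setE => /(supportedP sM) ->; rewrite mulr0 normr0 abse0.
Qed.

Definition cbox (N : R) : set 'rV[R]_n := obox (fun=> - N) (fun=> N).

Lemma cube_obox M (x : 'rV[R]_n) :
  cbox M x -> cube (ctr n M) (2 * M) x.
Proof.
move=> H i; have /andP[h1 h2] := H i; rewrite in_itv/= !mxE; apply/andP; split; lra.
Qed.

(** Smooth ramps converge to indicators of boxes; boxes generate the Borel
    sets and are stable by intersection, so a locally integrable function
    orthogonal to all test functions has a vanishing integral on every bounded
    Borel set. *)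
Lemma orthogonal_test_ae0 (g : 'rV[R]_n -> R) : L1loc g ->
  (forall phi, test_function phi -> \int[mu]_x (g x * phi x) = 0) ->
  {ae mu, forall x : borel 'rV[R]_n, g x = 0}.
Proof.
move=> Lg g0; have [mg gK] := Lg.
have cK N := @compact_cube R n (ctr n N) (2 * N).
have g0' phi : test_function phi -> (\int[mu]_x (g x * phi x)%:E = 0)%E.
  move=> tp; rewrite -(fineK (integrable_fin_num measurableT (L1loc_test_integrable Lg tp))).
  by congr EFin; exact: g0.
have iB N : mu.-integrable (cbox N) (EFin \o g).
  apply: integrableS (gK _ (cK N)).
  - exact: measurable_cube.
  - exact: measurable_obox.
  - exact: cube_obox.
have box0 N a b : (\int[mu]_(x in obox a b `&` cbox N) (g x)%:E = 0)%E.
  have [[c d] E] : oboxes (obox a b `&` cbox N).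
    by apply: setI_closed_oboxes; [exists (a, b)|exists (fun=> - N, fun=> N)].
  have sub : obox c d `<=` cbox N by rewrite -E => x [].
  rewrite E /= integral_mkcond.
  have icd : mu.-integrable setT ((EFin \o g) \_ (obox c d)).
    apply: (integrable_patch (measurable_obox _ _)).
    apply: integrableS (iB N) => //; exact: measurable_obox.
  have mj j : measurable_fun setT (fun x : borel 'rV[R]_n => (g x * rampbox c d j x)%:E).
    by have /integrableP[] := L1loc_test_integrable Lg (test_rampbox c d j).
  have cvj : {ae mu, forall x : borel 'rV[R]_n, setT x ->
      (g x * rampbox c d j x)%:E @[j --> \oo] --> ((EFin \o g) \_ (obox c d)) x}.
    apply: aeW => x _; rewrite patchE; case: ifPn => [|].
      rewrite inE => /rampbox_in[N0 HN0].
      apply: cvg_near_cst; exists N0 => // j /= Nj.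
      by rewrite HN0// mulr1.
    rewrite notin_setE => nx; apply: cvg_near_cst; apply: nearW => j.
    by rewrite rampbox_out// mulr0.
  have domj : {ae mu, forall (x : borel 'rV[R]_n) j, setT x ->
      (`|(g x * rampbox c d j x)%:E| <= `|((EFin \o g) \_ (obox c d)) x|)%E}.
    apply: aeW => x j _; rewrite patchE; case: ifPn => [_|].
      by rewrite /= lee_fin normrM ler_piMr// rampbox_norm.
    by rewrite notin_setE => nx; rewrite rampbox_out// mulr0 abse0.
  have [_ _] := dominated_convergence measurableT mj (measurable_int _ icd) cvj
    (integrable_abse icd) domj.
  rewrite (_ : [sequence _]_j = cst 0%E); last first.
    by apply/funext => j /=; rewrite g0'//; exact: test_rampbox.
  move=> h; apply/esym; apply: (cvg_unique _ _ h); first exact: ereal_hausdorff.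
  exact: cvg_cst.
have boxN N : (\int[mu]_(x in cbox N) (g x)%:E = 0)%E.
  by have := box0 N (fun=> (- N)%R) (fun=> N); rewrite setIid.
have meas0 N A : @measurable _ (borel 'rV[R]_n) A ->
    (\int[mu]_(x in A `&` cbox N) (g x)%:E = 0)%E.
    rewrite borel_oboxes; move: A.
  apply: (@dynkin_induction _ (borel 'rV[R]_n) oboxes (fun A => (\int[mu]_(x in A `&` cbox N) (g x)%:E = 0)%E)).
  - exact: borel_oboxes.
  - exact: setI_closed_oboxes.
  - by rewrite setTI boxN.
  - by move=> _ [[a b] ->]; exact: box0.
  - move=> S mS S0.
    have BE : cbox N = (S `&` cbox N) `|` (~` S `&` cbox N) by rewrite -setIUl setUv setTI.
    have : (\int[mu]_(x in (S `&` cbox N) `|` (~` S `&` cbox N)) (g x)%:E = 0)%E.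
      by rewrite -BE boxN.
    rewrite integral_setU//.
    + by rewrite S0 add0e.
    + by apply: measurableI => //; exact: measurable_obox.
    + by apply: measurableI; [exact: measurableC|exact: measurable_obox].
    + by apply/measurable_EFinP; apply: measurable_funTS.
    + by apply/disj_setPS => x [[Sx _] [nSx _]].
  - move=> F mF tF F0; rewrite setI_bigcupl integral_bigcup.
    + by rewrite eseries0// => i _ _; rewrite F0.
    + by apply: trivIset_setIr.
    + by move=> k; apply: measurableI => //; exact: measurable_obox.
    + apply: integrableS (iB N) => //; first exact: measurable_obox.
        by apply: bigcupT_measurable => k; apply: measurableI => //; exact: measurable_obox.
      by move=> x [k _ []].
have aeN (N : nat) : {ae mu, forall x : borel 'rV[R]_n,
    cbox N%:R x -> g x = 0}.
  have : ae_eq mu (cbox N%:R) (EFin \o g) (cst 0%E).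
    apply: (integral_ae_eq (measurable_obox _ _) (iB _)) => //.
    move=> E EB mE; rewrite integral0.
    by have := meas0 N%:R E mE; rewrite setIidl.
  by apply: filterS => x /= H Bx; have [] := H Bx.
have := ae_foralln aeN; apply: filterS => x H.
apply: (H (Num.truncn `|x|).+1) => i.
rewrite -ltr_norml (le_lt_trans _ (truncnS_gt _))//.
exact: ler_coord_norm.
Qed.

Lemma wderiv_unique k (f g1 g2 : 'rV[R]_n -> R) :
  is_wderiv k f g1 -> is_wderiv k f g2 -> L1norm g1 = L1norm g2.
Proof.
move=> [_ L1 H1] [_ L2 H2].
have L12 : L1loc (fun x => g1 x - g2 x).
  split; first by apply: measurable_funB; [exact: L1.1|exact: L2.1].
  move=> K cK; rewrite (_ : EFin \o _ = (EFin \o g1) \- (EFin \o g2))%E//.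
  by apply: integrableB; [exact: compact_measurable_borel|exact: L1.2|exact: L2.2].
have ae0 : {ae mu, forall x : borel 'rV[R]_n, g1 x - g2 x = 0}.
  apply: orthogonal_test_ae0 => // phi tp.
  transitivity (\int[mu]_x (g1 x * phi x - g2 x * phi x)).
    by apply: eq_Rintegral => x _; rewrite mulrBl.
  rewrite RintegralB//; [|exact: L1loc_test_integrable..].
  apply/eqP; rewrite subr_eq0; apply/eqP/(@mulfI _ ((-1) ^+ morder k)).
    by rewrite signr_eq0.
  by rewrite -H1// -H2.
apply: ae_eq_integral => //.
- by apply/measurable_EFinP; apply: measurableT_comp => //; exact: L1.1.
- by apply/measurable_EFinP; apply: measurableT_comp => //; exact: L2.1.
- by apply: filterS ae0 => x /= /eqP; rewrite subr_eq0 => /eqP ->.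
Qed.

End weak_uniqueness.

(** * Iterated derivatives on the line *)

Section iterated_derivatives.
Context {R : realType}.
Implicit Types (f g : R -> R).

Lemma derive1n_affine k f (a b : R) : smooth1 f ->
  derive1n k (fun t => f (a * t + b)) = fun t => a ^+ k * derive1n k f (a * t + b).
Proof.
move=> sf; elim: k => [|k IH]; first by apply/funext => t; rewrite mul1r.
rewrite derive1nS IH; apply/funext => t; rewrite derive1E; apply: derive_val.
have dg : is_derive t (1 : R) (fun x : R => a * x + b) a.
  have h1 : is_derive t (1 : R) (fun x : R => a * x) a.
    have h := @is_deriveZ _ _ _ id a t 1 1 _.
    by apply: is_derive_eq; rewrite /GRing.scale/= mulr1.
  by apply: is_derive_eq; rewrite addr0.
have sk := smooth1_derive1n k sf.
have h := @is_derive1_comp _ (derive1n k f) _ t _ _ (smooth1_is_derive (a * t + b) sk) dg.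
have h2 := @is_deriveZ _ _ _ _ (a ^+ k) _ _ _ h.
apply: is_derive_eq; rewrite /GRing.scale/= -derive1nS exprSr; lra.
Qed.

Lemma derive1n_open k f g (U : set R) : open U -> {in U, f =1 g} ->
  {in U, derive1n k f =1 derive1n k g}.
Proof.
move=> oU fg; elim: k => [//|k IH] t; rewrite !derive1nS inE => Ut.
rewrite !derive1E; apply: near_eq_derive.
have : nbhs t U by exact: open_nbhs_nbhs.
by apply: filterS => s Us; apply: IH; rewrite inE.
Qed.

Lemma derive1n_cst0 k : derive1n k (cst 0 : R -> R) = cst 0.
Proof.
elim: k => [//|k IH]; rewrite derive1nS IH; apply/funext => t.
by rewrite derive1E derive_cst.
Qed.

Lemma open_normgt (M : R) : open [set t : R | M < `|t|].
Proof.
rewrite (_ : [set _ | _] = Num.norm @^-1` [set t : R | M < t])//.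
apply: open_comp; last exact: open_gt.
by move=> y _; exact: norm_continuous.
Qed.

Lemma supported1_derive1n k M f : supported1 M f -> supported1 M (derive1n k f).
Proof.
move=> sf t Mt.
rewrite (@derive1n_open k f (cst 0) [set t | M < `|t|]) ?inE//.
- by rewrite derive1n_cst0.
- exact: open_normgt.
- by move=> s; rewrite inE => /sf ->.
Qed.

Lemma smooth1_supported_bounded f M : smooth1 f -> supported1 M f ->
  exists2 C, 0 <= C & forall t, `|f t| <= C.
Proof.
move=> sf sM.
have /compact_bounded[C [_ HC]] : compact (f @` `[- M, M]).
  apply: continuous_compact; last exact: segment_compact.
  exact/continuous_subspaceT/smooth1_continuous.
exists `|C + 1| => // t; have [Mt|Mt] := ltP M `|t|.
  by rewrite sM ?normr0.
rewrite (le_trans _ (ler_norm _))//; apply: (HC (C + 1)); first by rewrite ltrDl.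
by exists t => //=; rewrite in_itv/= -ler_norml.
Qed.

End iterated_derivatives.

(** * Test functions as elements of the Sobolev space *)

Section weak_derivatives.
Context {R : realType} {n : nat}.
Local Notation mu := (@lebesgueRn R n).
Implicit Types (f u v : 'rV[R]_n -> R).

Lemma ccont_L1loc f : ccont f -> L1loc f.
Proof.
move=> cf; split; first exact: continuous_borel_measurable cf.1.
move=> K cK; apply: integrableS (ccont_integrable cf) => //.
exact: compact_measurable_borel.
Qed.

Lemma test_derivable u x i : test_function u -> derivable u x (delta_mx ord0 i).
Proof. by move=> [su _]; have [_ d] := su [::]; exact: d. Qed.

Lemma ccontM u v : ccont u -> continuous v -> ccont (fun x => u x * v x).
Proof.
move=> [cu [M sM]] cv; split; first by move=> x; apply: continuousM; [exact: cu|exact: cv].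
by exists M => x Mx; rewrite sM// mul0r.
Qed.

Lemma integration_by_parts_test u v i : test_function u -> test_function v ->
  \int[mu]_x (u x * partial i v x) = - \int[mu]_x (partial i u x * v x).
Proof.
move=> tu tv.
have tpu := test_partial i tu; have tpv := test_partial i tv.
have E x : partial i (fun x => u x * v x) x = u x * partial i v x + partial i u x * v x.
  rewrite /partial deriveM; [|exact: test_derivable..].
  by rewrite /GRing.scale/= [v x * _]mulrC.
have i1 : mu.-integrable setT (EFin \o (fun x => u x * partial i v x)).
  by apply: ccont_integrable; apply: ccontM; [exact: test_ccont|exact: (test_ccont tpv).1].
have i2 : mu.-integrable setT (EFin \o (fun x => partial i u x * v x)).
  by apply: ccont_integrable; apply: ccontM; [exact: test_ccont|exact: (test_ccont tv).1].
apply/eqP; rewrite -addr_eq0 -RintegralD//; apply/eqP.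
transitivity (\int[mu]_x partial i (fun x => u x * v x) x).
  by apply: eq_Rintegral => x _; rewrite E.
rewrite /Rintegral integral_partial0//.
- by apply: ccontM; [exact: test_ccont|exact: (test_ccont tv).1].
- by move=> x; apply: derivableM; exact: test_derivable.
- rewrite (_ : partial i _ = fun x => u x * partial i v x + partial i u x * v x).
    have c1 := (ccontM (test_ccont tu) (test_ccont tpv).1).1.
    have c2 := (ccontM (test_ccont tpu) (test_ccont tv).1).1.
    by move=> x; exact: (cvgD (c1 x) (c2 x)).
  by apply/funext => x; rewrite E.
Qed.

Lemma test_iter_partial k u i : test_function u -> test_function (iter k (partial i) u).
Proof. by move=> tu; elim: k => [//|k IH]; rewrite iterS; exact: test_partial. Qed.

Lemma integration_by_parts_iter k u v i : test_function u -> test_function v ->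
  \int[mu]_x (u x * iter k (partial i) v x) =
  (-1) ^+ k * \int[mu]_x (iter k (partial i) u x * v x).
Proof.
elim: k u => [|k IH] u tu tv; first by rewrite mul1r.
rewrite iterS integration_by_parts_test//; last exact: test_iter_partial.
rewrite IH//; last exact: test_partial.
by rewrite -iterSr exprS mulN1r mulNr.
Qed.

Lemma test_mderiv k v (s : seq 'I_n) : test_function v ->
  test_function (foldr (fun i => iter (k i) (partial i)) v s).
Proof. by move=> tv; elim: s => [//|i s IH] /=; exact: test_iter_partial. Qed.

Lemma test_tens (b : 'I_n -> R -> R) M :
  (forall i, smooth1 (b i)) -> (forall i, supported1 M (b i)) ->
  test_function (tens b).
Proof.
move=> sb sM; apply: (@smooth_supported_test _ _ _ M).
  exact: smooth_tens.
exact: supported_tens.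
Qed.

(** The factors of the mixed derivative are integrated by parts one axis after
    another, in the order in which they are composed. *)
Lemma is_wderiv_tens (b : 'I_n -> R -> R) M k :
  (forall i, smooth1 (b i)) -> (forall i, supported1 M (b i)) ->
  is_wderiv k (tens b) (tens (fun i => derive1n (k i) (b i))).
Proof.
move=> sb sM; split.
- exact/ccont_L1loc/test_ccont/(test_tens sb sM).
- apply/ccont_L1loc/test_ccont; apply: (@test_tens _ M) => i.
    exact: smooth1_derive1n.
  exact: supported1_derive1n.
move=> phi tp; rewrite /mderiv /morder.
have H s (b' : 'I_n -> R -> R) : uniq s -> (forall i, smooth1 (b' i)) ->
    (forall i, supported1 M (b' i)) ->
    \int[mu]_x (tens b' x * foldr (fun i => iter (k i) (partial i)) phi s x) =
    (-1) ^+ (\sum_(i <- s) k i) *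
    \int[mu]_x (tens (fun j => if j \in s then derive1n (k j) (b' j) else b' j) x * phi x).
  elim: s b' => [|i s IH] b' /=.
    by rewrite big_nil mul1r => _ _ _; apply: eq_Rintegral.
  move=> /andP[nis us] sb' sM'.
  rewrite integration_by_parts_iter; [|exact: (test_tens sb' sM')|exact: test_mderiv].
  rewrite iter_partial_tens// IH//.
  - rewrite big_cons exprD -mulrA; congr (_ * (_ * _)).
    apply: eq_Rintegral => x _; congr (tens _ x * _).
    apply/funext => j; rewrite in_cons.
    by have [->|//] := eqVneq j i; rewrite (negbTE nis).
  - by move=> j; case: eqP => // _; exact: smooth1_derive1n.
  - by move=> j; case: eqP => // _; exact: supported1_derive1n.
rewrite (H _ b (enum_uniq _))//; congr (_ ^+ _ * _).
  by rewrite big_enum.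
apply: eq_Rintegral => x _; congr (tens _ x * _).
by apply/funext => j; rewrite mem_enum.
Qed.

Lemma L1loc0 : L1loc (0 : 'rV[R]_n -> R).
Proof.
by apply: ccont_L1loc; split; [exact: cst_continuous|exists 0].
Qed.

Lemma is_wderiv0 k : is_wderiv k (0 : 'rV[R]_n -> R) 0.
Proof.
split; [exact: L1loc0..|] => phi tp.
under eq_Rintegral do rewrite mul0r.
under [X in _ * X]eq_Rintegral do rewrite mul0r.
by rewrite Rintegral_cst// mul0r mulr0.
Qed.

(** The norm of the representative chosen in the Sobolev norm can be read off
    from any other one. *)
Lemma L1norm_wderiv k f g : is_wderiv k f g -> L1norm (wderiv k f) = L1norm g.
Proof.
move=> H; have H' : is_wderiv k f (wderiv k f).
  by apply: (@xgetPex _ (cst 0) [set g | is_wderiv k f g]); exists g.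
exact: wderiv_unique H' H.
Qed.

Lemma L1norm_ge0 f : (0 <= L1norm f)%E.
Proof. exact: integral_ge0. Qed.

Lemma wnorm_ge0 m f : (0 <= wnorm m f)%E.
Proof. by apply: sume_ge0 => k _; exact: L1norm_ge0. Qed.

Lemma L1norm0 : L1norm (0 : 'rV[R]_n -> R) = 0%E.
Proof. by rewrite /L1norm integral0_eq// => x _; rewrite abse0. Qed.

Lemma wnorm0 m : wnorm m (0 : 'rV[R]_n -> R) = 0%E.
Proof.
rewrite /wnorm big1// => k _; rewrite (L1norm_wderiv (@is_wderiv0 _)).
exact: L1norm0.
Qed.

Lemma L1_0 : L1 (0 : 'rV[R]_n -> R).
Proof. exact: integrable0. Qed.

Lemma w1_0 m : w1 m (0 : 'rV[R]_n -> R).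
Proof.
split; first by move=> k _; exists 0; [exact: is_wderiv0|exact: L1_0].
move=> e e0; exists 0; last by rewrite subrr wnorm0 lte_fin.
apply: (@smooth_supported_test _ _ _ 0) => // s.
have -> : foldr partial (0 : 'rV[R]_n -> R) s = cst 0.
  elim: s => [//|i s /= ->]; apply/funext => x.
  by rewrite /partial derive_cst.
by split; [exact: cst_continuous|move=> x i; exact: derivable_cst].
Qed.

Lemma w1_tens m (b : 'I_n -> R -> R) M :
  (forall i, smooth1 (b i)) -> (forall i, supported1 M (b i)) ->
  w1 m (tens b).
Proof.
move=> sb sM; split=> [k _|e e0].
  exists (tens (fun i => derive1n (k i) (b i))); first exact: (is_wderiv_tens _ sb sM).
  apply/ccont_integrable/test_ccont; apply: (@test_tens _ M) => i.
    exact: smooth1_derive1n.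
  exact: supported1_derive1n.
exists (tens b); first exact: (test_tens sb sM).
by rewrite subrr wnorm0 lte_fin.
Qed.

Lemma schwartz_tens (b : 'I_n -> R -> R) M :
  (forall i, smooth1 (b i)) -> (forall i, supported1 M (b i)) ->
  schwartz (tens b).
Proof.
move=> sb sM; split; first exact: smooth_tens.
move=> a k.
have cc : ccont (fun x => mderiv k (tens b) x * tens (fun i t => t ^+ a i) x).
  apply: ccontM.
    exact/test_ccont/test_mderiv/(test_tens sb sM).
  apply: continuous_tens => i; exact: exprn_continuous.
have [C _ HC] := ccont_bounded cc; exists C => x.
by rewrite mulrC; exact: HC.
Qed.

Lemma L1norm_le f (C : R) (K : set 'rV[R]_n) :
  @measurable _ (borel 'rV[R]_n) K -> 0 <= C ->
  (forall x, `|f x| <= C) -> (forall x, ~ K x -> f x = 0) ->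
  (L1norm f <= C%:E * mu K)%E.
Proof.
move=> mK C0 fC fK.
have -> : mu K = (\int[mu]_x (\1_K x)%:E)%E.
  by rewrite (integral_indic mu measurableT mK) setIT.
rewrite -ge0_integralZl//.
- apply: ge0_le_integral_nomeas => // x _.
  rewrite /= -EFinM lee_fin indicE; case: (boolP (x \in K)) => [_|].
    by rewrite mulr1.
  by rewrite notin_setE => /fK ->; rewrite normr0 mulr_ge0.
- exact/measurable_EFinP.
Qed.

End weak_derivatives.

(** * Real interpolation norms *)

Section interpolation.
Context {R : realType}.
Local Notation lam := (@lebesgue_measure R).

Lemma nneseries_geometric (a z : R) : 0 <= z < 1 ->
  (\sum_(j <oo) (a * z ^+ j)%:E = (a / (1 - z))%:E)%E.
Proof.
move=> /andP[z0 z1]; apply: cvg_lim; first exact: ereal_hausdorff.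
rewrite (_ : (fun k => _) = EFin \o series (geometric a z)).
  by apply: cvg_EFin; [exact: nearW|apply: cvg_geometric_series; rewrite ger0_norm].
by apply/funext => k; rewrite /= /series/= big_mkord sumEFin big_mkord.
Qed.

Lemma dyadic_scale (x : R) : 1 <= x -> exists j : nat, 2 ^+ j <= x < 2 ^+ j.+1.
Proof.
move=> x1; have ex : exists j : nat, x < 2 ^+ j.+1.
  exists (Num.truncn x); rewrite (lt_le_trans (truncnS_gt _))//.
  by rewrite -natrX ler_nat; exact/ltnW/ltn_expl.
have := ex_minnP ex => -[[|j] xj jmin]; first by exists 0%N; rewrite expr0 x1.
exists j.+1; rewrite xj andbT leNgt; apply/negP => /jmin; by rewrite ltnn.
Qed.

Lemma exprn_powR (x a : R) j : 0 <= x -> (x ^+ j) `^ a = (x `^ a) ^+ j.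
Proof.
move=> x0; elim: j => [|j IH]; first by rewrite !expr0 powR1.
by rewrite !exprS powRM ?exprn_ge0// IH.
Qed.

Lemma powR_invl (x a : R) : 0 <= x -> x^-1 `^ a = x `^ (- a).
Proof. by move=> x0; rewrite -powR_inv1// -powRrM mulN1r. Qed.

Lemma integral_scaled_indic (c : R) (I : set R) : 0 <= c -> measurable I ->
  (\int[lam]_t (c%:E * (\1_I t)%:E) = c%:E * lam I)%E.
Proof.
move=> c0 mI; have mi : measurable_fun setT (fun t : R => (\1_I t : R)%:E).
  exact/measurable_EFinP.
by rewrite ge0_integralZl// (integral_indic lam measurableT mI) setIT.
Qed.

Context {V : zmodType} (A0 A1 : set V) (N0 N1 : V -> \bar R).
Hypothesis N0_ge0 : forall f, (0 <= N0 f)%E.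
Hypothesis N1_ge0 : forall f, (0 <= N1 f)%E.
Local Notation K := (Kfun A0 A1 N0 N1).
Local Notation inorm := (interp_norm A0 A1 N0 N1).

Lemma Kfun_ge0 t f : 0 <= t -> (0 <= K t f)%E.
Proof.
move=> t0; apply: le_ereal_inf_tmp => _ [p _ <-].
by rewrite adde_ge0// mule_ge0.
Qed.

Lemma Kfun_homo s t f : 0 <= s -> s <= t -> (K s f <= K t f)%E.
Proof.
move=> s0 st; apply: le_ereal_inf_tmp => _ [p Hp <-].
apply: ge_ereal_inf; exists (N0 p.1 + s%:E * N1 p.2)%E; first by exists p.
by rewrite leeD2l// lee_wpmul2r// lee_fin.
Qed.

Lemma poweR_homo (p : R) (x y : \bar R) : 0 <= p -> (0 <= x)%E -> (x <= y)%E ->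
  (x `^ p <= y `^ p)%E.
Proof.
move=> p0 x0 xy; apply: gt0_ler_poweR => //; rewrite in_itv/= leey andbT//.
exact: le_trans xy.
Qed.

(** The K-functional increases with t: over [t, 2t] the integrand is at least a
    constant multiple of its value at t. *)
Lemma Kfun_le_interp (theta : R) (q : \bar R) : 0 < theta -> (0 < q)%E ->
  exists2 B : R, 0 < B & forall (t : R) f, 0 < t ->
    ((t `^ (- theta))%:E * K t f <= B%:E * inorm theta q f)%E.
Proof.
move=> th0; case: q => [q|_|//]; last first.
  exists 1 => // t f t0; rewrite mul1e; apply: ereal_sup_ubound; by exists t.
rewrite lte_fin => q0; exists (2 `^ (theta + q^-1)); first exact: powR_gt0.
move=> t f t0; set k := K t f.
have k0 : (0 <= k)%E by apply: Kfun_ge0; exact: ltW.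
pose c := (((((2 * t) `^ (- theta))%:E * k) `^ q) * ((2 * t)^-1)%:E)%E.
have t20 : 0 < 2 * t by rewrite mulr_gt0.
have c0 : (0 <= c)%E.
  by rewrite mule_ge0// ?poweR_ge0// lee_fin invr_ge0 ltW.
have ct : ((c * t%:E) <= \int[lam]_(s in `]0%R, +oo[)
    (((s `^ (- theta))%:E * K s f) `^ q * (s^-1)%:E))%E.
  have -> : (c * t%:E = \int[lam]_(s in `[t, (2 * t)%R]) (cst c s))%E.
    rewrite integral_cst//= lebesgue_measure_itv/= lte_fin ltr_pMl// ltr1n.
    by rewrite -EFinD; congr (_ * _%:E)%E; lra.
  rewrite integral_mkcond [leRHS]integral_mkcond.
  apply: ge0_le_integral_nomeas => s _.
    by rewrite patchE; case: ifPn.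
  have F0 (s' : R) : 0 < s' -> (0 <= ((s' `^ (- theta))%:E * K s' f) `^ q * (s'^-1)%:E)%E.
    by move=> s'0; rewrite mule_ge0 ?poweR_ge0// lee_fin invr_ge0 ltW.
  rewrite !patchE; case: ifPn; last first.
    move=> _; case: ifPn => //; rewrite inE/= in_itv/= andbT; exact: F0.
  rewrite inE/= in_itv/= => /andP[ts st].
  have s0 : 0 < s by exact: lt_le_trans ts.
  rewrite mem_set ?ifT//=; last by rewrite in_itv/= s0.
  apply: lee_pmul.
  - exact: poweR_ge0.
  - by rewrite lee_fin invr_ge0 ltW.
  - apply: poweR_homo; [exact: ltW|by rewrite mule_ge0// lee_fin powR_ge0|].
    apply: lee_pmul => //; first by rewrite lee_fin powR_ge0.
      rewrite lee_fin !powRN lef_pV2 ?posrE ?powR_gt0//.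
      by apply: ge0_ler_powR => //; [exact: ltW|rewrite nnegrE ltW..].
    by apply: Kfun_homo => //; exact: ltW.
  - by rewrite lee_fin lef_pV2.
have {ct} := poweR_homo (p := q^-1) _ _ ct; rewrite invr_ge0 (ltW q0).
move=> /(_ isT); rewrite mule_ge0 ?lee_fin ?(ltW t0)// => /(_ isT) ct.
rewrite /interp_norm; apply: le_trans (lee_wpmul2l _ ct); last by rewrite lee_fin powR_ge0.
rewrite /c -muleA -EFinM (_ : (2 * t)^-1 * t = 2^-1); last first.
  by rewrite invfM -mulrA mulVf ?mulr1// gt_eqF.
have w0 : (0 <= ((2 * t) `^ (- theta))%:E * k)%E.
  by rewrite mule_ge0// lee_fin powR_ge0.
have h2 : (0 <= (2^-1 : R)%:E)%E by rewrite lee_fin.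
rewrite (poweRM _ (poweR_ge0 _ _) h2).
rewrite -poweRrM mulfV ?(gt_eqF q0)// poweRe1// poweR_EFin.
rewrite [X in (_ <= _ * X)%E]muleC !muleA -!EFinM.
suff -> : t `^ (- theta) = 2 `^ (theta + q^-1) * 2^-1 `^ q^-1 * (2 * t) `^ (- theta) by [].
rewrite powRM ?(ltW t0)// powRD; last by rewrite (_ : (2 : R) != 0) ?implybT.
rewrite -[2^-1]powR_inv1// -powRrM mulN1r.
have h a : (2 : R) `^ (- a) * 2 `^ a = 1 by rewrite powRN mulVf// gt_eqF// powR_gt0.
have aux (a a' b b' u : R) : a' * a = 1 -> b' * b = 1 -> u = a * b * b' * (a' * u).
  move=> h1 h3; rewrite -(mulrA a) (mulrC b) h3 mulr1 mulrA (mulrC a) h1.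
  by rewrite mul1r.
by apply: aux; exact: h.
Qed.

(** The hypotheses say that K is at most A min(1, t / s). The integral over the
    dyadic shells above and below s is then bounded by two geometric series,
    which converge since 0 < theta < 1. *)
Lemma interp_norm_le (theta : R) (q : \bar R) : 0 < theta < 1 -> (0 < q)%E ->
  exists2 B : R, 0 < B & forall (A s : R) f, 0 <= A -> 0 < s ->
    (forall t, 0 < t -> (K t f <= A%:E)%E) ->
    (forall t, 0 < t -> (K t f <= (A * (t / s))%:E)%E) ->
    (inorm theta q f <= (B * (A * s `^ (- theta)))%:E)%E.
Proof.
move=> /andP[th0 th1]; case: q => [q|_|//]; last first.
  exists 1 => // A s f A0' s0 HA Hs; rewrite mul1r.
  apply: ge_ereal_sup => _ [t /= t0 <-].
  have [st|ts] := leP s t.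
    rewrite (le_trans (lee_wpmul2l _ (HA t t0))) ?lee_fin ?powR_ge0//.
    rewrite mulrC ler_wpM2l// !powRN lef_pV2 ?posrE ?powR_gt0//.
    by apply: ge0_ler_powR => //; [exact: ltW|rewrite nnegrE ltW..].
  rewrite (le_trans (lee_wpmul2l _ (Hs t t0))) ?lee_fin ?powR_ge0//.
  rewrite mulrCA ler_wpM2l// mulrA -ler_pdivlMr ?invr_gt0// invrK.
  have E (u : R) : 0 < u -> u `^ (- theta) * u = u `^ (1 - theta).
    move=> u0; rewrite addrC powRD ?powRr1 ?(ltW u0)//.
    by rewrite (gt_eqF u0) implybT.
  rewrite !E//; apply: ge0_ler_powR; [lra|by rewrite nnegrE ltW..|exact: ltW].
rewrite lte_fin => q0.
pose z1 : R := 2 `^ (- (theta * q)); pose z2 : R := 2 `^ (- ((1 - theta) * q)).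
have zz (a : R) : 0 < a -> 0 <= (2 : R) `^ (- a) < 1.
  move=> a0; rewrite powR_ge0/= powRN invf_lt1 ?powR_gt0//.
  rewrite -[ltLHS](@powRr0 _ 2); rewrite /powR pnatr_eq0/= ltr_expR ltr_pM2r//.
  by rewrite ln_gt0// ltr1n.
have hz1 : 0 <= z1 < 1 by apply: zz; rewrite mulr_gt0.
have hz2 : 0 <= z2 < 1 by apply: zz; rewrite mulr_gt0// subr_gt0.
pose S := (1 / (1 - z1) + 1 / (1 - z2)).
have S0 : 0 < S.
  by rewrite addr_gt0// divr_gt0// subr_gt0; [case/andP: hz1|case/andP: hz2].
exists (S `^ q^-1); first exact: powR_gt0.
move=> A s f A0' s0 HA Hs; rewrite /interp_norm.
pose D := (A * s `^ (- theta)) `^ q.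
suff : (\int[lam]_(t in `]0%R, +oo[)
    (((t `^ (- theta))%:E * K t f) `^ q * (t^-1)%:E) <= (D * S)%:E)%E.
  move=> h; apply: le_trans (poweR_homo (p := q^-1) _ _ h) _.
  - by rewrite invr_ge0 ltW.
  - apply: integral_ge0 => t; rewrite /= in_itv/= andbT => t0.
    by rewrite mule_ge0 ?poweR_ge0// lee_fin invr_ge0 ltW.
  rewrite poweR_EFin lee_fin mulrC powRM ?(ltW S0)// ?powR_ge0//.
  rewrite /D -powRrM mulfV ?gt_eqF// powRr1// mulr_ge0 ?powR_ge0//.
(* the shells above and below s, with the values there of the bound *)
pose I1 (j : nat) := `[2 ^+ j * s, 2 ^+ j.+1 * s[%classic.
pose I2 (j : nat) := `](2 ^+ j.+1)^-1 * s, (2 ^+ j)^-1 * s]%classic.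
pose c1 j := (A * (2 ^+ j * s) `^ (- theta)) `^ q / (2 ^+ j * s).
pose c2 j := (A * (((2 ^+ j)^-1 * s) `^ (1 - theta) / s)) `^ q / ((2 ^+ j.+1)^-1 * s).
pose g j t := ((c1 j)%:E * (\1_(I1 j) t)%:E + (c2 j)%:E * (\1_(I2 j) t)%:E)%E.
have pw (j : nat) : 0 < (2 : R) ^+ j by rewrite exprn_gt0.
have c10 j : 0 <= c1 j by rewrite divr_ge0 ?powR_ge0// mulr_ge0 ?(ltW s0)// ltW.
have c20 j : 0 <= c2 j.
  by rewrite divr_ge0 ?powR_ge0// mulr_ge0 ?(ltW s0)// invr_ge0 ltW.
have g0 j t : (0 <= g j t)%E.
  by rewrite adde_ge0// mule_ge0// lee_fin.
have mI1 j : measurable (I1 j) by exact: measurable_itv.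
have mI2 j : measurable (I2 j) by exact: measurable_itv.
have mg j : measurable_fun setT (g j).
  by apply: emeasurable_funD; apply: measurable_funeM; apply/measurable_EFinP.
have lI1 j : lam (I1 j) = (2 ^+ j * s)%:E.
  rewrite lebesgue_measure_itv/= lte_fin ltr_pM2r// exprS ltr_pMl// ltr1n.
  by rewrite -EFinD; congr EFin; lra.
have lI2 j : lam (I2 j) = ((2 ^+ j.+1)^-1 * s)%:E.
  rewrite /I2.
  have -> : 2 ^- j = 2 * 2 ^- j.+1 :> R by rewrite exprS invfM mulrA mulfV// mul1r.
  have w0 : 0 < 2 ^- j.+1 :> R by rewrite invr_gt0.
  move: (2 ^- j.+1) w0 => w w0.
  rewrite lebesgue_measure_itv/= lte_fin ltr_pM2r// ltr_pMl// ltr1n.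
  by rewrite -EFinD; congr EFin; lra.
have i0 (c : R) (I : set R) (t : R) : 0 <= c -> (0 <= c%:E * (\1_I t)%:E)%E.
  by move=> ?; rewrite mule_ge0// lee_fin.
have mi (c : R) (I : set R) : measurable I ->
    measurable_fun setT (fun t : R => c%:E * (\1_I t : R)%:E)%E.
  by move=> mI; apply: measurable_funeM; apply/measurable_EFinP.
have int_g j : (\int[lam]_t g j t = (c1 j * (2 ^+ j * s) + c2 j * ((2 ^+ j.+1)^-1 * s))%:E)%E.
  rewrite (ge0_integralD lam measurableT (fun t _ => i0 _ _ t (c10 j))
    (mi _ _ (mI1 j)) (fun t _ => i0 _ _ t (c20 j)) (mi _ _ (mI2 j))).
  by rewrite !integral_scaled_indic// lI1 lI2.
have E1 j : c1 j * (2 ^+ j * s) = D * z1 ^+ j.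
  have e1 : ((2 ^+ j) `^ (- theta)) `^ q = z1 ^+ j.
    by rewrite !exprn_powR ?powR_ge0// -powRrM mulNr.
  have e2 : (2 ^+ j * s) `^ (- theta) = (2 ^+ j) `^ (- theta) * s `^ (- theta).
    by rewrite powRM// ltW.
  rewrite /c1 mulfVK ?gt_eqF ?mulr_gt0// e2 mulrCA powRM ?e1 ?powR_ge0//.
    by rewrite mulrC.
  by rewrite mulr_ge0 ?powR_ge0.
have E2 j : c2 j * ((2 ^+ j.+1)^-1 * s) = D * z2 ^+ j.
  have e0 : s `^ (1 - theta) / s = s `^ (- theta).
    rewrite powRD ?powRr1 ?(ltW s0)//; last by rewrite (gt_eqF s0) implybT.
    by rewrite mulrAC mulfV ?gt_eqF// mul1r.
  have e1 : ((2 ^- j) `^ (1 - theta)) `^ q = z2 ^+ j.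
    by rewrite -exprVn !exprn_powR ?powR_ge0 ?invr_ge0// powR_invl// -powRrM mulNr.
  have e2 : (2 ^- j * s) `^ (1 - theta) / s = (2 ^- j) `^ (1 - theta) * s `^ (- theta).
    by rewrite powRM ?(ltW s0)// -mulrA e0.
  rewrite /c2 mulfVK ?gt_eqF ?mulr_gt0 ?invr_gt0// e2 mulrCA powRM ?e1 ?powR_ge0//.
    by rewrite mulrC.
  by rewrite mulr_ge0 ?powR_ge0.
have F0 t : 0 < t -> (0 <= ((t `^ (- theta))%:E * K t f) `^ q * (t^-1)%:E)%E.
  by move=> t0; rewrite mule_ge0 ?poweR_ge0// lee_fin invr_ge0 ltW.
have Fle t u v w : 0 < t -> (K t f <= u%:E)%E -> t `^ (- theta) * u <= v -> t^-1 <= w ->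
    (((t `^ (- theta))%:E * K t f) `^ q * (t^-1)%:E <= (v `^ q * w)%:E)%E.
  move=> t0 Ku uv tw; rewrite EFinM -(poweR_EFin v q); apply: lee_pmul.
  - exact: poweR_ge0.
  - by rewrite lee_fin invr_ge0 ltW.
  - apply: poweR_homo; first exact: ltW.
      by rewrite mule_ge0 ?lee_fin ?powR_ge0// Kfun_ge0// ltW.
    apply: le_trans (lee_wpmul2l _ Ku) _; first by rewrite lee_fin powR_ge0.
    by rewrite -EFinM lee_fin.
  - by rewrite lee_fin.
have gle j t : (g j t <= \sum_(j <oo) g j t)%E.
  apply: le_trans (nneseries_lim_ge j.+1 _); last by move=> *; exact: g0.
  rewrite big_nat_recr//= leeDr//; apply: sume_ge0 => i _; exact: g0.
apply: (@le_trans _ _ (\int[lam]_t (\sum_(j <oo) g j t))%E).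
  rewrite integral_mkcond; apply: ge0_le_integral_nomeas => t _.
    rewrite patchE; case: ifPn => //; rewrite inE/= in_itv/= andbT; exact: F0.
  rewrite patchE; case: ifPn => [|_]; last first.
    by apply: nneseries_ge0 => *; exact: g0.
  rewrite inE/= in_itv/= andbT => t0.
  have [st|ts] := leP s t.
    have [j /andP[j1 j2]] : exists j : nat, 2 ^+ j <= t / s < 2 ^+ j.+1.
      by apply: dyadic_scale; rewrite ler_pdivlMr// mul1r.
    move: j1 j2; rewrite ler_pdivlMr// ltr_pdivrMr// => j1 j2.
    apply: le_trans (gle j t).
    rewrite /g indicE mem_set; last by rewrite /I1/= in_itv/= j1.
    rewrite mule1 -[leLHS]adde0; apply: leeD; last first.
      by rewrite mule_ge0// lee_fin.
    have js0 : 0 < 2 ^+ j * s by rewrite mulr_gt0.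
    apply: (@Fle t A) => //; first exact: HA.
      rewrite mulrC ler_wpM2l// !powRN lef_pV2 ?posrE ?powR_gt0//.
      by apply: ge0_ler_powR => //; [exact: ltW|rewrite nnegrE ltW..].
    by rewrite lef_pV2.
  have [j /andP[j1 j2]] : exists j : nat, 2 ^+ j <= s / t < 2 ^+ j.+1.
    by apply: dyadic_scale; rewrite ler_pdivlMr// mul1r ltW.
  move: j1 j2; rewrite ler_pdivlMr// ltr_pdivrMr// => j1 j2.
  apply: le_trans (gle j t).
  have tI2 : \1_(I2 j) t = 1 :> R.
    rewrite indicE mem_set//.
    by rewrite /I2/= in_itv/= ltr_pdivrMl// j2/= ler_pdivlMl.
  rewrite /g tI2 mule1 -[leLHS]add0e; apply: leeD.
    by rewrite mule_ge0// lee_fin.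
  have js0 : 0 < 2 ^- j * s by rewrite mulr_gt0// invr_gt0.
  have js1 : 0 < 2 ^- j.+1 * s by rewrite mulr_gt0// invr_gt0.
  apply: (@Fle t (A * (t / s))) => //; first exact: Hs.
    rewrite mulrCA ler_wpM2l// mulrA ler_wpM2r ?invr_ge0 ?(ltW s0)//.
    rewrite -{2}[t]powRr1 ?(ltW t0)// -powRD; last by rewrite (gt_eqF t0) implybT.
    rewrite addrC; apply: ge0_ler_powR; [lra|by rewrite nnegrE ltW..|].
    by rewrite ler_pdivlMl.
  by rewrite lef_pV2 ?posrE// ler_pdivrMl// ltW.
rewrite integral_nneseries//.
under eq_eseriesr => j _ do rewrite int_g E1 E2 EFinD.
have D0 : 0 <= D by exact: powR_ge0.
rewrite nneseriesD; last 2 first.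
- by move=> j _ _; rewrite lee_fin mulr_ge0// exprn_ge0//; case/andP: hz1.
- by move=> j _ _; rewrite lee_fin mulr_ge0// exprn_ge0//; case/andP: hz2.
rewrite !nneseries_geometric// -EFinD lee_fin /S; lra.
Qed.

End interpolation.

(** * The capacity of a ball *)

Section ball_capacity.
Context {R : realType}.

(** Equal to 1 on [-1, 1], and to 0 outside [-2, 2]; the factors have the form
    a * t + b of the closure lemma for affine changes of variable. *)
Definition bump1 (t : R) : R := sstep (1 * t + 2) * sstep ((-1) * t + 2).

Lemma smooth1_bump1 : smooth1 bump1.
Proof.
by move=> k; apply: (@diff_uptoM _ _ (fun t => sstep (1 * t + 2)));
  exact/diff_upto_affine/smooth1_sstep.
Qed.

Lemma supported1_bump1 : supported1 2 bump1.
Proof.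
move=> t; rewrite /bump1 ltr_normr => /orP[t2|t2].
  by rewrite mulrC sstep_le0 ?mul0r//; lra.
by rewrite sstep_le0 ?mul0r//; lra.
Qed.

Lemma bump1_ge0 t : 0 <= bump1 t.
Proof. by rewrite mulr_ge0// sstep_ge0. Qed.

Lemma bump1_eq1 t : `|t| <= 1 -> bump1 t = 1.
Proof.
by rewrite ler_norml => /andP[h1 h2]; rewrite /bump1 !sstep_ge1 ?mulr1//; lra.
Qed.

Lemma bump1_derivative_bound m : exists2 C : R, 1 <= C & forall k t, (k <= m)%N ->
  `|derive1n k bump1 t| <= C.
Proof.
have /choice[c Hc] k : exists C : R, 0 <= C /\ forall t, `|derive1n k bump1 t| <= C.
  have [C C0 HC] := smooth1_supported_bounded (smooth1_derive1n k smooth1_bump1)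
    (supported1_derive1n k supported1_bump1).
  by exists C.
exists (1 + \sum_(k < m.+1) c k).
  by rewrite lerDl sumr_ge0// => k _; exact: (Hc k).1.
move=> k t km; rewrite (le_trans ((Hc k).2 t))//.
have kl : (k < m.+1)%N by [].
rewrite (bigD1 (Ordinal kl))//= addrCA lerDl addr_ge0//.
by rewrite sumr_ge0// => j _; exact: (Hc j).1.
Qed.

Variable n : nat.
Local Notation mu := (@lebesgueRn R n).

Definition bump (x : 'rV[R]_n) (rho : R) (i : 'I_n) (t : R) : R :=
  bump1 (rho^-1 * t + - (rho^-1 * x ord0 i)).

Lemma ler_coord_enorm (x : 'rV[R]_n) i : `|x ord0 i| <= enorm x.
Proof.
rewrite /enorm -sqrtr_sqr ler_wsqrtr// (bigD1 i)//= lerDl.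
by rewrite sumr_ge0// => j _; exact: sqr_ge0.
Qed.

Lemma smooth1_bump x rho i : smooth1 (bump x rho i).
Proof. by move=> k; exact/diff_upto_affine/smooth1_bump1. Qed.

Lemma bump_supp (x : 'rV[R]_n) rho i t k : 0 < rho -> 2 * rho < `|t - x ord0 i| ->
  derive1n k bump1 (rho^-1 * t + - (rho^-1 * x ord0 i)) = 0.
Proof.
move=> r0 h; apply: (supported1_derive1n k supported1_bump1).
rewrite -mulrBr normrM gtr0_norm ?invr_gt0// mulrC ltr_pdivlMr//.
Qed.

Lemma supported1_bump (x : 'rV[R]_n) rho : 0 < rho ->
  exists M, forall i, supported1 M (bump x rho i).
Proof.
move=> r0; exists (2 * rho + \sum_i `|x ord0 i|) => i t h.
apply: (@bump_supp x rho i t 0) => //.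
have h2 : `|x ord0 i| <= \sum_i `|x ord0 i|.
  by rewrite (bigD1 i)//= lerDl sumr_ge0.
have := lerB_dist t (x ord0 i); lra.
Qed.

(** The competitor is a bump at scale rho; the bounds for K come from the two
    trivial decompositions f + 0 and 0 + f. *)
Lemma cap_eball_le (m : nat) (alpha : R) (q : \bar R) :
  0 < alpha -> (0 < m)%N -> alpha < m%:R -> (0 < q)%E ->
  exists2 C : R, 0 < C & forall (x : 'rV[R]_n) (rho : R), 0 < rho ->
    (cap m alpha q (eball x rho) <= (C * rho `^ (n%:R - alpha))%:E)%E.
Proof.
move=> a0 m0 am q0.
have mR : 0 < m%:R :> R by rewrite ltr0n.
have th : 0 < alpha / m%:R < 1.
  by rewrite divr_gt0//= ltr_pdivrMr// mul1r.
have [C C1 HC] := bump1_derivative_bound m.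
have C0 : 0 <= C by exact: le_trans C1.
have [B B0 HB] := @interp_norm_le R _ L1 (w1 m) (@L1norm R n) (wnorm m)
  L1norm_ge0 (@wnorm_ge0 R n m) _ q th q0.
(* C bounds the derivatives of the profile, 4 * rho is the side of the support,
   and the Sobolev norm has one term for each multi-index *)
pose E : R := (1 + #|mindices m : {set {ffun 'I_n -> 'I_m.+1}}|%:R) * (C ^+ n * 4 ^+ n).
have E0 : 0 < E.
  apply: mulr_gt0; first by rewrite ltr_pwDl.
  by apply: mulr_gt0; rewrite exprn_gt0// (lt_le_trans ltr01).
exists (B * E); first exact: mulr_gt0.
move=> x rho r0; pose f := tens (bump x rho).
have [M sM] := supported1_bump x r0.
have sb := @smooth1_bump x rho.
apply: ge_ereal_inf; exists (besov_norm m alpha q f).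
  exists f => //; split; first exact: (schwartz_tens sb sM).
    by move=> y; apply: prodr_ge0 => i _; exact: bump1_ge0.
  move=> y /= xy; rewrite /f /tens big1// => i _; apply: bump1_eq1.
  rewrite -mulrBr normrM gtr0_norm ?invr_gt0// mulrC ler_pdivrMr// mul1r.
  apply/ltW/(le_lt_trans _ xy).
  by have := ler_coord_enorm (y - x) i; rewrite !mxE.
have rm0 : 0 < rho ^+ m by exact: exprn_gt0.
pose K := cube (x - const_mx (2 * rho)) (4 * rho).
have r4 : 0 <= 4 * rho by rewrite mulr_ge0// ltW.
have muK : mu K = (4 ^+ n * rho ^+ n)%:E by rewrite lebesgueRn_cube// exprMn.
have derb k (i : 'I_n) : derive1n k (bump x rho i) =
    fun t => rho^-1 ^+ k * derive1n k bump1 (rho^-1 * t + - (rho^-1 * x ord0 i)).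
  exact/derive1n_affine/smooth1_bump1.
have nb (k : 'I_n -> nat) : (forall i, (k i <= m)%N) ->
    (L1norm (tens (fun i => derive1n (k i) (bump x rho i))) <=
      (rho^-1 ^+ morder k * (C ^+ n * 4 ^+ n) * rho ^+ n)%:E)%E.
  move=> km; rewrite -mulrA -mulrA mulrA EFinM -muK; apply: L1norm_le.
  - exact: measurable_cube.
  - by rewrite mulr_ge0 ?exprn_ge0// invr_ge0 ltW.
  - move=> y; rewrite /tens normr_prod /morder -prodrXr.
    rewrite -[C ^+ n](_ : \prod_(i < n) C = _); last by rewrite prodr_const card_ord.
    rewrite -big_split/=; apply: ler_prod => i _; rewrite normr_ge0/= derb normrM.
    rewrite ger0_norm ?exprn_ge0 ?invr_ge0 ?(ltW r0)// ler_wpM2l ?HC//.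
    by rewrite exprn_ge0// invr_ge0 ltW.
  - move=> y /existsNP[i /negP]; rewrite in_itv/= !mxE => h.
    rewrite /tens (bigD1 i)//= derb bump_supp// ?mulr0 ?mul0r// ltNge.
    by apply: contra h; rewrite ler_norml => /andP[? ?]; apply/andP; split; lra.
apply: le_trans (HB (E * rho ^+ n) (rho ^+ m) f _ rm0 _ _) _.
- by rewrite mulr_ge0 ?exprn_ge0// ltW.
- move=> t t0; apply: ge_ereal_inf; exists (L1norm f + t%:E * wnorm m (0%R : 'rV[R]_n -> R))%E.
    exists (f, 0) => //=; split; last by rewrite addr0.
      exact/ccont_integrable/test_ccont/(test_tens sb sM).
    exact: w1_0.
  rewrite wnorm0 mule0 adde0.
  have := nb (fun=> 0%N) (fun=> leq0n _).
  rewrite /morder big1// expr0 mul1r => /le_trans; apply.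
  rewrite lee_fin ler_wpM2r ?exprn_ge0 ?(ltW r0)// /E ler_peMl//.
    by rewrite mulr_ge0// exprn_ge0.
  by rewrite lerDl.
- move=> t t0; apply: ge_ereal_inf; exists (L1norm (0%R : 'rV[R]_n -> R) + t%:E * wnorm m f)%E.
    exists (0, f) => //=; split; last by rewrite add0r.
      exact: L1_0.
    exact: (w1_tens _ sb sM).
  rewrite L1norm0 add0e.
  have wf : (wnorm m f <= (E * rho ^+ n / rho ^+ m)%:E)%E.
    rewrite /wnorm; apply: (@le_trans _ _ (\sum_(k in mindices m : {set {ffun 'I_n -> 'I_m.+1}})
        (rho^-1 ^+ m * (C ^+ n * 4 ^+ n) * rho ^+ n)%:E)%E).
      apply: lee_sum => k; rewrite inE => /eqP km.
      rewrite (L1norm_wderiv (is_wderiv_tens _ sb sM)).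
      by have := nb (fun i => k i) (fun i => ltn_ord (k i)); rewrite km.
    rewrite sumEFin lee_fin sumr_const -[leLHS]mulr_natl -exprVn /E.
    set w := rho^-1 ^+ m; set v := rho ^+ n; set D := C ^+ n * 4 ^+ n.
    set N := #|_|%:R; have : 0 <= w * D * v.
      by rewrite !mulr_ge0 ?exprn_ge0// ?invr_ge0// ltW.
    by move: w D v N => w D v N; lra.
  apply: le_trans (lee_wpmul2l _ wf) _; first by rewrite lee_fin ltW.
  by rewrite -EFinM lee_fin le_eqVlt; apply/orP; left; apply/eqP; lra.
have e : rho ^+ n * (rho ^+ m) `^ (- (alpha / m%:R)) = rho `^ (n%:R - alpha).
  rewrite -(powR_mulrn n (ltW r0)) -(powR_mulrn m (ltW r0)) -powRrM mulrN.
  rewrite mulrCA mulfV ?gt_eqF// mulr1 -powRD//.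
  by rewrite (gt_eqF r0) implybT.
by rewrite -e !mulrA.
Qed.

End ball_capacity.

(** * A mollifier whose scale differences are m-th derivatives *)

Section kernel_line.
Context {R : realType}.
Local Notation lam := (@lebesgue_measure R).
Variable m : nat.
Hypothesis m0 : (0 < m)%N.

Lemma smooth1D (f g : R -> R) : smooth1 f -> smooth1 g -> smooth1 (fun t => f t + g t).
Proof. by move=> sf sg k; exact: diff_uptoD. Qed.

Lemma smooth1M (f g : R -> R) : smooth1 f -> smooth1 g -> smooth1 (fun t => f t * g t).
Proof. by move=> sf sg k; exact: diff_uptoM. Qed.

Lemma smooth1_cst (a : R) : smooth1 (fun=> a).
Proof. by move=> k; exact: diff_upto_cst. Qed.

Lemma smooth1_affine (f : R -> R) a b : smooth1 f -> smooth1 (fun t => f (a * t + b)).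
Proof. by move=> sf k; exact: diff_upto_affine. Qed.

Lemma derive1n_lin k (f g : R -> R) (a : R) : smooth1 f -> smooth1 g ->
  derive1n k (fun t => a * f t + g t) = fun t => a * derive1n k f t + derive1n k g t.
Proof.
move=> sf sg; elim: k => [//|k IH]; rewrite derive1nS IH; apply/funext => t.
rewrite derive1E; apply: derive_val.
have hf := smooth1_is_derive t (smooth1_derive1n k sf).
have hg := smooth1_is_derive t (smooth1_derive1n k sg).
have hz := @is_deriveZ _ _ _ (derive1n k f) a _ _ _ hf.
exact: is_deriveD hz hg.
Qed.

Lemma derive1n_horner k (p : {poly R}) : derive1n k (horner p) = horner (p^`(k)).
Proof.
elim: k => [|k IH]; first by rewrite derivn0.
by rewrite derive1nS IH derivnS derivE.
Qed.

Definition mono : {poly R} := (m.-1`!%:R)^-1 *: 'X^(m.-1).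

(** It vanishes for t < 0 and equals t^(m-1) / (m-1)! for t > 1, so that its
    derivative of order m is supported in [0, 1] and has integral 1. *)
Definition Gfun (t : R) : R := mono.[t] * sstep t.

Lemma monoE t : mono.[t] = (m.-1`!%:R)^-1 * t ^+ m.-1.
Proof. by rewrite /mono hornerZ hornerXn. Qed.

Lemma smooth1_Gfun : smooth1 Gfun.
Proof.
apply: smooth1M; last exact: smooth1_sstep.
move=> k; rewrite (_ : horner mono = fun t => (m.-1`!%:R)^-1 * t ^+ m.-1).
  by apply: diff_uptoM; [exact: diff_upto_cst|exact: diff_uptoX].
by apply/funext => t; rewrite monoE.
Qed.

Lemma Gfun_lt0 k t : t < 0 -> derive1n k Gfun t = 0.
Proof.
move=> t0; rewrite (@derive1n_open _ k _ (cst 0) [set s | s < 0]) ?inE//.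
- by rewrite derive1n_cst0.
- by move=> s; rewrite inE /= => s0; rewrite /Gfun sstep_le0 ?mulr0// ltW.
Qed.

Lemma Gfun_gt1 k t : 1 < t -> derive1n k Gfun t = (mono^`(k)).[t].
Proof.
move=> t1; rewrite (@derive1n_open _ k _ (horner mono) [set s | 1 < s]) ?inE//.
- by rewrite derive1n_horner.
- by move=> s; rewrite inE /= => s0; rewrite /Gfun sstep_ge1 ?mulr1// ltW.
Qed.

Definition eta : R -> R := derive1n m Gfun.

(** The two dilates are weighted so that their polynomial parts cancel beyond 1:
    theta is supported in [0, 1], and its derivative of order m is the
    difference of two scales of eta. *)
Definition theta (t : R) : R := (2 / 2 ^+ m) * Gfun (2 * t + 0) + (-1) * Gfun t.

Lemma smooth1_eta : smooth1 eta.
Proof. exact/smooth1_derive1n/smooth1_Gfun. Qed.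

Lemma smooth1_theta : smooth1 theta.
Proof.
apply: smooth1D; apply: smooth1M; try exact: smooth1_cst; last exact: smooth1_Gfun.
exact/smooth1_affine/smooth1_Gfun.
Qed.

Lemma eta_out t : t \notin `[0, 1] -> eta t = 0.
Proof.
rewrite in_itv/= negb_and -!ltNge => /orP[t0|t1]; first exact: Gfun_lt0.
by rewrite /eta Gfun_gt1// derivnZ derivnXn ffact_small ?mulr0n ?scaler0 ?horner0// prednK.
Qed.

Lemma theta_out t : t \notin `[0, 1] -> theta t = 0.
Proof.
rewrite in_itv/= negb_and -!ltNge /theta addr0 => /orP[t0|t1].
  have h : 2 * t < 0 by lra.
  by have := Gfun_lt0 0 t0; have := Gfun_lt0 0 h => /= -> ->; rewrite !mulr0 addr0.
have h : 1 < 2 * t by lra.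
have /= -> := Gfun_gt1 0 t1; have /= -> := Gfun_gt1 0 h.
rewrite !monoE exprMn mulN1r; apply/eqP; rewrite subr_eq0; apply/eqP.
have e : 2 / 2 ^+ m * 2 ^+ m.-1 = 1 :> R.
  by rewrite mulrAC -exprS prednK// mulfV// expf_neq0.
by rewrite mulrCA (mulrA (2 / _)) e mul1r.
Qed.

Lemma derive1n_theta t : derive1n m theta t = 2 * eta (2 * t) - eta t.
Proof.
rewrite /theta.
rewrite (@derive1n_lin m (fun t => Gfun (2 * t + 0)) (fun t => (-1) * Gfun t)).
- rewrite (derive1n_affine _ _ _ smooth1_Gfun) mulrA divfK ?expf_neq0// addr0; congr (_ + _).
  rewrite (_ : (fun t => -1 * Gfun t) = fun t => -1 * Gfun t + cst 0 t).
    rewrite (@derive1n_lin m Gfun (cst 0)); [|exact: smooth1_Gfun|exact: smooth1_cst].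
    by rewrite derive1n_cst0 addr0 mulN1r.
  by apply/funext => s; rewrite addr0.
- exact/smooth1_affine/smooth1_Gfun.
- by apply: smooth1M; [exact: smooth1_cst|exact: smooth1_Gfun].
Qed.

Definition ker (h x t : R) : R := h^-1 * eta (h^-1 * t + - (h^-1 * x)).

(** The m-fold primitive, supported in [x, x + h], of the difference between
    the kernels at the scales h / 2 and h. *)
Definition pot (h x t : R) : R := h ^+ m / h * theta (h^-1 * t + - (h^-1 * x)).

Lemma smooth1_ker h x : smooth1 (ker h x).
Proof. by apply: smooth1M; [exact: smooth1_cst|exact/smooth1_affine/smooth1_eta]. Qed.

Lemma smooth1_pot h x : smooth1 (pot h x).
Proof. by apply: smooth1M; [exact: smooth1_cst|exact/smooth1_affine/smooth1_theta]. Qed.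

Lemma scaled_in (h x t : R) : 0 < h ->
  (h^-1 * t + - (h^-1 * x) \in `[0, 1]) = (t \in `[x, x + h]).
Proof.
move=> h0; rewrite !in_itv/= -mulrBr pmulr_rge0 ?invr_gt0// subr_ge0.
by rewrite ler_pdivrMl// mulr1 lerBlDl.
Qed.

Lemma ker_out h x t : 0 < h -> t \notin `[x, x + h] -> ker h x t = 0.
Proof. by move=> h0; rewrite -scaled_in// /ker => /eta_out ->; rewrite mulr0. Qed.

Lemma pot_out h x t : 0 < h -> t \notin `[x, x + h] -> pot h x t = 0.
Proof. by move=> h0; rewrite -scaled_in// /pot => /theta_out ->; rewrite mulr0. Qed.

Lemma derive1n_pot h x : 0 < h ->
  derive1n m (pot h x) = fun t => ker (h / 2) x t - ker h x t.
Proof.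
move=> h0; have hn : h != 0 by rewrite gt_eqF.
rewrite (_ : pot h x = fun t => (h ^+ m / h) * theta (h^-1 * t + - (h^-1 * x)) + cst 0 t); last first.
  by apply/funext => t; rewrite addr0.
rewrite (@derive1n_lin m (fun t => theta (h^-1 * t + - (h^-1 * x)))).
- apply/funext => t; rewrite (derive1n_affine _ _ _ smooth1_theta) derive1n_cst0 addr0 derive1n_theta.
  have e : h ^+ m / h * h^-1 ^+ m = h^-1.
    by rewrite exprVn mulrAC mulfV ?expf_neq0// mul1r.
  rewrite mulrA e mulrBr /ker invf_div; congr (_ - _).
  have -> : 2 / h * t + - (2 / h * x) = 2 * (h^-1 * t - h^-1 * x) by lra.
  by rewrite mulrCA mulrA.
- exact/smooth1_affine/smooth1_theta.
- exact: smooth1_cst.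
Qed.

Lemma kernel_bound : exists2 C : R, 0 < C & forall h x t, 0 < h ->
  [/\ `|ker h x t| <= C * h^-1, `|ker (h / 2) x t| <= C * h^-1,
      `|ker (h / 2) x t - ker h x t| <= C * h^-1 &
      `|pot h x t| <= h ^+ m * (C * h^-1)].
Proof.
have supp (f : R -> R) : (forall t, t \notin `[0, 1] -> f t = 0) -> supported1 1 f.
  move=> H t t1; apply: H; apply: contraL t1; rewrite in_itv/= => /andP[h1 h2].
  by rewrite -leNgt ger0_norm.
have [C1 C10 H1] := smooth1_supported_bounded smooth1_eta (supp _ eta_out).
have [C2 C20 H2] := smooth1_supported_bounded smooth1_theta (supp _ theta_out).
exists (3 * C1 + C2 + 1); first by rewrite ltr_wpDl// addr_ge0// mulr_ge0.
move=> h x t h0; have hi : 0 < h^-1 by rewrite invr_gt0.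
have k1 : `|ker h x t| <= C1 * h^-1.
  by rewrite normrM gtr0_norm// mulrC ler_wpM2r// ltW.
have k2 : `|ker (h / 2) x t| <= 2 * C1 * h^-1.
  rewrite normrM gtr0_norm ?invr_gt0 ?divr_gt0// invf_div.
  rewrite [leRHS]mulrAC; apply: ler_wpM2l; last exact: H1.
  by rewrite ltW// divr_gt0.
have hC : 0 <= C1 * h^-1 by rewrite mulr_ge0// ltW.
have hC2 : 0 <= C2 * h^-1 by rewrite mulr_ge0// ltW.
split.
- by rewrite (le_trans k1)//; lra.
- by rewrite (le_trans k2)//; lra.
- by rewrite (le_trans (ler_normB _ _))//; lra.
- rewrite /pot normrM normrM (gtr0_norm hi) ger0_norm ?exprn_ge0 ?(ltW h0)//.
  rewrite -mulrA ler_wpM2l ?exprn_ge0 ?(ltW h0)// mulrC ler_wpM2r ?(ltW hi)//.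
  by rewrite (le_trans (H2 _))//; lra.
Qed.

Lemma integral_ker h x : 0 < h -> (\int[lam]_t (ker h x t)%:E = 1)%E.
Proof.
move=> h0; have hn : h != 0 by rewrite gt_eqF.
pose g := fun t => derive1n m.-1 Gfun (h^-1 * t + - (h^-1 * x)).
have sg : smooth1 g by exact/smooth1_affine/smooth1_derive1n/smooth1_Gfun.
have dg : derive1 g = ker h x.
  have := derive1n_affine 1 h^-1 (- (h^-1 * x)) (smooth1_derive1n m.-1 smooth1_Gfun).
  by rewrite !derive1nS /= expr1 => ->; rewrite -derive1nS prednK.
rewrite -dg (@integral_derive1 _ g (x - h) (x + 2 * h)).
- rewrite /g; have -> : h^-1 * (x + 2 * h) + - (h^-1 * x) = 2.
    by rewrite -mulrBr addrAC subrr add0r mulrCA mulVf// mulr1.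
  have -> : h^-1 * (x - h) + - (h^-1 * x) = -1.
    by rewrite -mulrBr addrAC subrr add0r mulrN mulVf.
  have n1 : -1 < 0 :> R by rewrite ltrN10.
  have n2 : 1 < 2 :> R by rewrite ltr1n.
  rewrite (Gfun_lt0 _ n1) (Gfun_gt1 _ n2) subr0 derivnZ derivnXn subnn.
  by rewrite ffactnn expr0 hornerZ hornerMn hornerC mulVf// pnatr_eq0 -lt0n fact_gt0.
- lra.
- by move=> t; exact: smooth1_derivable.
- by rewrite dg; exact/smooth1_continuous/smooth1_ker.
- move=> t; rewrite dg => tn; apply: ker_out => //; apply: contra tn.
  by rewrite !in_itv/= => /andP[? ?]; apply/andP; split; lra.
Qed.

End kernel_line.

(** * Comparison of two consecutive mollifications *)

Section mollification.
Context {R : realType}.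
Variables (n m : nat).
Hypothesis m0 : (0 < m)%N.
Hypothesis n0 : (0 < n)%N.
Local Notation mu := (@lebesgueRn R n).
Implicit Types (f g : 'rV[R]_n -> R) (x y : 'rV[R]_n).

Definition kern h x : 'rV[R]_n -> R := tens (fun i => ker m h (x ord0 i)).

Definition mollify h f x : R := \int[mu]_y (f y * kern h x y).

Lemma prod_telescope (a b : 'I_n -> R) :
  \prod_i a i - \prod_i b i =
  \sum_(i < n) \prod_(j < n) (if (j < i)%N then a j else if j == i then a j - b j else b j).
Proof.
pose P k := \prod_(j < n) (if (j < k)%N then a j else b j).
have -> : \prod_i a i = P n by apply: eq_bigr => j _; rewrite ltn_ord.
have -> : \prod_i b i = P 0%N by apply: eq_bigr.
rewrite -(telescope_sumr P (leq0n n)) big_mkord; apply: eq_bigr => i _.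
rewrite /P (bigD1 i)//= ltnSn [X in _ - X](bigD1 i)//= ltnn [RHS](bigD1 i)//= ltnn eqxx.
rewrite mulrBl; congr (_ * _ - _ * _); apply: eq_bigr => j ji.
- rewrite ltnS leq_eqVlt (_ : (val j == val i) = false) ?(negbTE ji)//.
  by apply/negbTE; apply: contra ji => /eqP/val_inj ->.
- by rewrite (negbTE ji).
Qed.

(** The multi-index m e_i. *)
Definition axis (i j : 'I_n) : nat := if j == i then m else 0%N.

Lemma morder_axis i : morder (axis i) = m.
Proof.
rewrite /morder (bigD1 i)//= /axis eqxx big1 ?addn0// => j /negbTE -> //.
Qed.

(** The pure derivatives of order m are distinct terms of the Sobolev norm. *)
Lemma axis_mindices : exists d : 'I_n -> {ffun 'I_n -> 'I_m.+1},
  [/\ forall i, d i \in mindices m, injective d &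
      forall i, (fun j => nat_of_ord (d i j)) = axis i].
Proof.
exists (fun i => [ffun j => if j == i then ord_max else ord0]).
have E i : (fun j => nat_of_ord ([ffun j => if j == i then ord_max else ord0] j : 'I_m.+1)) = axis i.
  by apply/funext => j; rewrite ffunE /axis; case: eqP.
split => //.
- by move=> i; rewrite inE E morder_axis.
- move=> i i' e; have := congr1 (fun d : {ffun 'I_n -> 'I_m.+1} => nat_of_ord (d i)) e.
  rewrite !ffunE eqxx; case: eqP => //= _ mm.
  by move: m0; rewrite mm.
Qed.

(** The i-th term of the telescoped difference of the product kernels, where
    the factor along the axis i has been replaced by its m-fold primitive. *)
Definition Psi h x (i j : 'I_n) : R -> R :=
  if (j < i)%N then ker m (h / 2) (x ord0 j)
  else if j == i then pot m h (x ord0 j) else ker m h (x ord0 j).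

Lemma smooth1_Psi h x i j : smooth1 (Psi h x i j).
Proof.
rewrite /Psi; case: ifP => _; first exact: smooth1_ker.
by case: ifP => _; [exact: smooth1_pot|exact: smooth1_ker].
Qed.

Lemma half_itv (h a t : R) : 0 < h -> t \notin `[a, a + h] -> t \notin `[a, a + h / 2].
Proof.
move=> h0; apply: contra; rewrite !in_itv/= => /andP[-> h1]/=; lra.
Qed.

Lemma Psi_out h x i j t : 0 < h -> t \notin `[x ord0 j, x ord0 j + h] -> Psi h x i j t = 0.
Proof.
move=> h0 tn; rewrite /Psi; case: ifP => _.
  by apply: ker_out => //; [rewrite divr_gt0|exact: half_itv].
by case: ifP => _; [exact: pot_out|exact: ker_out].
Qed.

Lemma ker_half_out h a t : 0 < h -> t \notin `[a, a + h] -> ker m (h / 2) a t = 0 :> R.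
Proof. by move=> h0 tn; apply: ker_out => //; [rewrite divr_gt0|exact: half_itv]. Qed.

Lemma itv_supported1 h x : 0 < h -> exists M, forall i (b : R -> R),
  (forall t, t \notin `[x ord0 i, x ord0 i + h] -> b t = 0) -> supported1 M b.
Proof.
move=> h0; exists (\sum_i `|x ord0 i| + h) => i b H t Mt; apply: H.
apply: contraL Mt; rewrite in_itv/= -leNgt => /andP[h1 h2].
have h3 : `|x ord0 i| <= \sum_i `|x ord0 i|.
  by rewrite (bigD1 i)//= lerDl sumr_ge0.
have := ler_norm (x ord0 i); have := ler_norm (- x ord0 i); rewrite normrN => *.
rewrite ler_norml; apply/andP; split; lra.
Qed.

Lemma test_kern h x : 0 < h -> test_function (kern h x).
Proof.
move=> h0; have [M HM] := itv_supported1 x h0.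
apply: (@test_tens _ _ _ M) => i; first exact: smooth1_ker.
by apply: (HM i) => t; exact: ker_out.
Qed.

Lemma test_Psi h x i : 0 < h -> test_function (tens (Psi h x i)).
Proof.
move=> h0; have [M HM] := itv_supported1 x h0.
apply: (@test_tens _ _ _ M) => j; first exact: smooth1_Psi.
by apply: (HM j) => t; exact: Psi_out.
Qed.

(** Telescoping the product along the axes, every term is a pure derivative of
    order m of a function supported in the same cube. *)
Lemma kern_diff h x y : 0 < h ->
  kern (h / 2) x y - kern h x y = \sum_i mderiv (axis i) (tens (Psi h x i)) y.
Proof.
move=> h0; rewrite /kern /tens prod_telescope; apply: eq_bigr => i _.
rewrite mderiv_tens; last by move=> j; exact: smooth1_Psi.
apply: eq_bigr => j _; rewrite /axis /Psi.
have [ji|] := ltnP j i.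
  by case: eqP => // e; move: ji; rewrite e ltnn.
by case: eqP => // -> _; rewrite derive1n_pot.
Qed.

Lemma cube_outP x h y : ~ cube x h y -> exists i, y ord0 i \notin `[x ord0 i, x ord0 i + h].
Proof. by move=> /existsNP[i /negP]; exists i. Qed.

Lemma kern_out h x y : 0 < h -> ~ cube x h y -> kern h x y = 0.
Proof.
move=> h0 /cube_outP[i yi]; rewrite /kern /tens (bigD1 i)//= ker_out ?mul0r//.
Qed.

Lemma kern_half_out h x y : 0 < h -> ~ cube x h y -> kern (h / 2) x y = 0.
Proof.
move=> h0 /cube_outP[i yi]; rewrite /kern /tens (bigD1 i)//= ker_half_out ?mul0r//.
Qed.

Lemma tens_Psi_out h x i y : 0 < h -> ~ cube x h y -> tens (Psi h x i) y = 0.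
Proof.
move=> h0 /cube_outP[j yj]; rewrite /tens (bigD1 j)//= Psi_out ?mul0r//.
Qed.

Lemma kern_bound : exists2 C : R, 0 < C & forall h x, 0 < h ->
  [/\ forall y, `|kern h x y| <= C * h^-1 ^+ n,
      forall y, `|kern (h / 2) x y - kern h x y| <= C * h^-1 ^+ n &
      forall i y, `|tens (Psi h x i) y| <= h ^+ m * (C * h^-1 ^+ n)].
Proof.
have [c c0 Hc] := @kernel_bound R m m0.
have cn0 : 0 < c ^+ n by exact: exprn_gt0.
exists (2 * c ^+ n); first by rewrite mulr_gt0.
move=> h x h0; have hi : 0 < h^-1 by rewrite invr_gt0.
have P0 : 0 <= c ^+ n * h^-1 ^+ n by rewrite mulr_ge0 ?exprn_ge0// ltW.
have bd (b : 'I_n -> R -> R) y : (forall i, `|b i (y ord0 i)| <= c * h^-1) ->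
    `|tens b y| <= c ^+ n * h^-1 ^+ n.
  move=> H; rewrite /tens normr_prod -exprMn.
  rewrite -[leRHS](_ : \prod_(i < n) (c * h^-1) = _); last by rewrite prodr_const card_ord.
  by apply: ler_prod => i _; rewrite normr_ge0 H.
have k1 y : `|kern h x y| <= c ^+ n * h^-1 ^+ n.
  by apply: bd => i; have [] := Hc h (x ord0 i) (y ord0 i) h0.
have k2 y : `|kern (h / 2) x y| <= c ^+ n * h^-1 ^+ n.
  by apply: bd => i; have [] := Hc h (x ord0 i) (y ord0 i) h0.
split.
- by move=> y; rewrite (le_trans (k1 y))//; lra.
- by move=> y; rewrite (le_trans (ler_normB _ _))//; have := k1 y; have := k2 y; lra.
- move=> i y; rewrite /tens (bigD1 i)//= normrM.
  apply: (@le_trans _ _ (h ^+ m * (c ^+ n * h^-1 ^+ n))); last first.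
    by apply: ler_wpM2l; [rewrite exprn_ge0// ltW|lra].
  rewrite -exprMn; have <- : \prod_(i < n) (c * h^-1) = (c * h^-1) ^+ n.
    by rewrite prodr_const card_ord.
  rewrite [in leRHS](bigD1 i)//= mulrA; apply: ler_pM => //.
    by rewrite /Psi ltnn eqxx; have [] := Hc h (x ord0 i) (y ord0 i) h0.
  rewrite normr_prod; apply: ler_prod => j ji; rewrite normr_ge0/=.
  have [b1 b2 _ _] := Hc h (x ord0 j) (y ord0 j) h0.
  by rewrite /Psi (negbTE ji); case: ifP.
Qed.

Lemma Rintegral_le (F g : 'rV[R]_n -> R) (K : set 'rV[R]_n) (c : R) :
  mu.-integrable setT (EFin \o F) -> @measurable _ (borel 'rV[R]_n) K ->
  measurable_fun setT (g : borel 'rV[R]_n -> R) -> 0 <= c -> (forall y, 0 <= g y) ->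
  (forall y, K y -> `|F y| <= c * g y) -> (forall y, ~ K y -> F y = 0) ->
  ((`|\int[mu]_y F y|)%:E <= c%:E * \int[mu]_(y in K) (g y)%:E)%E.
Proof.
move=> iF mK mg c0 g0 FK FnK.
have -> : (`|\int[mu]_y F y|)%:E = (`| \int[mu]_y (F y)%:E |)%E.
  by rewrite /Rintegral -(fineK (integrable_fin_num measurableT iF)).
apply: le_trans (le_abse_integral mu measurableT (measurable_int _ iF)) _.
have mgK : measurable_fun (K : set (borel 'rV[R]_n)) ((fun y => (g y)%:E) : borel 'rV[R]_n -> \bar R).
  by apply/measurable_EFinP; exact: measurable_funTS.
rewrite -ge0_integralZl//; last by move=> y _; rewrite lee_fin.
rewrite [leRHS]integral_mkcond; apply: ge0_le_integral_nomeas => // y _.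
rewrite patchE; case: ifPn => [|]; last by rewrite notin_setE => /FnK/= ->; rewrite normr0.
by rewrite inE => /FK h; rewrite /= -EFinM lee_fin.
Qed.

Lemma Rintegral_sum_fin (F : 'I_n -> 'rV[R]_n -> R) :
  (forall i, mu.-integrable setT (EFin \o F i)) ->
  mu.-integrable setT (EFin \o (fun y => \sum_i F i y)) /\
  \int[mu]_y (\sum_i F i y) = \sum_i \int[mu]_y F i y.
Proof.
move=> iF; elim: (index_enum _) => [|i s [IH1 IH2]].
  under eq_fun do rewrite big_nil.
  split; first exact: integrable0.
  by rewrite big_nil Rintegral_cst// mul0r.
have E : (fun y => \sum_(j <- i :: s) F j y) = (fun y => F i y + \sum_(j <- s) F j y).
  by apply/funext => y; rewrite big_cons.
split.
  rewrite E; exact: (integrableD measurableT (iF i) IH1).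
rewrite big_cons -IH2 -RintegralD//.
by apply: eq_Rintegral => y _; rewrite big_cons.
Qed.

Lemma L1_L1loc f : L1 f -> L1loc f.
Proof.
move=> If; split; first by have /measurable_EFinP := measurable_int _ If.
move=> K cK; apply: integrableS If => //.
exact: compact_measurable_borel.
Qed.

Lemma w1_wderiv f k : w1 m f -> morder k = m ->
  is_wderiv k f (wderiv k f) /\ L1 (wderiv k f).
Proof.
move=> [H _] km; have [g gw gL] := H k km.
have W : is_wderiv k f (wderiv k f).
  by apply: (@xgetPex _ (cst 0) [set g | is_wderiv k f g]); exists g.
split => //; have [_ [mw _] _] := W.
apply/integrableP; split; first exact/measurable_EFinP.
by have := L1norm_wderiv gw; rewrite /L1norm => ->; have /integrableP[] := gL.
Qed.

(** Its integral is at most the quantity whose infimum over the decompositions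
    f0 + f1 is K(h^m). *)
Definition dominant h (f0 f1 : 'rV[R]_n -> R) : 'rV[R]_n -> R :=
  fun y => `|f0 y| + h ^+ m * \sum_i `|wderiv (axis i) f1 y|.

(** The part f0 is integrated against the difference of the kernels, of size
    h^(-n); for f1 the derivatives are moved from the potentials, of size
    h^m h^(-n), onto f1. *)
Lemma mollify_diff : exists2 C : R, 0 < C & forall f0 f1 h x, 0 < h -> L1 f0 -> w1 m f1 ->
  ((`|mollify (h / 2) (f0 + f1) x - mollify h (f0 + f1) x|)%:E <=
   (C * h^-1 ^+ n)%:E * \int[mu]_(y in cube x h) (dominant h f0 f1 y)%:E)%E.
Proof.
have [C C0 HC] := kern_bound; exists C => // f0 f1 h x h0 L0 w1f.
have [b1 b2 b3] := HC h x h0.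
have h20 : 0 < h / 2 by rewrite divr_gt0.
have hn0 : 0 <= h^-1 ^+ n by rewrite exprn_ge0// invr_ge0 ltW.
have W i := w1_wderiv w1f (morder_axis i).
have loc1 : L1loc f1 by have [[] ] := W (Ordinal n0).
have loc0 := L1_L1loc L0.
pose D i := wderiv (axis i) f1.
pose F y := f0 y * (kern (h / 2) x y - kern h x y) +
  \sum_i ((-1) ^+ m * (D i y * tens (Psi h x i) y)).
have iD i : mu.-integrable setT (EFin \o (fun y => D i y * tens (Psi h x i) y)).
  by apply: L1loc_test_integrable; [exact/L1_L1loc/(W i).2|exact: test_Psi].
have iD' i : mu.-integrable setT (EFin \o (fun y => (-1) ^+ m * (D i y * tens (Psi h x i) y))).
  have := integrableZl measurableT ((-1) ^+ m) (iD i).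
  by apply: eq_integrable => // y _; rewrite /= EFinM.
have ik0 k : 0 < k -> mu.-integrable setT (EFin \o (fun y => f0 y * kern k x y)).
  by move=> k0; apply: L1loc_test_integrable => //; exact: test_kern.
have ik1 k : 0 < k -> mu.-integrable setT (EFin \o (fun y => f1 y * kern k x y)).
  by move=> k0; apply: L1loc_test_integrable => //; exact: test_kern.
have i0 : mu.-integrable setT (EFin \o (fun y => f0 y * (kern (h / 2) x y - kern h x y))).
  have := integrableB measurableT (ik0 _ h20) (ik0 _ h0).
  by apply: eq_integrable => // y _; rewrite /= -EFinB mulrBr.
have im i : mu.-integrable setT (EFin \o (fun y => f1 y * mderiv (axis i) (tens (Psi h x i)) y)).
  by apply: L1loc_test_integrable => //; apply: test_mderiv; exact: test_Psi.
have [isum esum] := Rintegral_sum_fin iD'.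
have [isum1 esum1] := Rintegral_sum_fin im.
have E : mollify (h / 2) (f0 + f1) x - mollify h (f0 + f1) x = \int[mu]_y F y.
  have mE k : 0 < k -> mollify k (f0 + f1) x =
      \int[mu]_y (f0 y * kern k x y) + \int[mu]_y (f1 y * kern k x y).
    move=> k0; rewrite -RintegralD//; [|exact: ik0|exact: ik1].
    by apply: eq_Rintegral => y _; rewrite -mulrDl.
  rewrite !mE// RintegralD// esum.
  transitivity (\int[mu]_y (f0 y * (kern (h / 2) x y - kern h x y)) +
     \int[mu]_y (f1 y * (kern (h / 2) x y - kern h x y))).
    rewrite opprD addrACA; congr (_ + _); rewrite -RintegralB//; try exact: ik0; try exact: ik1;
      by apply: eq_Rintegral => y _; rewrite mulrBr.
  congr (_ + _); transitivity (\int[mu]_y (\sum_i f1 y * mderiv (axis i) (tens (Psi h x i)) y)).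
    by apply: eq_Rintegral => y _; rewrite kern_diff// mulr_sumr.
  rewrite esum1; apply: eq_bigr => i _; rewrite RintegralZl//.
  have [[_ _ Wi] _] := W i.
  by rewrite (Wi _ (test_Psi x i h0)) morder_axis.
rewrite E; apply: Rintegral_le.
- exact: (integrableD measurableT i0 isum).
- exact: measurable_cube.
- apply: measurable_funD; first by apply: measurableT_comp => //; exact: loc0.1.
  apply: measurable_funM => //; apply: measurable_sum => i.
  by apply: measurableT_comp => //; have [[_ [] ]] := W i.
- by rewrite mulr_ge0// ltW.
- move=> y; rewrite addr_ge0// mulr_ge0 ?exprn_ge0 ?(ltW h0)//.
  by rewrite sumr_ge0.
- move=> y _; rewrite /F (le_trans (ler_normD _ _))// /dominant [leRHS]mulrDr; apply: lerD.
    by rewrite normrM mulrC ler_wpM2r.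
  rewrite (le_trans (ler_norm_sum _ _ _))// mulr_sumr mulr_sumr; apply: ler_sum => i _.
  rewrite normrM normr_sign mul1r normrM mulrC mulrA; apply: ler_wpM2r => //.
  by rewrite mulrC; exact: b3.
- move=> y ny; rewrite /F (kern_out h0 ny) (kern_half_out h0 ny) subrr mulr0 add0r big1// => i _.
  by rewrite tens_Psi_out// !mulr0.
Qed.

End mollification.

(** * The measure of the set where a function is at least one *)

Section limits_of_mollifications.
Context {R : realType}.
Variables (n m : nat).
Hypothesis m0 : (0 < m)%N.
Hypothesis n0 : (0 < n)%N.
Local Notation mu := (@lebesgueRn R n).
Implicit Types (f g G : 'rV[R]_n -> R) (x y : 'rV[R]_n).

(** The points x whose cube contains y form a cube of the same side. *)
Lemma ge0_tonelli_cube G h : 0 <= h ->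
  measurable_fun setT (G : borel 'rV[R]_n -> R) -> (forall y, 0 <= G y) ->
  measurable_fun setT ((fun x => \int[mu]_(y in cube x h) (G y)%:E)%E : borel 'rV[R]_n -> \bar R) /\
  (\int[mu]_x \int[mu]_(y in cube x h) (G y)%:E = (h ^+ n)%:E * \int[mu]_y (G y)%:E)%E.
Proof.
move=> h0 mG G0.
pose E : set (borel 'rV[R]_n * borel 'rV[R]_n) :=
  [set p : borel 'rV[R]_n * borel 'rV[R]_n |
    forall i, (p.2 : 'rV[R]_n) ord0 i - (p.1 : 'rV[R]_n) ord0 i \in `[0, h] ].
have mE : measurable E.
  rewrite (_ : E = \bigcap_(i in [set: 'I_n])
     ((fun p : borel 'rV[R]_n * borel 'rV[R]_n => p.2 ord0 i - p.1 ord0 i) @^-1` `[0, h])).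
    apply: fin_bigcap_measurable => // i _.
    rewrite -[X in measurable X]setTI.
    have mB : measurable_fun setT
        (fun p : borel 'rV[R]_n * borel 'rV[R]_n => p.2 ord0 i - p.1 ord0 i : R).
      apply: measurable_funB.
        exact: (measurableT_comp (measurable_coord i) measurable_snd).
      exact: (measurableT_comp (measurable_coord i) measurable_fst).
    by apply: mB => //; exact: measurable_itv.
  by apply/seteqP; split => p /= H i; [move=> _|]; have := H i => //; exact.
pose F (p : borel 'rV[R]_n * borel 'rV[R]_n) : \bar R := (G p.2 * \1_E p)%:E.
have mF : measurable_fun setT F.
  apply/measurable_EFinP; apply: measurable_funM.
    exact: (@measurableT_comp _ _ _ _ (borel 'rV[R]_n) _ G setT snd mG measurable_snd).
  exact: measurable_indic.
have F0 p : (0 <= F p)%E by rewrite lee_fin mulr_ge0.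
have Fx x : (\int[mu]_y F (x, y) = \int[mu]_(y in cube x h) (G y)%:E)%E.
  rewrite [RHS]integral_mkcond; apply: eq_integral => y _.
  have e : ((x, y) \in E) = (y \in cube x h).
    apply/idP/idP; rewrite !inE => H i; have := H i; rewrite /= !in_itv/= => /andP[? ?];
      apply/andP; split; lra.
  by rewrite patchE /F indicE /= e; case: ifPn => _; rewrite ?mulr1 ?mulr0.
have Fy y : (\int[mu]_x F (x, y) = (h ^+ n)%:E * (G y)%:E)%E.
  have e x : \1_E (x, y) = \1_(cube (y - const_mx h) h) x :> R.
    rewrite !indicE; congr (_%:R); congr nat_of_bool.
    apply/idP/idP; rewrite !inE => H i; have := H i; rewrite /= !in_itv/= ?mxE => /andP[? ?];
      apply/andP; split; rewrite ?mxE; lra.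
  transitivity (\int[mu]_x ((G y)%:E * (\1_(cube (y - const_mx h) h) x)%:E))%E.
    by apply: eq_integral => x _; rewrite /F e.
  have mc := @measurable_cube R n (y - const_mx h) h.
  have mi : measurable_fun setT ((fun x => (\1_(cube (y - const_mx h) h) x : R)%:E) : borel 'rV[R]_n -> \bar R).
    by apply/measurable_EFinP; exact: measurable_indic.
  rewrite ge0_integralZl//; last by rewrite lee_fin.
  have -> : (\int[mu]_x (\1_(cube (y - const_mx h) h) x)%:E = mu (cube (y - const_mx h) h))%E.
    by rewrite (integral_indic mu measurableT mc) setIT.
  by rewrite lebesgueRn_cube// muleC.
split.
  have := measurable_fun_fubini_tonelli_F (m2 := mu) F mF F0.
  by apply: eq_measurable_fun => x _; rewrite /fubini_F Fx.
transitivity (\int[mu]_x \int[mu]_y F (x, y))%E.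
  by apply: eq_integral => x _; rewrite Fx.
rewrite (@fubini_tonelli _ _ _ _ _ mu mu F mF F0).
under eq_integral do rewrite Fy.
rewrite ge0_integralZl//.
- exact/measurable_EFinP.
- by move=> y _; rewrite lee_fin.
- by rewrite lee_fin exprn_ge0.
Qed.

Lemma measurable_dominant h f0 f1 : L1 f0 -> w1 m f1 ->
  measurable_fun setT (dominant m h f0 f1 : borel 'rV[R]_n -> R).
Proof.
move=> L0 w1f; apply: measurable_funD.
  by apply: measurableT_comp => //; exact: (L1_L1loc L0).1.
apply: measurable_funM => //; apply: measurable_sum => i.
by apply: measurableT_comp => //; have [[_ [] ]] := w1_wderiv w1f (morder_axis m i).
Qed.

Lemma dominant_ge0 h f0 f1 y : 0 <= h -> 0 <= dominant m h f0 f1 y.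
Proof.
by move=> h0; rewrite addr_ge0// mulr_ge0 ?exprn_ge0// sumr_ge0.
Qed.

Lemma integral_dominant h f0 f1 : 0 <= h -> L1 f0 -> w1 m f1 ->
  (\int[mu]_y (dominant m h f0 f1 y)%:E <= L1norm f0 + (h ^+ m)%:E * wnorm m f1)%E.
Proof.
move=> h0 L0 w1f; have hm : 0 <= h ^+ m by exact: exprn_ge0.
have mD i : measurable_fun setT ((fun y => `|(wderiv (axis m i) f1 y)%:E|%E) : borel 'rV[R]_n -> \bar R).
  apply/measurable_EFinP; apply: measurableT_comp => //.
  by have [[_ [] ]] := w1_wderiv w1f (morder_axis m i).
have m0' : measurable_fun setT ((fun y => `|(f0 y)%:E|%E) : borel 'rV[R]_n -> \bar R).
  by apply/measurable_EFinP; apply: measurableT_comp => //; exact: (L1_L1loc L0).1.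
have -> : (\int[mu]_y (dominant m h f0 f1 y)%:E =
    \int[mu]_y (`|(f0 y)%:E| + (h ^+ m)%:E * \sum_i `|(wderiv (axis m i) f1 y)%:E|))%E.
  by apply: eq_integral => y _; rewrite /dominant EFinD EFinM -sumEFin.
have mS : measurable_fun setT
    ((fun y => \sum_i `|(wderiv (axis m i) f1 y)%:E|)%E : borel 'rV[R]_n -> \bar R).
  exact: emeasurable_sum.
have S0 y : (0 <= \sum_i `|(wderiv (axis m i) f1 y)%:E|)%E by exact: sume_ge0.
rewrite ge0_integralD//; last 2 first.
- by move=> y _; rewrite mule_ge0.
- exact: measurable_funeM.
rewrite ge0_integralZl// ge0_integral_sum//.
apply: leeD => //; apply: lee_wpmul2l; first by rewrite lee_fin.
have [d [dm di dE]] := axis_mindices n m0.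
rewrite /wnorm; apply: (@le_trans _ _ (\sum_(k in d @: [set: 'I_n]%SET) L1norm (wderiv (fun i => k i) f1))%E).
  rewrite big_imset/=; last by move=> i j _ _; exact: di.
  rewrite [leRHS](eq_bigl xpredT); last by move=> i; rewrite inE.
  by apply: lee_sum => i _; rewrite dE.
apply: lee_sum_nneg_subset.
  by move=> _ /imsetP[i _ ->]; exact: dm.
by move=> k _; exact: integral_ge0.
Qed.

Lemma integrable_bounded_kern f h x (M0 : R) : 0 < h -> continuous f ->
  (forall y, `|f y| <= M0) ->
  mu.-integrable setT (EFin \o (fun y => f y * kern m h x y)).
Proof.
move=> h0 cf fM; have [C C0 HC] := @kern_bound R n m m0; have [b1 _ _] := HC h x h0.
apply: (@integrable_bounded_supp _ _ _ (M0 * (C * h^-1 ^+ n)) (cube x h)).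
- apply: measurable_funM; first exact: continuous_borel_measurable.
  exact: (measurable_test (test_kern m0 x h0)).
- exact: measurable_cube.
- exact: cube_lty.
- by move=> y; rewrite normrM; apply: ler_pM.
- by move=> y ny; rewrite kern_out ?mulr0.
Qed.

Lemma integral_kern h x : 0 < h -> \int[mu]_y kern m h x y = 1.
Proof.
move=> h0; have [M HM] := itv_supported1 x h0.
rewrite /Rintegral (@integral_tens _ _ _ M (fun=> 1)) ?big1//.
- by move=> i; exact/smooth1_continuous/smooth1_ker.
- by move=> i; apply: (HM i) => t; exact: ker_out.
- by move=> i; exact: integral_ker.
Qed.

Lemma integral_cube_cst (c : R) x h : 0 <= h ->
  (\int[mu]_(y in cube x h) c%:E = (c * h ^+ n)%:E)%E.
Proof.
move=> h0; have := @integral_cst _ _ _ mu _ (@measurable_cube R n x h) c%:E.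
move=> ->; exact: (congr1 (fun z => c%:E * z)%E (lebesgueRn_cube x h0)).
Qed.

Lemma expr_inv_mul (h : R) : 0 < h -> h^-1 ^+ n * h ^+ n = 1.
Proof. by move=> h0; rewrite -exprMn mulVf ?gt_eqF// expr1n. Qed.

(** The kernel has integral 1, lives at distance h from x and is at most
    C h^(-n), so that an oscillation of e / C is enough. *)
Lemma mollify_small f (M0 : R) x e : continuous f -> (forall y, `|f y| <= M0) ->
  0 < e -> exists2 d : R, 0 < d & forall h, 0 < h -> h < d -> `|mollify m h f x - f x| <= e.
Proof.
move=> cf fM e0; have [C C0 HC] := @kern_bound R n m m0.
have e'0 : 0 < e / C by exact: divr_gt0.
have [d /= d0 dH] : exists2 d : R, 0 < d & ball x d `<=` [set y | `|f x - f y| < e / C].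
  apply/nbhs_ballP; have /cvgrPdist_lt/(_ _ e'0) := cf x; exact.
exists d => // h h0 hd; have [b1 _ _] := HC h x h0.
have ik := integrable_bounded_kern x h0 cf fM.
have ikern := ccont_integrable (test_ccont (test_kern m0 x h0)).
have ic : mu.-integrable setT (EFin \o (fun y => f x * kern m h x y)).
  have := integrableZl measurableT (f x) ikern.
  by apply: eq_integrable => // y _; rewrite /= EFinM.
have cfx : \int[mu]_y (f x * kern m h x y) = f x.
  by rewrite RintegralZl// integral_kern// mulr1.
have E : mollify m h f x - f x = \int[mu]_y ((f y - f x) * kern m h x y).
  rewrite -[in LHS]cfx /mollify -RintegralB//; apply: eq_Rintegral => y _.
  by rewrite mulrBl.
rewrite E -lee_fin.
have mc := @measurable_cube R n x h.
apply: (@le_trans _ _ ((e / C * (C * h^-1 ^+ n))%:E * \int[mu]_(y in cube x h) 1%:E)%E).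
  apply: Rintegral_le => //.
  - have := integrableB measurableT ik ic.
    by apply: eq_integrable => // y _; rewrite /= -EFinB mulrBl.
  - by rewrite mulr_ge0 ?(ltW e'0)// mulr_ge0 ?(ltW C0)// exprn_ge0// invr_ge0 ltW.
  - move=> y xy; rewrite mulr1 normrM; apply: ler_pM => //.
    rewrite distrC; apply/ltW/dH; rewrite ball_rVE// => i /=.
    have := xy i; rewrite in_itv/= /ball/= ltr_distlC => /andP[? ?].
    by apply/andP; split; lra.
  - by move=> y ny; rewrite kern_out ?mulr0.
rewrite integral_cube_cst ?(ltW h0)// mul1r -EFinM lee_fin.
by rewrite -!mulrA expr_inv_mul// mulr1 mulVf ?mulr1// gt_eqF.
Qed.

(** Outside a fixed cube Q the function is small, and Q receives a share
    O(h^(-n)) of the kernel. *)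
Lemma mollify_large f (M0 M1 : R) x e : continuous f -> (forall y, `|f y| <= M0) ->
  (forall i y, `|y ord0 i * f y| <= M1) -> 0 < e ->
  exists2 d : R, 0 < d & forall h, d < h -> `|mollify m h f x| <= e.
Proof.
move=> cf fM fM1 e0; have [C C0 HC] := @kern_bound R n m m0.
pose e' := e / (2 * C); have e'0 : 0 < e' by rewrite divr_gt0// mulr_gt0.
have M00 : 0 <= M0 by rewrite (le_trans _ (fM 0)).
have M10 : 0 <= M1 by rewrite (le_trans _ (fM1 (Ordinal n0) 0)).
pose r := M1 / e'; have r0 : 0 <= r by rewrite divr_ge0// ltW.
pose Q := cube (ctr n r) (2 * r).
pose g y := e' + M0 * \1_Q y.
have mQ := @measurable_cube R n (ctr n r) (2 * r).
pose V := M0 * (2 * r) ^+ n.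
have V0 : 0 <= V by rewrite mulr_ge0// exprn_ge0// mulr_ge0.
have fg y : `|f y| <= g y.
  rewrite /g indicE; case: (boolP (y \in Q)) => [_|].
    by rewrite mulr1 (le_trans (fM y))// lerDr ltW.
  rewrite notin_setE => ny; rewrite mulr0 addr0.
  have [i yi] : exists i, r < `|y ord0 i|.
    apply: contrapT => /forallNP H; apply: ny => i.
    have /negP := H i; rewrite -leNgt ler_norml => /andP[h1 h2].
    by rewrite !mxE in_itv/= h1/=; lra.
  have := fM1 i y; rewrite normrM => h1.
  have yi0 : 0 < `|y ord0 i| by exact: le_lt_trans yi.
  rewrite -(ler_pM2l yi0) (le_trans h1)//.
  by rewrite mulrC -ler_pdivrMl// mulrC ltW.
exists (1 + 2 * C * V / e); first by rewrite ltr_pwDl// divr_ge0 ?(ltW e0)// mulr_ge0 ?V0// mulr_ge0// ltW.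
move=> h hd.
have h1 : 1 < h.
  by rewrite (le_lt_trans _ hd)// lerDl divr_ge0 ?(ltW e0)// mulr_ge0 ?V0// mulr_ge0// ltW.
have h0 : 0 < h by exact: lt_trans h1.
have [b1 _ _] := HC h x h0.
have ik := integrable_bounded_kern x h0 cf fM.
have hn0 : 0 < h^-1 ^+ n by rewrite exprn_gt0// invr_gt0.
have mc := @measurable_cube R n x h.
have mg : measurable_fun setT (g : borel 'rV[R]_n -> R).
  by apply: measurable_funD => //; apply: measurable_funM => //; exact: measurable_indic.
have g0 y : 0 <= g y by rewrite addr_ge0 ?(ltW e'0)// mulr_ge0.
rewrite -lee_fin.
apply: (@le_trans _ _ ((C * h^-1 ^+ n)%:E * \int[mu]_(y in cube x h) (g y)%:E)%E).
  apply: Rintegral_le => //.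
  - by rewrite mulr_ge0 ?ltW.
  - move=> y xy; rewrite normrM mulrC; apply: ler_pM => //.
  - by move=> y ny; rewrite kern_out ?mulr0.
have -> : (\int[mu]_(y in cube x h) (g y)%:E =
    \int[mu]_(y in cube x h) e'%:E + \int[mu]_(y in cube x h) (M0%:E * (\1_Q y)%:E))%E.
  rewrite -ge0_integralD//.
  - by move=> y _; rewrite lee_fin ltW.
  - by move=> y _; rewrite mule_ge0// lee_fin.
  - by apply: measurable_funeM; apply/measurable_EFinP; apply: measurable_funTS; exact: measurable_indic.
rewrite integral_cube_cst ?(ltW h0)//.
apply: (@le_trans _ _ ((C * h^-1 ^+ n)%:E * ((e' * h ^+ n)%:E + V%:E))%E).
  apply: lee_wpmul2l; first by rewrite lee_fin mulr_ge0 ?ltW.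
  rewrite leeD2l//.
  rewrite ge0_integralZl//; last first.
    by apply/measurable_EFinP; apply: measurable_funTS; exact: measurable_indic.
  rewrite (integral_indic mu mc mQ) /V EFinM; apply: lee_wpmul2l; first by rewrite lee_fin.
  have <- : mu Q = ((2 * r) ^+ n)%:E by rewrite lebesgueRn_cube// mulr_ge0.
  apply: (le_measure mu); rewrite ?inE//; exact: measurableI.
rewrite -EFinD -EFinM lee_fin mulrDr.
have -> : C * h^-1 ^+ n * (e' * h ^+ n) = e / 2.
  rewrite mulrACA expr_inv_mul// mulr1 /e' invfM mulrCA (mulrCA C).
  by rewrite mulfV ?mulr1// gt_eqF.
have hV : C * h^-1 ^+ n * V <= e / 2.
  have hh : h^-1 ^+ n <= h^-1.
    rewrite -{2}[h^-1]expr1 ler_wiXn2l//; first by rewrite invr_ge0 ltW.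
    by rewrite invf_le1// ltW.
  apply: (@le_trans _ _ (C * h^-1 * V)).
    by rewrite ler_wpM2r// ler_wpM2l// ltW.
  rewrite mulrAC ler_pdivrMr//.
  have : 2 * C * V / e < h by rewrite (le_lt_trans _ hd)// lerDr.
  by rewrite ltr_pdivrMr// => ?; lra.
by lra.
Qed.

End limits_of_mollifications.

Section volume_bound.
Context {R : realType}.
Variables (n m : nat).
Hypothesis m0 : (0 < m)%N.
Hypothesis n0 : (0 < n)%N.
Local Notation mu := (@lebesgueRn R n).
Implicit Types (f g G : 'rV[R]_n -> R) (x y : 'rV[R]_n).

Lemma schwartz_continuous f : schwartz f -> continuous f.
Proof. by move=> [sf _]; have [cf _] := sf [::]. Qed.

Lemma mderiv0 f : mderiv (fun=> 0%N) f = f.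
Proof. by rewrite /mderiv; elim: (enum _) => [//|i s /= ->]. Qed.

Lemma schwartz_decay f : schwartz f -> exists M0 M1 : R,
  (forall y, `|f y| <= M0) /\ (forall i y, `|y ord0 i * f y| <= M1).
Proof.
move=> [_ sf]; have [M0 HM0] := sf (fun=> 0%N) (fun=> 0%N).
have /choice[M HM] i := sf (fun j => nat_of_bool (j == i)) (fun=> 0%N).
exists M0, (\sum_i `|M i|); split => [y|i y].
  by have := HM0 y; rewrite mderiv0 big1 ?mul1r// => i _; rewrite expr0.
have := HM i y; rewrite mderiv0 (bigD1 i)//= eqxx expr1 big1; last first.
  by move=> j /negbTE ->.
rewrite mulr1 => /le_trans; apply.
by rewrite (bigD1 i)//= (le_trans (ler_norm _))// lerDl sumr_ge0.
Qed.

(** The scales below and above H are kept apart, as they are estimated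
    differently. *)
Lemma dyadic_telescope (S : R -> R) H J :
  `|S (H / 2 ^+ J)| <= `|S (H * 2 ^+ J)| +
    \sum_(j < J) `|S (H / 2 ^+ j / 2) - S (H / 2 ^+ j)| +
    \sum_(j < J) `|S (H * 2 ^+ j.+1 / 2) - S (H * 2 ^+ j.+1)|.
Proof.
elim: J => [|J IH]; first by rewrite !big_ord0 !addr0 !expr0 divr1 mulr1.
rewrite !big_ord_recr/=.
have e1 : H / 2 ^+ J.+1 = H / 2 ^+ J / 2 by rewrite exprSr invfM mulrA.
have e2 : H * 2 ^+ J.+1 / 2 = H * 2 ^+ J by rewrite exprSr mulrA mulfK.
rewrite e1 e2.
have t1 : `|S (H / 2 ^+ J / 2)| <=
    `|S (H / 2 ^+ J)| + `|S (H / 2 ^+ J / 2) - S (H / 2 ^+ J)|.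
  by rewrite -[X in `|X| <= _](subrK (S (H / 2 ^+ J))) addrC ler_normD.
have t2 : `|S (H * 2 ^+ J)| <=
    `|S (H * 2 ^+ J.+1)| + `|S (H * 2 ^+ J) - S (H * 2 ^+ J.+1)|.
  by rewrite -[X in `|X| <= _](subrK (S (H * 2 ^+ J.+1))) addrC ler_normD.
lra.
Qed.

Lemma geometric_sum_le (z : R) J : 0 <= z < 1 -> \sum_(j < J) z ^+ j <= 1 / (1 - z).
Proof.
move=> /andP[z0 z1]; have := geometric_seriesE (1 : R) (_ : z != 1).
rewrite lt_eqF// => /(_ isT)/(congr1 (@^~ J)); rewrite /series/= big_mkord.
have -> : \sum_(i < J) 1 * z ^+ i = \sum_(j < J) z ^+ j.
  by apply: eq_bigr => i _; rewrite mul1r.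
move=> ->; rewrite ler_pM2r ?invr_gt0 ?subr_gt0// mul1r gerBl exprn_ge0//.
Qed.

Lemma half_le (v s s' a b c : R) : 1 <= v -> v - 8^-1 <= s -> s <= s' ->
  s' <= a + b + c -> a <= 8^-1 -> c <= 4^-1 -> 2^-1 <= b.
Proof. by move=> *; lra. Qed.

(** At coarse scales the differences of mollifications are small in sup norm,
    at fine scales they are small in L1 norm; the scale H balances the two. *)
Lemma measure_superlevel_le (alpha : R) : 0 < alpha -> alpha < n%:R ->
  exists2 C : R, 0 < C & forall f (N : R) (O : set 'rV[R]_n), schwartz f -> 0 < N ->
    (forall h : R, 0 < h ->
      (Kfun L1 (w1 m) (@L1norm R n) (wnorm m) (h ^+ m) f < (N * h `^ alpha)%:E)%E) ->
    @measurable _ (borel 'rV[R]_n) O -> (forall x, O x -> 1 <= f x) ->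
    (mu O <= (C * N `^ (n%:R / (n%:R - alpha)))%:E)%E.
Proof.
move=> a0 an; have [C C0 HC] := @mollify_diff R n m m0 n0.
have na0 : 0 < n%:R - alpha by rewrite subr_gt0.
have p2lt1 (a : R) : 0 < a -> 0 <= (2 : R) `^ (- a) < 1.
  move=> a0'; rewrite powR_ge0/= powRN invf_lt1 ?powR_gt0//.
  rewrite -[ltLHS](@powRr0 _ 2); rewrite /powR pnatr_eq0/= ltr_expR ltr_pM2r//.
  by rewrite ln_gt0// ltr1n.
pose z : R := 2 `^ (- (n%:R - alpha)); pose w : R := 2 `^ (- alpha).
have hz : 0 <= z < 1 by exact: p2lt1.
have hw : 0 <= w < 1 by exact: p2lt1.
have z1 : 0 < 1 - z by rewrite subr_gt0; case/andP: hz.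
have w1' : 0 < 1 - w by rewrite subr_gt0; case/andP: hw.
(* H below satisfies H^(n-alpha) = A N, which makes the coarse sum, a geometric
   series of ratio z, at most 1/4 *)
pose A := 4 * C / (1 - z); have A0 : 0 < A by rewrite divr_gt0// mulr_gt0.
exists (2 * C / (1 - w) * A `^ (alpha / (n%:R - alpha))).
  by rewrite mulr_gt0 ?powR_gt0// divr_gt0// mulr_gt0.
move=> f N O sf N0 HK mO Of.
have cf := schwartz_continuous sf.
have [M0 [M1 [fM0 fM1]]] := schwartz_decay sf.
pose S h x := mollify m h f x.
have ex h : exists G, 0 < h -> [/\ measurable_fun setT (G : borel 'rV[R]_n -> R),
    forall y, 0 <= G y, (\int[mu]_y (G y)%:E <= (N * h `^ alpha)%:E)%E &
    forall x, ((`|S (h / 2) x - S h x|)%:E <=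
      (C * h^-1 ^+ n)%:E * \int[mu]_(y in cube x h) (G y)%:E)%E].
  have [h0|h0] := ltP 0 h; last by exists (cst 0).
  have := HK h h0 => /ereal_inf_lt[_ [[f0 f1] /= [L0 W1 fE] <-] KN].
  exists (dominant m h f0 f1) => _; split.
  - exact: measurable_dominant.
  - by move=> y; apply: dominant_ge0; exact: ltW.
  - apply: le_trans (integral_dominant m0 (ltW h0) L0 W1) _.
    exact: ltW.
  - by move=> x; rewrite /S fE; exact: HC.
have /choice[G HG] := ex.
have n1R : (1 : R) <= n%:R by rewrite ler1n.
have hpow (h : R) : 0 < h -> h^-1 ^+ n * h `^ alpha = h `^ (- (n%:R - alpha)).
  move=> h0; rewrite -powR_mulrn ?invr_ge0 ?(ltW h0)// powR_invl ?(ltW h0)//.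
  rewrite -powRD; last by rewrite (gt_eqF h0) implybT.
  by congr (_ `^ _); lra.
have dsup h x : 0 < h -> `|S (h / 2) x - S h x| <= C * N * h `^ (- (n%:R - alpha)).
  move=> h0; have [mG G0 GI Gx] := HG h h0; rewrite -lee_fin (le_trans (Gx x))//.
  have hn0 : 0 <= C * h^-1 ^+ n.
    by rewrite mulr_ge0 ?(ltW C0)// exprn_ge0// invr_ge0 ltW.
  apply: (@le_trans _ _ ((C * h^-1 ^+ n)%:E * (N * h `^ alpha)%:E)%E).
    apply: lee_wpmul2l; first by rewrite lee_fin.
    apply: le_trans GI; apply: ge0_subset_integral => //.
    - exact: measurable_cube.
    - exact/measurable_EFinP.
    - by move=> y _; rewrite lee_fin.
  rewrite -EFinM lee_fin -hpow// le_eqVlt; apply/orP; left; apply/eqP.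
  by move: (h^-1 ^+ n) (h `^ alpha) => u v; lra.
pose H := (A * N) `^ (n%:R - alpha)^-1.
have AN0 : 0 < A * N by exact: mulr_gt0.
have H0 : 0 < H by exact: powR_gt0.
have Hpow : H `^ (- (n%:R - alpha)) = (A * N)^-1.
  by rewrite /H -powRrM mulrN mulVf ?gt_eqF// powR_inv1// ltW.
have pw (j : nat) : 0 < (2 : R) ^+ j by rewrite exprn_gt0.
have coarse x J : \sum_(j < J) `|S (H * 2 ^+ j.+1 / 2) x - S (H * 2 ^+ j.+1) x| <= 4^-1.
  apply: (@le_trans _ _ (\sum_(j < J) (C * N * (A * N)^-1) * z ^+ j)).
    apply: ler_sum => j _.
    have Hj : 0 < H * 2 ^+ j.+1 by exact: mulr_gt0.
    rewrite (le_trans (dsup _ x Hj))// powRM ?(ltW H0) ?(ltW (pw _))// Hpow.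
    rewrite (_ : (2 ^+ j.+1) `^ _ = z ^+ j.+1); last by rewrite -exprn_powR.
    rewrite mulrA; apply: ler_wpM2l.
      by rewrite mulr_ge0 ?invr_ge0 ?(ltW AN0)// mulr_ge0 ?ltW.
    rewrite exprS ler_piMl ?exprn_ge0//; case/andP: hz => // _ /ltW//.
  rewrite -mulr_sumr; apply: (@le_trans _ _ (C * N * (A * N)^-1 * (1 / (1 - z)))).
    apply: ler_wpM2l; last exact: geometric_sum_le.
    by rewrite mulr_ge0 ?invr_ge0 ?(ltW AN0)// mulr_ge0 ?ltW.
  rewrite /A le_eqVlt; apply/orP; left; apply/eqP.
  have Cn : C != 0 by rewrite gt_eqF.
  have Nn : N != 0 by rewrite gt_eqF.
  have zn : 1 - z != 0 by rewrite gt_eqF.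
  rewrite !invfM invrK mul1r.
  transitivity ((C / C) * (N / N) * ((1 - z) / (1 - z)) * 4^-1); first by lra.
  by rewrite !mulfV// !mul1r.
pose c j := (C * (H / 2 ^+ j)^-1 ^+ n)%:E.
pose T j x := (\int[mu]_(y in cube x (H / 2 ^+ j)) (G (H / 2 ^+ j) y)%:E)%E.
have Hj0 j : 0 < H / 2 ^+ j by exact: divr_gt0.
have c0 j : (0 <= c j)%E.
  by rewrite lee_fin mulr_ge0 ?(ltW C0)// exprn_ge0// invr_ge0 ltW.
have T0 j x : (0 <= T j x)%E.
  by apply: integral_ge0 => y _; have [_ G0 _ _] := HG _ (Hj0 j); rewrite lee_fin.
have fine_part x : O x -> ((2^-1)%:E <= \sum_(j <oo) (c j * T j x))%E.
  move=> Ox.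
  (* 1 - 1/8 - 1/8 - 1/4 = 1/2 is left to the fine scales *)
  have e8 : 0 < 8^-1 :> R by rewrite invr_gt0.
  have [d1 d10 Hd1] := mollify_small m0 x cf fM0 e8.
  have [d2 d20 Hd2] := mollify_large m0 n0 x cf fM0 fM1 e8.
  pose J := maxn (Num.truncn (H / d1)).+1 (Num.truncn (d2 / H)).+1.
  have J2 : J%:R < 2 ^+ J :> R by rewrite -natrX ltr_nat ltn_expl.
  have h1 : `|S (H / 2 ^+ J) x - f x| <= 8^-1.
    apply: Hd1 => //; rewrite ltr_pdivrMr// mulrC -ltr_pdivrMr//.
    rewrite (lt_trans _ J2)// (lt_le_trans (truncnS_gt _))// ler_nat.
    exact: leq_maxl.
  have h2 : `|S (H * 2 ^+ J) x| <= 8^-1.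
    apply: Hd2; rewrite mulrC -ltr_pdivrMr//.
    rewrite (lt_trans _ J2)// (lt_le_trans (truncnS_gt _))// ler_nat.
    exact: leq_maxr.
  have h3 := dyadic_telescope (S^~ x) H J.
  have h4 := coarse x J.
  have h5 : 2^-1 <= \sum_(j < J) `|S (H / 2 ^+ j / 2) x - S (H / 2 ^+ j) x|.
    have h6 := Of x Ox; have h7 := ler_norm (S (H / 2 ^+ J) x).
    have h8 : f x - 8^-1 <= S (H / 2 ^+ J) x.
      by move: h1; rewrite ler_distl => /andP[].
    exact: half_le h6 h8 h7 h3 h2 h4.
  apply: (@le_trans _ _ (\sum_(0 <= j < J) (c j * T j x))%E); last first.
    by apply: nneseries_lim_ge => j _ _; rewrite mule_ge0.
  rewrite big_mkord; apply: (@le_trans _ _ (\sum_(j < J) (`|S (H / 2 ^+ j / 2) x - S (H / 2 ^+ j) x|)%:E)%E).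
    by rewrite sumEFin lee_fin.
  by apply: lee_sum => j _; have [_ _ _ Gx] := HG _ (Hj0 j); exact: Gx.
have TT j := ge0_tonelli_cube (ltW (Hj0 j)) (let: And4 a _ _ _ := HG _ (Hj0 j) in a)
  (let: And4 _ b _ _ := HG _ (Hj0 j) in b).
have mT j : measurable_fun setT ((fun x => c j * T j x)%E : borel 'rV[R]_n -> \bar R).
  by apply: measurable_funeM; exact: (TT j).1.
have -> : mu O = (\int[mu]_(x in O) 1%:E)%E.
  by rewrite (@integral_cst _ _ _ mu _ mO 1%:E) mul1e.
apply: (@le_trans _ _ (2%:E * \int[mu]_x (\sum_(j <oo) (c j * T j x)))%E).
  have mF : measurable_fun setT
      ((fun x => \sum_(j <oo) (c j * T j x))%E : borel 'rV[R]_n -> \bar R).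
    by apply: ge0_emeasurable_sum => // j x _ _; rewrite mule_ge0.
  have F0 x : (0 <= \sum_(j <oo) (c j * T j x))%E.
    by apply: nneseries_ge0 => j _ _; rewrite mule_ge0.
  rewrite -ge0_integralZl//.
  apply: (@le_trans _ _ (\int[mu]_(x in O) (2%:E * \sum_(j <oo) (c j * T j x)))%E).
    apply: ge0_le_integral_nomeas => // x /fine_part h.
    by apply: le_trans (lee_wpmul2l _ h) => //; rewrite -EFinM mulfV.
  apply: ge0_subset_integral => //.
    exact: measurable_funeM.
  by move=> x _; rewrite mule_ge0.
rewrite integral_nneseries//; last by move=> j x _; rewrite mule_ge0.
apply: (@le_trans _ _ (2%:E * \sum_(j <oo) (C * N * H `^ alpha * w ^+ j)%:E)%E).
  apply: lee_wpmul2l => //; apply: lee_nneseries => [j _ _|j _].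
    by apply: integral_ge0 => x _; rewrite mule_ge0.
  rewrite ge0_integralZl//; last exact: (TT j).1.
  rewrite (TT j).2; have [_ _ GI _] := HG _ (Hj0 j).
  rewrite muleA /c -EFinM -(mulrA C (_^-1 ^+ n)) (expr_inv_mul _ (Hj0 j)) mulr1.
  apply: le_trans (lee_wpmul2l _ GI) _; first by rewrite lee_fin ltW.
  rewrite -EFinM lee_fin powRM ?(ltW H0) ?invr_ge0 ?(ltW (pw j))//.
  rewrite powR_invl ?(ltW (pw j))// exprn_powR// -/w !mulrA//.
rewrite nneseries_geometric// -EFinM lee_fin.
have HA : H `^ alpha = A `^ (alpha / (n%:R - alpha)) * N `^ (alpha / (n%:R - alpha)).
  by rewrite -powRM ?(ltW A0) ?(ltW N0)// /H -powRrM (mulrC _ alpha).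
have HN : N * N `^ (alpha / (n%:R - alpha)) = N `^ (n%:R / (n%:R - alpha)).
  rewrite -{1}[N]powRr1 ?(ltW N0)// -powRD; last by rewrite (gt_eqF N0) implybT.
  congr (_ `^ _); apply: (@mulIf _ (n%:R - alpha)); first by rewrite gt_eqF.
  by rewrite mulrDl !divfK ?gt_eqF// mul1r subrK.
rewrite HA -HN le_eqVlt; apply/orP; left; apply/eqP; lra.
Qed.

End volume_bound.

(** * Tents *)

Section tent_geometry.
Context {R : realType}.
Variable n : nat.
Local Notation mu := (@lebesgueRn R n).
Implicit Types (O A : set 'rV[R]_n) (c x y z : 'rV[R]_n).

Lemma enorm_ge0 x : 0 <= enorm x.
Proof. exact: sqrtr_ge0. Qed.

Lemma enorm_sqr x : enorm x ^+ 2 = \sum_i x ord0 i ^+ 2.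
Proof. by rewrite sqr_sqrtr// sumr_ge0// => i _; exact: sqr_ge0. Qed.

Lemma enormN x : enorm (- x) = enorm x.
Proof. by congr Num.sqrt; apply: eq_bigr => i _; rewrite mxE sqrrN. Qed.

Lemma enorm_distC x y : enorm (x - y) = enorm (y - x).
Proof. by rewrite -enormN opprB. Qed.

Lemma enorm0 : enorm (0 : 'rV[R]_n) = 0.
Proof. by rewrite /enorm big1 ?sqrtr0// => i _; rewrite mxE expr0n. Qed.

Lemma enorm_eq0 x : enorm x = 0 -> x = 0.
Proof.
move=> x0; apply/rowP => i; rewrite mxE; apply/eqP; rewrite -normr_le0.
by rewrite -x0 ler_coord_enorm.
Qed.

Lemma enormD x y : enorm (x + y) <= enorm x + enorm y.
Proof.
have [/enorm_eq0 ->|xn] := eqVneq (enorm x) 0.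
  by rewrite add0r enorm0 add0r.
have [/enorm_eq0 ->|yn] := eqVneq (enorm y) 0.
  by rewrite addr0 enorm0 addr0.
have x0 : 0 < enorm x by rewrite lt_neqAle eq_sym xn enorm_ge0.
have y0 : 0 < enorm y by rewrite lt_neqAle eq_sym yn enorm_ge0.
rewrite -(@ler_pXn2r _ 2)// ?nnegrE ?addr_ge0 ?enorm_ge0//.
rewrite sqrrD !enorm_sqr.
(* Cauchy-Schwarz, summing 2 a b <= t a^2 + b^2 / t over the coordinates *)
pose t := enorm y / enorm x; have t0 : 0 < t by exact: divr_gt0.
have -> : enorm x * enorm y *+ 2 =
    t * (\sum_i x ord0 i ^+ 2) + t^-1 * (\sum_i y ord0 i ^+ 2).
  rewrite -!enorm_sqr /t invfM invrK mulr2n !expr2; congr (_ + _).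
    by rewrite mulrA divfK// mulrC.
  by rewrite (mulrC _^-1) mulrA divfK.
rewrite !mulr_sumr -!big_split/=; apply: ler_sum => i _; rewrite mxE.
rewrite sqrrD lerD2r lerD2l -subr_ge0.
have -> : t * x ord0 i ^+ 2 + t^-1 * y ord0 i ^+ 2 - x ord0 i * y ord0 i *+ 2
    = t * (x ord0 i - t^-1 * y ord0 i) ^+ 2.
  have tt : t * t^-1 = 1 by rewrite mulfV ?gt_eqF.
  move: (x ord0 i) (y ord0 i) (t^-1) tt => a b u tt; rewrite sqrrB !exprMn.
  rewrite mulrDr mulrBr mulrnAr -mulrCA.
  have -> : t * (u ^+ 2 * b ^+ 2) = u * b ^+ 2.
    by rewrite expr2 !mulrA tt mul1r.
  have -> : t * (a * (u * b)) = a * b.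
    by rewrite (mulrCA a) (mulrA t) tt mul1r.
  by rewrite addrAC.
by rewrite mulr_ge0 ?sqr_ge0// ltW.
Qed.

Lemma enorm_le_coord (a : R) x : 0 <= a -> (forall i, `|x ord0 i| <= a) ->
  enorm x <= Num.sqrt n%:R * a.
Proof.
move=> a0 xa; rewrite -[a in leRHS]ger0_norm// -sqrtr_sqr -sqrtrM//.
apply: ler_wsqrtr; apply: (@le_trans _ _ (\sum_(i < n) a ^+ 2)).
  by apply: ler_sum => i _; rewrite -real_normK ?num_real// lerXn2r ?nnegrE.
by rewrite sumr_const card_ord -[leLHS]mulr_natl.
Qed.

Lemma dist_to_lipschitz A x y : (dist_to x A <= dist_to y A + (enorm (x - y))%:E)%E.
Proof.
rewrite -leeBlDr//; apply: le_ereal_inf_tmp => _ [z Az <-].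
rewrite leeBlDr//; apply: ge_ereal_inf; exists (enorm (x - z))%:E; first by exists z.
rewrite -EFinD lee_fin (le_trans _ (enormD _ _))// ?[leRHS]addrC.
by rewrite (_ : y - z + (x - y) = x - z)// addrC addrA subrK.
Qed.

Lemma open_eball x (r : R) : open (eball x r).
Proof.
rewrite openE => y; rewrite /eball/= => yr.
pose a := (r - enorm (y - x)) / (Num.sqrt n%:R + 1).
have s0 : 0 <= Num.sqrt n%:R :> R by exact: sqrtr_ge0.
have s1 : 0 < Num.sqrt n%:R + 1 :> R by rewrite ltr_wpDl.
have a0 : 0 < a by rewrite divr_gt0// subr_gt0.
apply/nbhs_ballP; exists a => //= z; rewrite ball_rVE// => yz /=.
apply: (@le_lt_trans _ _ (enorm (z - y) + enorm (y - x))).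
  by rewrite (le_trans _ (enormD _ _))// addrA subrK.
rewrite -ltrBrDr; apply: (@le_lt_trans _ _ (Num.sqrt n%:R * a)).
  apply: enorm_le_coord; first exact: ltW.
  by move=> i; rewrite !mxE distrC ltW//; exact: (yz i).
by rewrite /a mulrCA gtr_pMr ?subr_gt0// ltr_pdivrMr// mul1r ltrDl.
Qed.

(** The distance to the boundary is Lipschitz; openness makes tents
    measurable. *)
Lemma open_tent O : open O -> open (tent O).
Proof.
move=> oO; pose V := [set p : 'rV[R]_n * R | O p.1 /\
  (p.2%:E < dist_to p.1 (boundary O))%E].
exists V => //; rewrite openE => -[x t] [/= Ox tx].
have [r r0 tr] : exists2 r : R, 0 < r & ((t + r)%:E < dist_to x (boundary O))%E.
  case: (dist_to x (boundary O)) tx => [d|_|//].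
  - rewrite lte_fin => td; exists ((d - t) / 2); first by rewrite divr_gt0 ?subr_gt0.
    by rewrite lte_fin; lra.
  - by exists 1 => //; rewrite ltry.
pose a := r / 2 / (Num.sqrt n%:R + 1).
have s0 : 0 <= Num.sqrt n%:R :> R by exact: sqrtr_ge0.
have s1 : 0 < Num.sqrt n%:R + 1 :> R by rewrite ltr_wpDl.
have a0 : 0 < a by rewrite !divr_gt0.
have ar : Num.sqrt n%:R * a < r / 2.
  by rewrite /a mulrCA gtr_pMr ?divr_gt0// ltr_pdivrMr// mul1r ltrDl.
have : nbhs x O by exact: open_nbhs_nbhs.
move=> /nbhs_ballP[b /= b0 bO].
apply/nbhs_ballP; exists (Num.min (Num.min a b) (r / 2)).
  by rewrite /= !lt_min a0 b0 divr_gt0.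
move=> [y u] [/= xy tu]; split => /=.
  by apply: bO; apply: le_ball xy; rewrite !ge_min lexx orbT.
have ux : u < t + r / 2.
  move: tu; rewrite /ball/= ltr_distlC => /andP[_ /lt_le_trans]; apply.
  by rewrite lerD2l ge_min lexx orbT.
have exy : enorm (x - y) < r / 2.
  apply: le_lt_trans ar; apply: enorm_le_coord; first exact: ltW.
  move=> i; rewrite !mxE.
  have := le_ball (_ : Num.min (Num.min a b) (r / 2) <= a) xy.
  rewrite !ge_min lexx => /(_ isT); rewrite ball_rVE// => /(_ i).
  by rewrite /ball/= => /ltW.
have := dist_to_lipschitz (boundary O) x y.
move=> /(lt_le_trans tr); case: (dist_to y (boundary O)) => [d| |].
- by rewrite -EFinD !lte_fin => h; lra.
- by move=> _; rewrite ltry.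
- by rewrite addNye.
Qed.

(** A segment leaving an open set crosses its boundary, since it is
    connected. *)
Lemma dist_to_boundary_le O x z : open O -> O x -> ~ O z ->
  (dist_to x (boundary O) <= (enorm (x - z))%:E)%E.
Proof.
move=> oO Ox Oz; pose g (t : R) : 'rV[R]_n := x + t *: (z - x).
have cg : continuous g.
  move=> t; apply: cvgD; first exact: cvg_cst.
  exact: scalel_continuous.
have [[t t01 bt]|nb] := pselect (exists2 t, `[0, 1]%classic t & boundary O (g t)).
  apply: ge_ereal_inf; exists (enorm (x - g t))%:E; first by exists (g t).
  rewrite lee_fin /g opprD addrA subrr add0r enormN [leRHS]enorm_distC /enorm.
  apply: ler_wsqrtr; apply: ler_sum => i _; rewrite !mxE exprMn.
  move: t01; rewrite /= in_itv/= => /andP[t0 t1].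
  by rewrite ler_piMl ?sqr_ge0// expr_le1.
suff E : `[0, 1]%classic `&` g @^-1` O = `[0, 1]%classic.
  have : (`[0, 1]%classic `&` g @^-1` O) 1 by rewrite E /= in_itv/= ler01 lexx.
  by move=> [_]; rewrite /= /g scale1r addrC subrK.
apply: (@segment_connected _ 0 1).
- by exists 0; split; [rewrite /= in_itv/= lexx ler01|rewrite /= /g scale0r addr0].
- exists (g @^-1` O) => //; apply: open_comp => // t _; exact: cg.
- exists (g @^-1` closure O).
    by apply: preimage_closed; [move=> t _; exact: cg|exact: closed_closure].
  apply/seteqP; split => t [t01 Ogt]; split => //; first exact: subset_closure.
  apply: contrapT => nO; apply: nb; exists t => //; split => //.
  by move=> /interior_subset.
Qed.

(** A point of O next to the complement sees the boundary of O at distance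
    2 sqrt(n) l at most, and is at distance sqrt(n) l from the centre c; the
    sphere of radius 3 sqrt(n) l about c is therefore farther away. *)
Lemma tent_sub_eball O c (l : R) (p : halfspace R n) : 0 < l ->
  open O -> (forall i, `|(set_val p).1 ord0 i - c ord0 i| <= l) ->
  (0 < n)%N ->
  (exists2 z, ~ O z & forall i, `|(set_val p).1 ord0 i - z ord0 i| <= 2 * l) ->
  tent O p -> tent (eball c (3 * Num.sqrt n%:R * l)) p.
Proof.
move=> l0 oO; set x := (set_val p).1 => xc n0 [z Oz xz] [Ox tx].
have sn : 0 < Num.sqrt n%:R :> R by rewrite sqrtr_gt0 ltr0n.
have exc : enorm (x - c) <= Num.sqrt n%:R * l.
  by apply: enorm_le_coord; [exact: ltW|move=> i; rewrite !mxE].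
have exz : enorm (x - z) <= Num.sqrt n%:R * (2 * l).
  by apply: enorm_le_coord; [rewrite mulr_ge0// ltW|move=> i; rewrite !mxE].
have sl : 0 < Num.sqrt n%:R * l by exact: mulr_gt0.
split; first by rewrite /eball/= -/x (le_lt_trans exc)//; lra.
apply: (lt_le_trans tx); apply: le_trans (dist_to_boundary_le oO Ox Oz) _.
apply: le_ereal_inf_tmp => _ [y [_ yb] <-].
have {}yb : 3 * Num.sqrt n%:R * l <= enorm (y - c).
  rewrite leNgt; apply/negP => yl; apply: yb.
  by apply: (@open_nbhs_nbhs _ y (eball c _)); split => //; exact: open_eball.
have := enormD (y - x) (x - c); rewrite addrA subrK (enorm_distC y x).
by rewrite -/x lee_fin => h; lra.
Qed.

End tent_geometry.

(** * Maximal dyadic cubes of an open set *)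

Section dyadic_cubes.
Context {R : realType}.
Variables (n : nat) (s : R).
Hypothesis s0 : 0 < s.
Local Notation mu := (@lebesgueRn R n).
Implicit Types (O : set 'rV[R]_n) (x y : 'rV[R]_n) (p : 'rV[int]_n) (j k : nat).

Definition side k := s / 2 ^+ k.

Definition dindex k x : 'rV[int]_n := \row_i Num.floor (x ord0 i / side k).

Definition dcube k p := [set x | dindex k x = p].

Definition dcorner k p : 'rV[R]_n := \row_i ((p ord0 i)%:~R * side k).

Lemma side_gt0 k : 0 < side k.
Proof. by rewrite divr_gt0// exprn_gt0. Qed.

Lemma side_le k : side k <= s.
Proof.
by rewrite ler_pdivrMr ?exprn_gt0// ler_peMr ?(ltW s0)// exprn_ege1// ler1n.
Qed.

Lemma sideS k : side k = 2 * side k.+1.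
Proof. by rewrite /side exprS invfM !mulrA [2 * s]mulrC mulfK. Qed.

Lemma dcube_box k p : dcube k p =
  [set x | forall i, `[dcorner k p ord0 i, dcorner k p ord0 i + side k[%classic (x ord0 i)].
Proof.
have E (z : int) (t : R) : (Num.floor (t / side k) == z) =
    (t \in `[z%:~R * side k, z%:~R * side k + side k[).
  rewrite floor_eq in_itv/= ler_pdivlMr ?side_gt0// ltr_pdivrMr ?side_gt0//.
  by rewrite intrD mulrDl mul1r.
apply/seteqP; split => x /=.
  by move=> <- i; rewrite !mxE -E.
by move=> H; apply/rowP => i; have := H i; rewrite !mxE -E => /eqP.
Qed.

Lemma measurable_dcube k p : @measurable _ (borel 'rV[R]_n) (dcube k p).
Proof.
rewrite dcube_box; apply: (@measurable_box R n
  (fun i => `[dcorner k p ord0 i, dcorner k p ord0 i + side k[%classic)) => i.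
exact: measurable_itv.
Qed.

Lemma lebesgueRn_dcube k p : mu (dcube k p) = (side k ^+ n)%:E.
Proof.
rewrite dcube_box; apply: etrans (@lebesgueRn_box R n
  (fun i => `[dcorner k p ord0 i, dcorner k p ord0 i + side k[%classic) _) _.
  by move=> i; exact: measurable_itv.
transitivity (\prod_(i < n) (side k)%:E)%E.
  apply: eq_bigr => i _; rewrite lebesgue_measure_itv/= lte_fin -EFinD.
  by rewrite addrAC subrr add0r ltrDl side_gt0.
by rewrite prodEFin prodr_const card_ord.
Qed.

Lemma dcube_close k x y : dindex k x = dindex k y ->
  forall i, `|x ord0 i - y ord0 i| <= side k.
Proof.
move=> xy i; have := congr1 (fun p : 'rV[int]_n => dcorner k p ord0 i) xy => exy.
have hx : dcube k (dindex k x) x by [].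
have hy : dcube k (dindex k x) y by [].
move: hx hy; rewrite dcube_box => /(_ i) + /(_ i); rewrite /= !in_itv/=.
by move=> /andP[h1 h2] /andP[h3 h4]; rewrite ler_norml; apply/andP; split; lra.
Qed.

Lemma dcorner_close k x i : `|x ord0 i - dcorner k (dindex k x) ord0 i| <= side k.
Proof.
have hx : dcube k (dindex k x) x by [].
move: hx; rewrite dcube_box => /(_ i); rewrite /= in_itv/= => /andP[h1 h2].
by rewrite ger0_norm ?subr_ge0//; lra.
Qed.

Lemma dindex_nested j k x y : (j <= k)%N -> dindex k x = dindex k y ->
  dindex j x = dindex j y.
Proof.
move=> jk /rowP xy; apply/rowP => i; have := xy i; rewrite !mxE.
have -> : side j = (2 ^ (k - j))%N%:R * side k.
  rewrite /side natrX mulrCA -[in X in _ * (_ / X)](subnK jk) exprD invfM.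
  by rewrite [X in _ = s * X]mulrA mulfV ?mul1r// expf_neq0.
move: (side_gt0 k) (x ord0 i) (y ord0 i) => + a b; move: (side k) => h h0.
have d0 : 0 < (2 ^ (k - j))%N%:R :> R by rewrite ltr0n expn_gt0.
have E (t : R) (z : int) : (z <= Num.floor (t / ((2 ^ (k - j))%N%:R * h))) =
    (z * (2 ^ (k - j))%N%:Z <= Num.floor (t / h)).
  rewrite !floor_ge_int intrM !ler_pdivlMr// ?mulr_gt0// mulrA.
  by rewrite -[(2 ^ (k - j))%N%:~R]/((2 ^ (k - j))%N%:R).
move=> ab; apply/eqP; rewrite eq_le.
by rewrite E -ab -E lexx E ab -E lexx.
Qed.

(** Described by their points, the maximal cubes are disjoint and cover O at
    once; that each nonempty one is a whole cube is the next lemma. *)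
Definition maximal O k p := [set x | [/\ dindex k x = p, dcube k p `<=` O &
  forall j, (j < k)%N -> ~ dcube j (dindex j x) `<=` O]].

Lemma maximal_dcube O k p x : maximal O k p x -> maximal O k p = dcube k p.
Proof.
move=> [xp pO xm]; apply/seteqP; split => [y []//|y yp]; split => // j jk.
rewrite (@dindex_nested j k y x) ?(ltnW jk)//; first exact: xm.
by rewrite xp.
Qed.

Lemma maximal_inj O j k p q x : maximal O j p x -> maximal O k q x ->
  j = k /\ p = q.
Proof.
move=> [xp pO xm] [xq qO xm']; have jk : j = k.
  case: (ltngtP j k) => // [/xm'|/xm]; first by rewrite xp.
  by rewrite xq.
by split => //; rewrite -xp -xq jk.
Qed.

Lemma maximal_cover O x : open O -> O x -> exists k, maximal O k (dindex k x) x.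
Proof.
move=> oO Ox; have : nbhs x O by exact: open_nbhs_nbhs.
move=> /nbhs_ballP[e /= e0 eO].
have ex : exists k, `[< dcube k (dindex k x) `<=` O >].
  exists (Num.truncn (s / e)).+1; apply/asboolP => y xy; apply: eO.
  rewrite ball_rVE// => i; apply: le_lt_trans (dcube_close (esym xy) i) _.
  rewrite /side ltr_pdivrMr ?exprn_gt0// mulrC -ltr_pdivrMr//.
  by rewrite (lt_trans (truncnS_gt _))// -natrX ltr_nat ltn_expl.
have [k /asboolP kO km] := ex_minnP ex.
exists k; split => // j jk /asboolP/km; rewrite leqNgt jk//.
Qed.

Lemma measurable_maximal O k p : @measurable _ (borel 'rV[R]_n) (maximal O k p).
Proof.
have [->|/set0P[x /maximal_dcube ->]] := eqVneq (maximal O k p) set0.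
  exact: measurable0.
exact: measurable_dcube.
Qed.

(** Since |O| < s^n, no cube of the top level lies in O. A maximal cube thus has
    a parent, which meets the complement of O. *)
Lemma tent_covering O : (0 < n)%N -> open O -> (mu O < (s ^+ n)%:E)%E ->
  exists (c : nat -> 'rV[R]_n) (l : nat -> R),
  [/\ forall j, 0 <= l j <= s,
      tent O `<=` \bigcup_j tent (eball (c j) (3 * Num.sqrt n%:R * l j)) &
      (\sum_(j <oo) (l j ^+ n)%:E <= mu O)%E].
Proof.
move=> n0 oO Os.
(* pickle_inv is injective where it is defined, hence the disjointness of the
   W j; the indices that code no maximal cube get balls of radius 0 *)
pose W j : set 'rV[R]_n := if @pickle_inv (nat * 'rV[int]_n)%type j is Some kp then maximal O kp.1 kp.2
  else set0.
pose c j : 'rV[R]_n := if @pickle_inv (nat * 'rV[int]_n)%type j is Some kp then dcorner kp.1 kp.2 else 0.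
pose l j : R := if @pickle_inv (nat * 'rV[int]_n)%type j is Some kp then
  if `[< maximal O kp.1 kp.2 !=set0 >] then side kp.1 else 0 else 0.
have mW j : @measurable _ (borel 'rV[R]_n) (W j).
  rewrite /W; case: (pickle_inv _) => [kp|]; last exact: measurable0.
  exact: measurable_maximal.
have Wl j : mu (W j) = (l j ^+ n)%:E.
  rewrite /W /l; case: (pickle_inv _) => [kp|]; last by rewrite measure0 expr0n gtn_eqF.
  case: asboolP => [[x /maximal_dcube ->]|]; first exact: lebesgueRn_dcube.
  by move=> /set0P/negP/negPn/eqP ->; rewrite measure0 expr0n gtn_eqF.
have WO j : W j `<=` O.
  rewrite /W; case: (pickle_inv _) => [kp|//] x [xp pO _].
  by apply: pO.
exists c, l; split => [j| |].
- rewrite /l; case: (pickle_inv _) => [kp|]; last by rewrite lexx ltW.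
  by case: asboolP => _; rewrite ?lexx ?(ltW s0)// side_le ltW ?side_gt0.
- move=> z Tz; have [Oz _] := Tz; have [k xm] := maximal_cover oO Oz.
  set x := (set_val z).1 in xm.
  exists (pickle (k, dindex k x)) => //; rewrite /c /l pickleK_inv/=.
  case: asboolP => [_|]; last by case; exists x.
  apply: (tent_sub_eball (side_gt0 k) oO) Tz => //.
    by move=> i; exact: dcorner_close.
  case: k xm => [|k] [_ kO km].
    suff : ((s ^+ n)%:E <= mu O)%E by rewrite leNgt Os.
    have := lebesgueRn_dcube 0 (dindex 0 x); rewrite /side expr0 divr1 => <-.
    by apply: le_measure => //; rewrite inE; [exact: measurable_dcube|exact: open_measurable_borel].
  have /existsNP[y /not_implyP[xy Oy]] := km k (ltnSn k).
  by exists y => // i; rewrite -sideS; apply: dcube_close; rewrite xy.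
- have -> : (\sum_(j <oo) (l j ^+ n)%:E = \sum_(j <oo) mu (W j))%E.
    by apply: eq_eseriesr => j _; rewrite Wl.
  have mU : @measurable _ (borel 'rV[R]_n) (\bigcup_j W j) by exact: bigcup_measurable.
  rewrite -measure_semi_bigcup//.
    apply: le_measure; rewrite ?inE//; first exact: open_measurable_borel.
    by move=> x [j _ /WO].
  move=> i j _ _ [x []]; rewrite /W.
  case ei: (pickle_inv i) => [[k p]|//]; case ej: (pickle_inv j) => [[k' p']|//].
  move=> /= h1 h2; have [ek ep] := maximal_inj h1 h2.
  have := @pickle_invK (nat * 'rV[int]_n)%type j.
  have := @pickle_invK (nat * 'rV[int]_n)%type i.
  by rewrite ei ej/= ek ep => -> ->.
Qed.

End dyadic_cubes.

(** * The gauge function *)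

Section gauge.
Context {R : realType}.
Implicit Types (s t u v : R).

Lemma quasi_increasing (Phi : R -> R) :
  (exists Psi : R -> R,
     [/\ forall s, 0 <= s -> 0 <= Psi s,
         forall s t, 0 <= s -> s < t -> Psi s < Psi t &
         comparable_on [set s : R | 0 <= s] (EFin \o Phi) (EFin \o Psi)]) ->
  exists2 c : R, 0 < c & forall s t, 0 <= s -> s <= t -> Phi s <= c * Phi t.
Proof.
move=> [Psi [_ Psi_incr [[a a0 Ha] [b b0 Hb]]]].
exists (a * b); first exact: mulr_gt0.
move=> s t s0 st; have t0 : 0 <= t by exact: le_trans st.
have := Ha s s0; have := Hb t t0; rewrite /= -!EFinM !lee_fin => h1 h2.
apply: (le_trans h2); rewrite -mulrA ler_wpM2l ?(ltW a0)//.
apply: le_trans h1; move: st; rewrite le_eqVlt => /predU1P[->//|st].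
exact/ltW/Psi_incr.
Qed.

Variables (Phi : R -> R) (n : nat) (p : R).
Hypothesis p0 : 0 < p.
Hypothesis Phi_gt0 : forall s, 0 < s -> 0 < Phi s.
Variable c1 : R.
Hypothesis c1_gt0 : 0 < c1.
Hypothesis Phi_incr : forall s t, 0 <= s -> s <= t -> Phi s <= c1 * Phi t.
Hypothesis Phi_dbl : forall c, 0 < c ->
  comparable_on [set s : R | 0 < s] (fun s => (Phi (c * s))%:E) (fun s => (Phi s)%:E).

Lemma gauge_scale c : 0 < c -> exists2 d : R, 0 < d &
  forall s, 0 < s -> Phi (c * s) <= d * Phi s.
Proof. by move=> /Phi_dbl[[d d0 Hd] _]; exists d.
Qed.

(** The integral over ]0, s[ is at least that over [u/2, u[, where the
    integrand is comparable to its value at u. *)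
Lemma gauge_ratio :
  dominated_on [set s : R | 0 < s]
    (fun s => (\int[lebesgue_measure]_(u in [set u : R | (0 < u < s)%R])
                ((Phi u / u ^+ n) `^ p / u)%R%:E)%E)
    (fun s => ((Phi s / s ^+ n) `^ p)%:E) ->
  exists2 C : R, 0 < C & forall u s, 0 < u -> u <= s ->
    Phi u / u ^+ n <= C * (Phi s / s ^+ n).
Proof.
move=> [c c0 Hc]; have [d d0 Hd] := gauge_scale (ltr0n R 2).
pose e := d * c1; have e0 : 0 < e by exact: mulr_gt0.
have c20 : 0 < 2 * c by exact: mulr_gt0.
exists (e * (2 * c) `^ p^-1); first by rewrite mulr_gt0 ?powR_gt0.
move=> u s u0 us; have s0 : 0 < s by exact: lt_le_trans us.
set X := Phi u / u ^+ n; set Y := Phi s / s ^+ n.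
have X0 : 0 < X by rewrite divr_gt0 ?Phi_gt0 ?exprn_gt0.
have Y0 : 0 < Y by rewrite divr_gt0 ?Phi_gt0 ?exprn_gt0.
have eX : 0 < X / e by exact: divr_gt0.
have low v : u / 2 <= v -> v < u -> (X / e) `^ p / u <= (Phi v / v ^+ n) `^ p / v.
  move=> uv vu; have u20 : 0 < u / 2 by exact: divr_gt0.
  have v0 : 0 < v by exact: lt_le_trans uv.
  have vP : 0 < Phi v / v ^+ n by rewrite divr_gt0 ?Phi_gt0 ?exprn_gt0.
  apply: ler_pM; rewrite ?powR_ge0 ?invr_ge0 ?(ltW u0)//; last first.
    by rewrite lef_pV2 ?posrE// ltW.
  apply: ge0_ler_powR; rewrite ?nnegrE ?(ltW p0) ?(ltW eX) ?(ltW vP)//.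
  rewrite /X mulrAC; apply: ler_pM.
  - by rewrite divr_ge0 ?ltW// Phi_gt0.
  - by rewrite invr_ge0 exprn_ge0// ltW.
  - rewrite ler_pdivrMr// mulrC /e -mulrA.
    have -> : Phi u = Phi (2 * (u / 2)) by rewrite mulrC divfK.
    apply: (le_trans (Hd _ u20)); apply: ler_wpM2l; first exact: ltW.
    by apply: Phi_incr => //; exact: ltW.
  - by rewrite lef_pV2 ?posrE ?exprn_gt0// lerXn2r ?nnegrE// ltW.
pose I := `[u / 2, u[%classic.
have mI : measurable I by exact: measurable_itv.
have k0 : 0 <= (X / e) `^ p / u by rewrite divr_ge0 ?powR_ge0// ltW.
have Iu : lebesgue_measure I = (u / 2)%:E.
  rewrite lebesgue_measure_itv/= lte_fin -EFinD.
  by rewrite ltr_pdivrMr// ltr_pMr// ltr1n; congr EFin; lra.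
have key : (((X / e) `^ p / u * (u / 2))%:E <= c%:E * (Y `^ p)%:E)%E.
  apply: le_trans (Hc s s0); rewrite EFinM -Iu -(integral_scaled_indic k0 mI).
  have -> : (\int[lebesgue_measure]_t (((X / e) `^ p / u)%:E * (\1_I t)%:E) =
     \int[lebesgue_measure]_(t in [set u : R | (0 < u < s)%R])
       (((X / e) `^ p / u)%:E * (\1_I t)%:E))%E.
    rewrite [RHS]integral_mkcond; apply: eq_integral => t _; rewrite patchE.
    case: ifPn => //; rewrite notin_setE/= => nt; rewrite indicE memNset ?mule0//.
    rewrite /I/= in_itv/= => /andP[h1 h2]; apply: nt; apply/andP; split; last lra.
    by apply: lt_le_trans h1; exact: divr_gt0.
  apply: ge0_le_integral_nomeas => t /= /andP[t0 ts].
    by rewrite mule_ge0 ?lee_fin.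
  rewrite -EFinM lee_fin indicE; case: (boolP (t \in I)) => h /=.
    move: h; rewrite inE /I/= in_itv/= => /andP[h1 h2].
    by rewrite mulr1; exact: low.
  by rewrite mulr0 divr_ge0 ?powR_ge0// ltW.
have {}key : (X / e) `^ p <= 2 * c * Y `^ p.
  move: key; rewrite -EFinM lee_fin => key.
  have E : (X / e) `^ p / u * (u / 2) = (X / e) `^ p / 2.
    by rewrite mulrA divfK ?gt_eqF.
  by move: key; rewrite E ler_pdivrMr// => /le_trans; apply; rewrite mulrAC (mulrC c).
have := @ge0_ler_powR R p^-1 _ _ _ _ _ key.
rewrite invr_ge0 (ltW p0) !nnegrE powR_ge0 mulr_ge0 ?powR_ge0 ?(ltW c20)//.
move=> /(_ isT isT isT).
have -> : (2 * c * Y `^ p) `^ p^-1 = (2 * c) `^ p^-1 * Y.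
  by rewrite powRM ?powR_ge0 ?(ltW c20)// -powRrM mulfV ?gt_eqF// powRr1// ltW.
rewrite -powRrM mulfV ?gt_eqF// powRr1 ?(ltW eX)//.
by rewrite ler_pdivrMr// mulrC mulrA.
Qed.

End gauge.

(** * Comparison of the two classes of measures *)

Section capacity_volume.
Context {R : realType}.
Variables (n m : nat) (alpha : R) (q : \bar R).
Hypotheses (n0 : (0 < n)%N) (m0 : (0 < m)%N) (a0 : 0 < alpha).
Hypotheses (an : alpha < n%:R) (am : alpha < m%:R) (q0 : (0 < q)%E).
Local Notation mu := (@lebesgueRn R n).

Lemma besov_norm_ge0 (f : 'rV[R]_n -> R) : (0 <= besov_norm m alpha q f)%E.
Proof.
rewrite /besov_norm /interp_norm; case: q => [r| |//]; first exact: poweR_ge0.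
apply: le_trans (_ : (0 <= ((1%R : R) `^ (- (alpha / m%:R)))%:E *
    Kfun L1 (w1 m) (@L1norm R n) (wnorm m) 1 f)%E) _.
  by rewrite mule_ge0 ?lee_fin ?powR_ge0//; exact: (Kfun_ge0 _ _ L1norm_ge0 (@wnorm_ge0 R n m)).
by apply: ereal_sup_ubound; exists 1 => /=.
Qed.

Lemma cap_ge0 (O : set 'rV[R]_n) : (0 <= cap m alpha q O)%E.
Proof. by apply: le_ereal_inf_tmp => _ [f _ <-]; exact: besov_norm_ge0. Qed.

(** The isocapacitary inequality: a competitor of norm less than N satisfies
    K(h^m, f) <= B N h^alpha and is at least 1 on O. *)
Lemma volume_le_cap : exists2 C : R, 0 < C & forall (O : set 'rV[R]_n) (N : R),
  open O -> 0 < N -> (cap m alpha q O < N%:E)%E ->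
  (mu O <= (C * N `^ (n%:R / (n%:R - alpha)))%:E)%E.
Proof.
have [C C0 HC] := @measure_superlevel_le R n m m0 n0 alpha a0 an.
have mR0 : 0 < m%:R :> R by rewrite ltr0n.
have th0 : 0 < alpha / m%:R by exact: divr_gt0.
have [B B0 HB] := Kfun_le_interp (L1 : set ('rV[R]_n -> R)) (w1 m) L1norm_ge0 (@wnorm_ge0 R n m) th0 q0.
exists (C * B `^ (n%:R / (n%:R - alpha))); first by rewrite mulr_gt0 ?powR_gt0.
move=> O N oO N0 /ereal_inf_lt[_ [f [sf _ f1] <-] fN].
rewrite -mulrA -powRM ?(ltW B0) ?(ltW N0)//.
apply: (HC f) => //; first exact: mulr_gt0; last exact: open_measurable_borel.
move=> h h0; have hm : 0 < h ^+ m by exact: exprn_gt0.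
have E : (h ^+ m) `^ (- (alpha / m%:R)) = h `^ (- alpha).
  rewrite -powR_mulrn ?(ltW h0)// -powRrM mulrN; congr (_ `^ - _).
  by rewrite mulrC divfK// gt_eqF.
have ha : 0 < h `^ alpha by exact: powR_gt0.
have := HB (h ^+ m) f hm; rewrite E => Kf.
have K1 : (Kfun L1 (w1 m) (@L1norm R n) (wnorm m) (h ^+ m) f <=
    (h `^ alpha)%:E * (B%:E * besov_norm m alpha q f))%E.
  apply: le_trans (lee_wpmul2l _ Kf); last by rewrite lee_fin ltW.
  rewrite muleA -EFinM -powRD; last by rewrite (gt_eqF h0) implybT.
  by rewrite subrr powRr0 mul1e.
apply: (le_lt_trans K1); rewrite mulrC EFinM lte_pmul2l// EFinM.
by rewrite lte_pmul2l.
Qed.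

End capacity_volume.

Section classes.
Context {R : realType}.
Variables (n m : nat) (alpha : R) (q : \bar R).
Hypotheses (n0 : (0 < n)%N) (m0 : (0 < m)%N) (a0 : 0 < alpha).
Hypotheses (an : alpha < n%:R) (am : alpha < m%:R) (q0 : (0 < q)%E).
Variables (Phi : R -> R) (c1 c2 : R).
Hypothesis Phi0 : Phi 0 = 0.
Hypothesis Phi_gt0 : forall s, 0 < s -> 0 < Phi s.
Hypothesis c1_gt0 : 0 < c1.
Hypothesis Phi_incr : forall s t, 0 <= s -> s <= t -> Phi s <= c1 * Phi t.
Hypothesis Phi_dbl : forall c, 0 < c ->
  comparable_on [set s : R | 0 < s] (fun s => (Phi (c * s))%:E) (fun s => (Phi s)%:E).
Hypothesis c2_gt0 : 0 < c2.
Hypothesis Phi_ratio : forall u s, 0 < u -> u <= s ->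
  Phi u / u ^+ n <= c2 * (Phi s / s ^+ n).
Local Notation leb := (@lebesgueRn R n).

Let na0 : 0 < n%:R - alpha. Proof. by rewrite subr_gt0. Qed.

(** The capacity of a ball of radius rho is at most that of order
    rho^(n-alpha), and dilations change Phi by bounded factors. *)
Lemma CapClass_CClass : @CapClass R n m alpha q (fun s => Phi (s `^ (1 / (n%:R - alpha))))
  `<=` @CClass R n Phi.
Proof.
move=> mu [c c0 Hc]; have [C C0 HC] := cap_eball_le n a0 m0 am q0.
pose D := C `^ (1 / (n%:R - alpha)); have D0 : 0 < D by exact: powR_gt0.
have [d d0 Hd] := gauge_scale Phi_dbl D0.
exists (c * (c1 * d)); first by rewrite !mulr_gt0.
move=> [x rho] /= rho0; have cle := HC x rho rho0.
have cfin : (cap m alpha q (eball x rho) < +oo)%E by rewrite (le_lt_trans cle)// ltry.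
have := Hc (eball x rho) (conj (@open_eball R n x rho) cfin) => /= /le_trans; apply.
rewrite -!EFinM !lee_fin -mulrA; apply: ler_wpM2l; first exact: ltW.
rewrite -mulrA; apply: (le_trans _ (ler_wpM2l (ltW c1_gt0) (Hd _ rho0))).
apply: Phi_incr; first exact: powR_ge0.
have {}cle : fine (cap m alpha q (eball x rho)) <= C * rho `^ (n%:R - alpha).
  by rewrite -lee_fin fineK// ge0_fin_numE// cap_ge0.
have -> : D * rho = (C * rho `^ (n%:R - alpha)) `^ (1 / (n%:R - alpha)).
  rewrite powRM ?powR_ge0 ?(ltW C0)// -powRrM mul1r mulfV ?gt_eqF//.
  by rewrite powRr1 ?(ltW rho0)// /D mul1r.
apply: ge0_ler_powR => //; first by rewrite divr_ge0// ltW.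
- by rewrite nnegrE fine_ge0// cap_ge0.
- by rewrite nnegrE mulr_ge0 ?powR_ge0// ltW.
Qed.

Lemma tent_eball0 (x : 'rV[R]_n) (rho : R) : rho <= 0 -> tent (eball x rho) = set0.
Proof.
move=> r0; apply/seteqP; split => // z [] /=.
by rewrite /eball/= => /lt_le_trans/(_ r0); rewrite ltNge enorm_ge0.
Qed.

(** A cube of side l <= s contributes at most Phi(l) <= C l^n Phi(s) / s^n, and
    the l^n add up to at most |O|. *)
Lemma tent_volume_le (mu : borel_measure R n) : @CClass R n Phi mu ->
  exists2 C : R, 0 < C & forall (O : set 'rV[R]_n) s, open O -> 0 < s ->
    (leb O < (s ^+ n)%:E)%E -> (mu (tent O) <= (C * Phi s)%:E)%E.
Proof.
move=> [c c0 Hc]; pose A : R := 3 * Num.sqrt n%:R.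
have A0 : 0 < A by rewrite mulr_gt0// sqrtr_gt0 ltr0n.
have [d d0 Hd] := gauge_scale Phi_dbl A0.
exists (c * d * c2); first by rewrite !mulr_gt0.
move=> O s oO s0 Os; have [x [l [ls cov suml]]] := tent_covering s0 n0 oO Os.
have sn0 : 0 < s ^+ n by exact: exprn_gt0.
have mT (U : set 'rV[R]_n) : open U -> measurable (tent U : set (borel (halfspace R n))).
  by move=> oU; apply: sub_sigma_algebra; exact: open_tent.
have ball_le j : (mu (tent (eball (x j) (A * l j))) <=
    (c * d * c2 * (Phi s / s ^+ n))%:E * (l j ^+ n)%:E)%E.
  have /andP[l0 ljs] := ls j; move: l0; rewrite le_eqVlt => /predU1P[<-|l0].
    by rewrite mulr0 tent_eball0// measure0 expr0n gtn_eqF// mule0.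
  have := Hc (x j, A * l j) (mulr_gt0 A0 l0) => /= /le_trans; apply.
  rewrite -!EFinM lee_fin -(mulrA (c * d)) -2!(mulrA c).
  apply: ler_wpM2l; first exact: ltW.
  rewrite -mulrA; apply: (le_trans (Hd _ l0)); apply: ler_wpM2l; first exact: ltW.
  have := Phi_ratio l0 ljs; rewrite ler_pdivrMr ?exprn_gt0// => /le_trans; exact.
apply: (@le_trans _ _ (\sum_(j <oo) mu (tent (eball (x j) (A * l j))))%E).
  apply: (@measure_sigma_subadditive _ R _ mu _ _ _ _ cov); last exact: mT.
  by move=> j; apply: mT; exact: (@open_eball R n).
apply: (@le_trans _ _ (\sum_(j <oo) (c * d * c2 * (Phi s / s ^+ n))%:E * (l j ^+ n)%:E)%E).
  by apply: lee_nneseries => [j _ _|j _]; [exact: measure_ge0|exact: ball_le].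
have k0 : 0 <= c * d * c2 * (Phi s / s ^+ n).
  by rewrite !mulr_ge0 ?invr_ge0 ?ltW// Phi_gt0.
rewrite nneseriesZl; last first.
  by move=> j _; rewrite lee_fin exprn_ge0//; case/andP: (ls j).
apply: (@le_trans _ _ ((c * d * c2 * (Phi s / s ^+ n))%:E * (s ^+ n)%:E)%E).
  apply: lee_wpmul2l; first by rewrite lee_fin.
  exact: le_trans suml (ltW Os).
by rewrite -EFinM lee_fin mulrA divfK// gt_eqF.
Qed.

Lemma CClass_CapClass : @CClass R n Phi `<=`
  @CapClass R n m alpha q (fun s => Phi (s `^ (1 / (n%:R - alpha)))).
Proof.
move=> mu Cmu; have [C C0 HC] := tent_volume_le Cmu.
have [V V0 HV] := volume_le_cap n0 m0 a0 an q0.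
pose b := 1 / (n%:R - alpha); have b0 : 0 < b by exact: divr_gt0.
pose M := V + 1; have M1 : 1 <= M by rewrite lerDr ltW.
have M0 : 0 < M by exact: lt_le_trans M1.
have [d d0 Hd] := gauge_scale Phi_dbl M0.
(* the side s = M N^(1/(n-alpha)) satisfies |O| < s^n because V < M <= M^n *)
have main (O : set 'rV[R]_n) N : open O -> 0 < N -> (cap m alpha q O < N%:E)%E ->
    (mu (tent O) <= (C * d * Phi (N `^ b))%:E)%E.
  move=> oO N0 ON; have Nb : 0 < N `^ b by exact: powR_gt0.
  apply: (@le_trans _ _ (C * Phi (M * N `^ b))%:E); last first.
    rewrite lee_fin -mulrA; apply: ler_wpM2l; first exact: ltW.
    exact: Hd.
  apply: HC => //; first exact: mulr_gt0.
  apply: (le_lt_trans (HV O N oO N0 ON)); rewrite lte_fin exprMn.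
  have -> : (N `^ b) ^+ n = N `^ (n%:R / (n%:R - alpha)).
    by rewrite -powR_mulrn ?powR_ge0// -powRrM; congr (_ `^ _); rewrite /b mul1r mulrC.
  rewrite ltr_pM2r ?powR_gt0//; apply: (@lt_le_trans _ _ M); first by rewrite ltrDl.
  by rewrite -[X in X <= _]expr1 ler_weXn2l.
have [e e0 He] := gauge_scale Phi_dbl (powR_gt0 b (ltr0n R 2)).
exists (C * d * e); first by rewrite !mulr_gt0.
move=> O [oO Ofin].
have capE : cap m alpha q O = (fine (cap m alpha q O))%:E.
  by rewrite fineK// ge0_fin_numE// cap_ge0.
have cap0 : 0 <= fine (cap m alpha q O) by rewrite fine_ge0// cap_ge0.
move: capE cap0; set k := fine (cap m alpha q O) => capE.
rewrite le_eqVlt => /predU1P[k0|k0]; last first.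
  have := main O (2 * k) oO (mulr_gt0 (ltr0n R 2) k0).
  rewrite capE lte_fin ltr_pMl// ltr1n => /(_ isT)/le_trans; apply.
  rewrite -EFinM lee_fin -(mulrA (C * d)); apply: ler_wpM2l.
    by rewrite mulr_ge0 ?ltW.
  by rewrite powRM ?(ltW k0)//; apply: He; exact: powR_gt0.
(* for a null capacity N is arbitrary, and Phi(v) <= c2 v^n Phi(1) tends to 0
   with v = N^(1/(n-alpha)) *)
rewrite -k0 powR0 ?gt_eqF// Phi0 mule0.
have small v : 0 < v -> v <= 1 -> (mu (tent O) <= (C * d * c2 * Phi 1 * v)%:E)%E.
  move=> v0 v1; have vN : 0 < v `^ (n%:R - alpha) by exact: powR_gt0.
  apply: le_trans (main O _ oO vN _) _; first by rewrite capE -k0 lte_fin.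
  have -> : (v `^ (n%:R - alpha)) `^ b = v.
    by rewrite -powRrM /b mul1r mulfV ?gt_eqF// powRr1// ltW.
  rewrite lee_fin -!(mulrA (C * d)); apply: ler_wpM2l; first by rewrite mulr_ge0 ?ltW.
  have := Phi_ratio v0 v1; rewrite ler_pdivrMr ?exprn_gt0// expr1n divr1 => /le_trans.
  apply; apply: ler_wpM2l; first by rewrite mulr_ge0 ?(ltW c2_gt0)// ltW// Phi_gt0.
  by rewrite -[X in _ <= X]expr1 ler_wiXn2l// ltW.
set K := C * d * c2 * Phi 1 in small.
have K0 : 0 < K by rewrite !mulr_gt0// Phi_gt0.
apply/lee_addgt0Pr => eps eps0; rewrite add0e.
have v0 : 0 < Num.min 1 (eps / K) by rewrite lt_min ltr01 divr_gt0.
apply: le_trans (small _ v0 _) _; first by rewrite ge_min lexx.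
by rewrite lee_fin mulrC -ler_pdivlMr// ge_min lexx orbT.
Qed.

End classes.

Theorem theorem2p4 (R : realType) (n m : nat) (alpha r : R) (q : \bar R)
    (Phi : R -> R) :
  (1 <= n)%N ->
  0 < alpha < n%:R ->
  (0 < q)%E ->
  1 / r = 1 - alpha / n%:R ->
  (* m is the order of the Sobolev space used to define the Besov norm *)
  (0 < m)%N -> alpha < m%:R ->
  Phi @` [set s : R | 0 <= s] = [set s : R | 0 <= s] ->
  (forall s, 0 < s -> 0 < Phi s) ->
  (exists Psi : R -> R,
     [/\ forall s, 0 <= s -> 0 <= Psi s,
         forall s t, 0 <= s -> s < t -> Psi s < Psi t &
         comparable_on [set s : R | 0 <= s] (EFin \o Phi) (EFin \o Psi)]) ->
  Phi 0 = 0 ->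
  (forall c, 0 < c ->
     comparable_on [set s : R | 0 < s] (fun s => (Phi (c * s))%:E) (fun s => (Phi s)%:E)) ->
  dominated_on [set s : R | 0 < s]
    (fun s => (\int[lebesgue_measure]_(u in [set u : R | (0 < u < s)%R])
                ((Phi u / u ^+ n) `^ (1 / r) / u)%R%:E)%E)
    (fun s => ((Phi s / s ^+ n) `^ (1 / r))%:E) ->
  @CapClass R n m alpha q (fun s => Phi (s `^ (1 / (n%:R - alpha)))) =
  @CClass R n Phi.
Proof.
move=> n0 /andP[a0 an] q0 rE m0 am _ Phi_gt0 Phi_psi Phi0 Phi_dbl Phi_int.
have [c1 c10 Phi_incr] := quasi_increasing Phi_psi.
have r0 : 0 < 1 / r by rewrite rE subr_gt0 ltr_pdivrMr ?mul1r ?ltr0n.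
have [c2 c20 Phi_ratio] := gauge_ratio r0 Phi_gt0 c10 Phi_incr Phi_dbl Phi_int.
apply/seteqP; split.
- exact: (CapClass_CClass m0 a0 an am q0 c10 Phi_incr Phi_dbl).
- exact: (CClass_CapClass n0 m0 a0 an q0 Phi0 Phi_gt0 Phi_dbl c20 Phi_ratio).
Qed.
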